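(* Let $\Omega$ be a subset of the open unit disk $\mathbf D$ containing the point $w_0$ and at least one other point. Define $S:\Omega\to\mathbf C$ by $S(w_0)=1$ and $S(z)=0$ for $z\in\Omega\setminus\{w_0\}$. Then the kernel $$K_S(w,z)=\frac{1-S(z)\overline{S(w)}}{1-z\bar w}\qquad (w,z\in\Omega)$$ has exactly one negative square, and the following statements are equivalent: (1) The function $S(z)$ is the restriction to $\Omega$ of a function in the generalized Schur class $\mathbf S_1$. (2) The set $\Omega$ is a Blaschke sequence.
   Context: A Hermitian kernel $K(w,z)$ on $\Omega\times\Omega$ has $\kappa$ negative squares if every matrix $(K(w_j,w_i))_{i,j=1}^n$ with $w_1,\dots,w_n\in\Omega$ has at most $\kappa$ negative eigenvalues (counting multiplicity) and some such matrix has exactly $\kappa$. For an integer $\kappa\ge 0$, the (scalar) generalized Schur class $\mathbf S_\kappa$ is the set of complex-valued functions $S(z)$ which are holomorphic on some subregion of $\mathbf D$ and such that the kernel $\frac{1-S(z)\overline{S(w)}}{1-z\bar w}$ on that subregion has $\kappa$ negative squares. Such functions extend meromorphically to $\mathbf D$, and a generalized Schur function is identified with its meromorphic extension to $\mathbf D$; that $S$ on $\Omega$ is the restriction of such a function $\hat S$ means that $\hat S$ is holomorphic at every point of $\Omega$ and agrees there with $S$. A set $\Omega\subset\mathbf D$ is a Blaschke sequence if its points can be arranged in a finite or infinite sequence $z_1,z_2,\dots$ with $\sum_n(1-|z_n|^2)<\infty$. *)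

(* Defs.v *)
From HB Require Import structures.
From mathcomp Require Import all_boot all_order all_algebra.
From mathcomp Require Import complex.
From mathcomp Require Import all_classical all_reals all_analysis.

Set Implicit Arguments.
Unset Strict Implicit.
Unset Printing Implicit Defensive.

Import Order.TTheory GRing.Theory Num.Theory.
Import numFieldNormedType.Exports.

Local Open Scope classical_set_scope.
Local Open Scope ring_scope.

Section GeneralizedSchur.
Variable C : numClosedFieldType.
Implicit Types (U Omega : set C) (f F : C -> C) (K : C -> C -> C).

(* The sequence of roots of the characteristic polynomial, each repeated
   according to its multiplicity (unique up to permutation). *)
Definition eigenvalues n (A : 'M[C]_n) : seq C :=
  sval (closed_field_poly_normal (char_poly A)).

(* In the partial order of [C], [x < 0] says that [x] is real and negative. *)
Definition num_neg_eigenvalues n (A : 'M[C]_n) : nat :=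
  count (fun x => x < 0) (eigenvalues A).

Definition hermitian_kernel Omega K : Prop :=
  forall w z, Omega w -> Omega z -> K z w = (K w z)^*.

Definition kernel_matrix K n (w : 'I_n -> C) : 'M[C]_n :=
  \matrix_(i, j) K (w j) (w i).

Definition has_neg_squares Omega K (kappa : nat) : Prop :=
  [/\ hermitian_kernel Omega K,
      forall n (w : 'I_n -> C), (forall i, Omega (w i)) ->
        (num_neg_eigenvalues (kernel_matrix K w) <= kappa)%N
    & exists n (w : 'I_n -> C), (forall i, Omega (w i)) /\
        num_neg_eigenvalues (kernel_matrix K w) = kappa].

Definition schur_kernel f : C -> C -> C :=
  fun w z => (1 - f z * (f w)^*) / (1 - z * w^*).

Definition unit_disk : set C := [set z | `|z| < 1].

Definition region U : Prop := [/\ open U, connected U & U !=set0].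

Definition holomorphic_at f (a : C) : Prop :=
  \forall z \near a, derivable f z 1.

Definition holomorphic_on U f : Prop := forall a, U a -> holomorphic_at f a.

(* [f] is a total function whose value at an exceptional point (a pole or a
   removable singularity) is arbitrary. *)
Definition meromorphic_on U f : Prop :=
  forall a, U a -> exists (n : nat) (g : C -> C),
    holomorphic_at g a /\ \forall z \near a^', f z = g z / (z - a) ^+ n.

(* A generalized Schur function is identified with its meromorphic extension
   to the disk, so the members of the class are taken to be functions
   meromorphic on the whole disk. *)
Definition generalized_schur (kappa : nat) F : Prop :=
  meromorphic_on unit_disk F /\
  exists U, [/\ region U, U `<=` unit_disk, holomorphic_on U F
    & has_neg_squares U (schur_kernel F) kappa].

Definition restriction_of_generalized_schur (kappa : nat) Omega f : Prop :=
  exists F, generalized_schur kappa F /\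
    forall z, Omega z -> holomorphic_at F z /\ F z = f z.

End GeneralizedSchur.

Definition blaschke_sequence (R : realType) (Omega : set R[i]) : Prop :=
  finite_set Omega \/
  exists z : nat -> R[i], [/\ injective z, range z = Omega
    & cvgn (series (fun n => 1 - Normc.normc (z n) ^+ 2))].

(* Main.v *)
Require Import Defs.
From mathcomp Require Import all_boot all_order all_algebra.
From mathcomp Require Import complex.
From mathcomp Require Import all_classical all_reals all_analysis.
From mathcomp Require Import ring lra.
Set Implicit Arguments.
Unset Strict Implicit.
Unset Printing Implicit Defensive.
Import Order.TTheory GRing.Theory Num.Theory.
Import numFieldNormedType.Exports.
Local Open Scope classical_set_scope.
Local Open Scope ring_scope.


(** The kernel of [S] is the Szego kernel [k(w,z) = 1 / (1 - w^* z)] minus a term of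
    rank one, so it has at most one negative square; the diagonal entry at [w0]
    is zero while the entry at [(w0, w1)] is not, so it has exactly one.

    If [Omega] is a Blaschke sequence, let [B] be a Schur function that vanishes
    on [Omega] except at [w0], where it does not vanish.  Divide it by the
    Blaschke factor of a point [al] close to [w0], and normalize: for [al] close
    enough the normalized numerator is still a Schur function.  The quotient has
    at most one negative square because the kernel of a Blaschke factor has rank
    one, and it has one because it is large near [al]
    ([blaschke_restriction]).

    Conversely let [F] in the class [S_1] agree with [S] on [Omega].  On every
    finite subset of the region of [F], a count of negative eigenvalues gives a
    polynomial [p] of degree at most one and norm one such that [F p] is
    interpolated by a function of norm at most one in the Hardy space
    ([hardy_interpolation]).  In the limit there is [g] in the Hardy space with
    [g = F p] on the region ([hardy_multiple]), hence on the disk away from the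
    poles by unique continuation ([meromorphic_identity]).  So [g] vanishes on
    [Omega] except at [w0], but it is not zero since [F w0 = 1]; and the zeros
    of [g] satisfy the Blaschke condition ([zeros_summable]).

    The Hardy space appears only through its kernel: a function [g] is
    dominated by [c] when the kernel [c k(w,z) - g(z) g(w)^*] is positive.  The
    key fact is that dividing by the Blaschke factor of a zero preserves this
    ([dominated_div], a Schur complement).  It bounds Blaschke products below
    at points where [g] does not vanish, and it shows that dominated functions
    are holomorphic ([dominated_cdiff]).  Limits are taken along ultrafilters on
    the finite subsets of a set; the conditions defining the Hardy space and the
    Schur class are stable under such pointwise limits, so infinite Blaschke
    products are never expanded.

    Holomorphy means differentiability at every point, so unique continuation
    requires Goursat's theorem.  It is proved by bisection of rectangles, with
    antiderivatives along horizontal and vertical lines in place of contour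
    integrals, and yields primitives ([primitive_estimate]).  A primitive has
    second order expansions, which are enough for the maximum modulus principle
    ([maximum_modulus]); applied to [(P - P v) / (z - v)^n] it gives unique
    continuation ([local_unique_continuation]). *)

(** * Negative eigenvalues of Hermitian matrices *)

Section Inertia.
Local Open Scope sesquilinear_scope.
Variable C : numClosedFieldType.

Lemma char_poly_conjV n (P A : 'M[C]_n) : P \in unitmx ->
  char_poly (invmx P *m A *m P) = char_poly A.
Proof.
move=> Pu; have Qu : map_mx (@polyC C) P \in unitmx by rewrite map_unitmx.
rewrite /char_poly /char_poly_mx.
have -> : 'X%:M - map_mx (@polyC C) (invmx P *m A *m P) =
    invmx (map_mx (@polyC C) P) *m ('X%:M - map_mx (@polyC C) A)
      *m map_mx (@polyC C) P.
  rewrite !map_mxM map_invmx mulmxBr mulmxBl; congr (_ - _).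
  by rewrite -mulmxA -scalar_mxC mulmxA mulVmx ?mul1mx.
rewrite !det_mulmx mulrC mulrA -det_mulmx mulmxV //.
by rewrite det1 mul1r.
Qed.

Lemma num_neg_spectral n (A : 'M[C]_n) : A \is hermsymmx ->
  num_neg_eigenvalues A = #|[pred i | spectral_diag A 0 i < 0]|.
Proof.
move=> Ah; have /hermitian_normalmx/orthomx_spectralP A_eq := Ah.
have eig : perm_eq (eigenvalues A) [seq spectral_diag A 0 i | i <- enum 'I_n].
  rewrite /eigenvalues; case: closed_field_poly_normal => /= r.
  rewrite (eqP (char_poly_monic A)) scale1r => char_r.
  apply: prod_XsubC_eq; rewrite -char_r big_map big_enum /=.
  rewrite {1}A_eq char_poly_conjV ?spectral_unit //.
  rewrite char_poly_trig ?diag_mx_is_trig //.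
  by apply: eq_bigr => i _; rewrite mxE eqxx mulr1n.
rewrite /num_neg_eigenvalues (permP eig) count_map -sum1_count.
by rewrite -sum1_card big_enum_cond.
Qed.

Lemma herm_form_spectral n (A : 'M[C]_n) (x : 'rV_n) : A \is hermsymmx ->
  (x *m A *m x^t*) 0 0 =
  \sum_i spectral_diag A 0 i * `|(x *m (spectralmx A)^t*) 0 i| ^+ 2.
Proof.
move=> Ah; have /hermitian_normalmx/orthomx_spectralP A_eq := Ah.
set P := spectralmx A in A_eq *; set d := spectral_diag A in A_eq *.
have PV : invmx P = P^t* by rewrite invmx_unitary ?spectral_unitarymx.
have -> : x *m A *m x^t* = (x *m P^t*) *m diag_mx d *m (x *m P^t*)^t*.
  rewrite [X in x *m X]A_eq PV trmx_mul map_mxM -map_trmx trmxK -map_mx_comp.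
  rewrite (map_mx_id (@conjCK _)) !mulmxA //.
rewrite mxE; apply: eq_bigr => i _.
by rewrite mul_mx_diag !mxE normCK mulrCA mulrA.
Qed.

(** Two orthogonal eigenvectors with negative eigenvalues would span a plane on
    which the form is negative definite, and this plane meets the hyperplane. *)
Lemma num_neg_le1 n (A : 'M[C]_n) (l : 'cV_n) : A \is hermsymmx ->
  (forall x : 'rV_n, x *m l = 0 -> 0 <= (x *m A *m x^t*) 0 0) ->
  (num_neg_eigenvalues A <= 1)%N.
Proof.
move=> Ah Al; rewrite num_neg_spectral // leqNgt; apply/negP.
move=> /card_gt1P[i [j [di dj ij]]]; move: di dj; rewrite !inE => di dj.
set P := spectralmx A in di dj; set d := spectral_diag A in di dj.
have Pu : P *m P^t* = 1%:M by apply/unitarymxP/spectral_unitarymx.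
pose a := (row i P *m l) 0 0; pose b := (row j P *m l) 0 0.
have [a' [b' [ab nz]]] : exists a' b', a' * a + b' * b = 0 /\
    (a' != 0) || (b' != 0).
  have [a0|a0] := eqVneq a 0.
    by exists 1, 0; rewrite a0 oner_eq0 mulr0 mul0r addr0.
  by exists (- b), a; rewrite a0 orbT mulNr mulrC addNr.
pose y : 'rV_n := a' *: delta_mx 0 i + b' *: delta_mx 0 j.
have yP : y *m P *m l = 0.
  apply/matrixP => p q; rewrite !ord1 mulmxDl mulmxDl -!scalemxAl.
  by rewrite -!rowE [LHS]mxE [X in X + _]mxE [X in _ + X]mxE -/a -/b ab mxE.
have := Al _ yP; rewrite herm_form_spectral // -/P -/d -mulmxA Pu mulmx1.
apply/negP; rewrite lt_geF //.
rewrite (bigD1 i) //= (bigD1 j) 1?eq_sym //= big1 ?addr0; last first.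
  move=> k /andP[ki kj]; rewrite !mxE /= (negPf ki) (negPf kj) !mulr0 addr0.
  by rewrite normr0 expr0n mulr0.
rewrite !mxE /= !eqxx (negPf ij) eq_sym (negPf ij) !mulr0 !mulr1 addr0 add0r.
have le0 (c e : C) : c < 0 -> c * `|e| ^+ 2 <= 0.
  by move=> c0; rewrite mulr_le0_ge0 // ?ltW ?exprn_ge0.
have lt0 (c e : C) : c < 0 -> e != 0 -> c * `|e| ^+ 2 < 0.
  by move=> c0 e0; rewrite nmulr_rlt0 // exprn_gt0 // normr_gt0.
case/orP: nz => nz; first by rewrite ltr_wnDr // ?le0 ?lt0.
by rewrite ltr_wnDl // ?le0 ?lt0.
Qed.

Lemma num_neg_le1_hyperplane n (A : 'M[C]_n) : A \is hermsymmx ->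
  (num_neg_eigenvalues A <= 1)%N ->
  exists l : 'cV_n, forall x : 'rV_n, x *m l = 0 -> 0 <= (x *m A *m x^t*) 0 0.
Proof.
move=> Ah; rewrite num_neg_spectral // => /card_le1P le1.
have dr i : spectral_diag A 0 i \is Num.real.
  exact: (mxOverP (hermitian_spectral_diag_real Ah)).
have [i di|nod] := pickP [pred i | spectral_diag A 0 i < 0].
  exists (col i ((spectralmx A)^t*)) => x xl; rewrite herm_form_spectral //.
  apply: sumr_ge0 => j _.
  have [->|ji] := eqVneq j i.
    have -> : (x *m (spectralmx A)^t*) 0 i = (x *m col i ((spectralmx A)^t*)) 0 0.
      by rewrite !mxE; apply: eq_bigr => k _; rewrite !mxE.
    by rewrite xl mxE normr0 expr0n mulr0.
  have := le1 _ di j; rewrite !inE (negPf ji) real_ltNge ?real0 //.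
  by move/negbFE => ?; rewrite mulr_ge0 ?exprn_ge0.
exists 0 => x _; rewrite herm_form_spectral //.
apply: sumr_ge0 => j _.
have := nod j; rewrite /= real_ltNge ?real0 //.
by move/negbFE => ?; rewrite mulr_ge0 ?exprn_ge0.
Qed.

Lemma num_neg_ge1 n (A : 'M[C]_n) (x : 'rV_n) : A \is hermsymmx ->
  (x *m A *m x^t*) 0 0 < 0 -> (1 <= num_neg_eigenvalues A)%N.
Proof.
move=> Ah; rewrite num_neg_spectral // lt0n; apply: contraTneq => /card0_eq c0.
have dr i : spectral_diag A 0 i \is Num.real.
  exact: (mxOverP (hermitian_spectral_diag_real Ah)).
rewrite -real_leNgt ?real0 //; last first.
  by rewrite herm_form_spectral // rpred_sum // => i _; rewrite realM // ?realX ?normr_real.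
rewrite herm_form_spectral //; apply: sumr_ge0 => j _.
have := c0 j; rewrite /= !inE real_ltNge ?real0 //.
by move/negbFE => ?; rewrite mulr_ge0 ?exprn_ge0.
Qed.
End Inertia.

(** * Kernels as forms on finite combinations of points *)

Section Kernels.
Variable C : numClosedFieldType.
Implicit Types (X : set C) (K : C -> C -> C) (f g : C -> C) (s t : seq (C * C)).

(** A list of pairs (coefficient, point) stands for a finite combination of point
    evaluations.  Repeated points are allowed, as in the matrices that define
    negative squares. *)
Definition form K s t : C :=
  \sum_(p <- s) \sum_(q <- t) p.1 * q.1^* * K q.2 p.2.

Definition pairing g s : C := \sum_(p <- s) p.1 * g p.2.

Definition rescale g s : seq (C * C) := [seq (p.1 * g p.2, p.2) | p <- s].

Definition supported X s : Prop := forall p, p \in s -> X p.2.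

Definition psd X K : Prop := forall s, supported X s -> 0 <= form K s s.

Lemma supported_cat X s t : supported X s -> supported X t -> supported X (s ++ t).
Proof. by move=> sX tX p; rewrite mem_cat => /orP[/sX|/tX]. Qed.

Lemma supported_cons X p s : X p.2 -> supported X s -> supported X (p :: s).
Proof. by move=> pX sX q; rewrite inE => /orP[/eqP->|/sX]. Qed.

Lemma supported_rescale X g s : supported X s -> supported X (rescale g s).
Proof. by move=> sX _ /mapP[p /sX pX ->]. Qed.

Lemma supported_consP X p s : supported X (p :: s) -> X p.2 /\ supported X s.
Proof.
move=> ps; split; first by apply: ps; rewrite mem_head.
by move=> q qs; apply: ps; rewrite inE qs orbT.
Qed.

Lemma form_catl K s1 s2 t : form K (s1 ++ s2) t = form K s1 t + form K s2 t.
Proof. by rewrite /form big_cat. Qed.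

Lemma form_catr K s t1 t2 : form K s (t1 ++ t2) = form K s t1 + form K s t2.
Proof.
by rewrite /form -big_split; apply: eq_bigr => p _; rewrite big_cat.
Qed.

Lemma form11 K p q : form K [:: p] [:: q] = p.1 * q.1^* * K q.2 p.2.
Proof. by rewrite /form !big_seq1. Qed.

Lemma form_nil K t : form K [::] t = 0.
Proof. by rewrite /form big_nil. Qed.

Lemma form_rescale K g h s t :
  form K (rescale g s) (rescale h t) =
  form (fun w z => g z * (h w)^* * K w z) s t.
Proof.
rewrite /form big_map; apply: eq_bigr => p _; rewrite big_map.
by apply: eq_bigr => q _ /=; rewrite rmorphM; ring.
Qed.

Lemma eq_form X K K' s t : supported X s -> supported X t ->
  (forall w z, X w -> X z -> K w z = K' w z) -> form K s t = form K' s t.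
Proof.
move=> sX tX KK'; rewrite /form [LHS]big_seq [RHS]big_seq.
apply: eq_bigr => p ps; rewrite [LHS]big_seq [RHS]big_seq.
by apply: eq_bigr => q qt; rewrite KK'; [|exact: tX|exact: sX].
Qed.

Lemma form_conj K s t : (forall w z, K z w = (K w z)^*) ->
  form K t s = (form K s t)^*.
Proof.
move=> Kh; rewrite /form exchange_big /= rmorph_sum; apply: eq_bigr => p _.
rewrite rmorph_sum; apply: eq_bigr => q _ /=.
by rewrite !rmorphM /= conjCK Kh; ring.
Qed.

Lemma formD K K' s t :
  form (fun w z => K w z + K' w z) s t = form K s t + form K' s t.
Proof.
rewrite /form -big_split; apply: eq_bigr => p _; rewrite -big_split.
by apply: eq_bigr => q _ /=; rewrite mulrDr.
Qed.

Lemma formZ c K s t : form (fun w z => c * K w z) s t = c * form K s t.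
Proof.
rewrite /form mulr_sumr; apply: eq_bigr => p _; rewrite mulr_sumr.
by apply: eq_bigr => q _ /=; ring.
Qed.

Lemma form_rank1 g h s t :
  form (fun w z => g z * (h w)^*) s t = pairing g s * (pairing h t)^*.
Proof.
rewrite /form /pairing rmorph_sum mulr_suml; apply: eq_bigr => p _.
by rewrite mulr_sumr; apply: eq_bigr => q _ /=; rewrite rmorphM /=; ring.
Qed.

Lemma formB_rank1 K g s :
  form (fun w z => K w z - g z * (g w)^*) s s = form K s s - `|pairing g s| ^+ 2.
Proof.
rewrite normCK -form_rank1 -[in RHS]mulN1r -formZ -formD.
rewrite /form; apply: eq_bigr => p _; apply: eq_bigr => q _.
by rewrite mulN1r.
Qed.

Lemma pairing_cons g p s : pairing g (p :: s) = p.1 * g p.2 + pairing g s.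
Proof. by rewrite /pairing big_cons. Qed.

Lemma pairing_rescale g h s : pairing g (rescale h s) = pairing (fun z => h z * g z) s.
Proof. by rewrite /pairing big_map; apply: eq_bigr => p _ /=; ring. Qed.

Lemma psd_sub X Y K : X `<=` Y -> psd Y K -> psd X K.
Proof. by move=> XY KY s sX; apply: KY => p /sX/XY. Qed.

Lemma eq_psd X K K' : (forall w z, X w -> X z -> K w z = K' w z) ->
  psd X K -> psd X K'.
Proof. by move=> KK' Kp s sX; rewrite -(eq_form sX sX KK') Kp. Qed.

Lemma psdD X K K' : psd X K -> psd X K' -> psd X (fun w z => K w z + K' w z).
Proof. by move=> Kp Kp' s sX; rewrite formD addr_ge0 ?Kp ?Kp'. Qed.

Lemma psdZ X c K : 0 <= c -> psd X K -> psd X (fun w z => c * K w z).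
Proof. by move=> c0 Kp s sX; rewrite formZ mulr_ge0 ?Kp. Qed.

Lemma psd_rank1 X g : psd X (fun w z => g z * (g w)^*).
Proof. by move=> s _; rewrite form_rank1 -normCK exprn_ge0. Qed.

Lemma psd_rescale X g K : psd X K -> psd X (fun w z => g z * (g w)^* * K w z).
Proof. by move=> Kp s sX; rewrite -form_rescale Kp //; exact: supported_rescale. Qed.

Lemma form_scalel K l s t : form K (rescale (fun=> l) s) t = l * form K s t.
Proof.
rewrite /form big_map mulr_sumr; apply: eq_bigr => p _; rewrite mulr_sumr.
by apply: eq_bigr => q _ /=; ring.
Qed.

Lemma form_scaler K l s t : form K s (rescale (fun=> l) t) = l^* * form K s t.
Proof.
rewrite /form mulr_sumr; apply: eq_bigr => p _; rewrite big_map mulr_sumr.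
by apply: eq_bigr => q _ /=; rewrite rmorphM; ring.
Qed.

Lemma form_CauchySchwarz X K s t : (forall w z, K z w = (K w z)^*) -> psd X K ->
  supported X s -> supported X t ->
  `|form K s t| ^+ 2 <= form K s s * form K t t.
Proof.
move=> Kh Kp sX tX; set A := form K s s; set B := form K s t; set D := form K t t.
have A0 : 0 <= A by exact: Kp.
have D0 : 0 <= D by exact: Kp.
have key (l : C) : 0 <= A + l^* * B + l * B^* + l * l^* * D.
  have := Kp (s ++ rescale (fun=> l) t).
  rewrite form_catl !form_catr !form_scalel !form_scaler (form_conj s t) //.
  rewrite -/A -/B -/D !addrA mulrA; apply.
  by apply: supported_cat => //; exact: supported_rescale.
(* when D vanishes, a large multiple of t makes the form negative unless B = 0 *)
have [D_eq0|Dn0] := eqVneq D 0.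
  rewrite D_eq0 mulr0; have := key (- (A + 1) * B / (`|B| ^+ 2)).
  rewrite D_eq0 mulr0 addr0; have [->|B0] := eqVneq B 0.
    by rewrite normr0 expr0n.
  rewrite !rmorphM /= fmorphV rmorphN rmorphD rmorph1 /= rmorphXn /=.
  rewrite (CrealP (ger0_real A0)) (CrealP (normr_real B)) normCK.
  have -> : A + - (A + 1) * B^* / (B * B^*) * B + - (A + 1) * B / (B * B^*) * B^* =
    - (A + 2).
    by field; rewrite fmorph_eq0 B0.
  by rewrite lt_geF // oppr_lt0 ltr_wpDl.
have := key (- B / D); rewrite !rmorphM /= fmorphV rmorphN /=.
rewrite (CrealP (ger0_real D0)).
have -> : A + - B^* / D * B + - B / D * B^* + - B / D * (- B^* / D) * D =
    A - `|B| ^+ 2 / D by rewrite normCK; field.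
by rewrite subr_ge0 ler_pdivrMr // lt_def Dn0.
Qed.

End Kernels.

(** * The Szego kernel, the Hardy space and the Schur class *)

Section Szego.
Variable C : numClosedFieldType.
Implicit Types (X : set C) (K : C -> C -> C) (f g : C -> C) (s t : seq (C * C)).
Local Notation disk := (unit_disk (C := C)).

Definition szego (w z : C) : C := (1 - z * w^*)^-1.

Definition blaschke (a z : C) : C := (z - a) / (1 - z * a^*).

Lemma diskE z : disk z = (`|z| < 1). Proof. by []. Qed.

Lemma disk_den w z : disk w -> disk z -> 1 - z * w^* != 0.
Proof.
rewrite !diskE => w1 z1; rewrite subr_eq0; apply/eqP => e.
suff : `|1 : C| < 1 by rewrite normr1 ltxx.
by rewrite {1}e normrM norm_conjC mulr_ilt1.
Qed.

Lemma disk_1subnorm a : disk a -> 0 < 1 - a * a^*.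
Proof. by rewrite diskE -normCK subr_gt0 => a1; rewrite exprn_ilt1. Qed.

Lemma szego_conj w z : szego z w = (szego w z)^*.
Proof.
by rewrite /szego fmorphV rmorphB rmorph1 rmorphM /= conjCK [in RHS]mulrC.
Qed.

Lemma szego_diag_gt0 a : disk a -> 0 < szego a a.
Proof. by move=> a1; rewrite invr_gt0 disk_1subnorm. Qed.

Lemma szego_diag a : szego a a = (1 - `|a| ^+ 2)^-1.
Proof. by rewrite normCK. Qed.

(** The Schur complement of the Szego kernel with respect to the point [a] is
    again a Szego kernel, rescaled by the Blaschke factor of [a]. *)
Lemma szego_complement a w z : disk a -> disk w -> disk z ->
  szego w z = blaschke a z * (blaschke a w)^* * szego w z +
    (1 - a * a^*) * (szego a z * (szego a w)^*).
Proof.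
move=> da dw dz; rewrite -szego_conj /szego /blaschke.
rewrite !(rmorphM, rmorphB, fmorphV, rmorph1) /= conjCK.
have := disk_den dw dz; have := disk_den dw da; have := disk_den da dz.
move: (a^*) (w^*) => a' w' h1 h2 h3.
by field; rewrite h1 h2 h3.
Qed.

Lemma form_szego_complement a s : disk a -> supported disk s ->
  form szego s s = form szego (rescale (blaschke a) s) (rescale (blaschke a) s) +
    (1 - a * a^*) * `|pairing (szego a) s| ^+ 2.
Proof.
move=> da ds; rewrite form_rescale normCK -form_rank1 -formZ -formD.
by apply: (eq_form ds ds) => w z dw dz; exact: szego_complement.
Qed.

Lemma form_0cons K a s : form K ((0, a) :: s) ((0, a) :: s) = form K s s.
Proof.
rewrite /form big_cons big1 ?add0r; last by move=> q _; rewrite !mul0r.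
by apply: eq_bigr => p _; rewrite big_cons /= rmorph0 mulr0 mul0r add0r.
Qed.

Lemma blaschke_self a : blaschke a a = 0.
Proof. by rewrite /blaschke subrr mul0r. Qed.

(** Taking the Schur complement with respect to one of the points removes this
    point from the combination and only rescales the other coefficients. *)
Lemma szego_psd : psd disk szego.
Proof.
move=> s; have [n sn] := ubnP (size s); elim: n s sn => // n IH [|[c a] s] /=.
  by rewrite form_nil.
rewrite ltnS => sn ds; have [/= da ds'] := supported_consP ds.
rewrite (form_szego_complement da ds) addr_ge0 //; last first.
  by rewrite mulr_ge0 ?exprn_ge0 // ltW // disk_1subnorm.
rewrite /rescale /= blaschke_self mulr0 form_0cons IH ?size_map //.
exact: supported_rescale.
Qed.

(** The restrictions to [X] of the elements of the Hardy space of squared norm at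
    most [c], described without that space: [c * szego - g g^*] is positive. *)
Definition dominated X g (c : C) : Prop :=
  forall s, supported X s -> `|pairing g s| ^+ 2 <= c * form szego s s.

Lemma dominated_sub X Y g c : X `<=` Y -> dominated Y g c -> dominated X g c.
Proof. by move=> XY gY s sX; apply: gY => p /sX/XY. Qed.

Lemma dominated_norm X g c z : X z -> dominated X g c ->
  `|g z| ^+ 2 <= c * szego z z.
Proof.
move=> Xz /(_ [:: (1, z)]); rewrite form11 /pairing big_seq1 /= rmorph1 !mul1r.
by apply=> p; rewrite inE => /eqP->.
Qed.

Lemma dominated_diff X g c z w : X z -> X w -> dominated X g c ->
  `|g z - g w| ^+ 2 <= c * (szego z z - szego w z - szego z w + szego w w).
Proof.
move=> Xz Xw /(_ [:: (1, z); (-1, w)]).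
rewrite /pairing /form !big_cons !big_nil /= rmorphN rmorph1.
have -> : 1 * g z + (-1 * g w + 0) = g z - g w by ring.
set q := (X in c * X); have -> : q =
    szego z z - szego w z - szego z w + szego w w by rewrite /q; ring.
apply.
by move=> p; rewrite !inE => /orP[]/eqP->.
Qed.

(** The hypothesis is applied with the extra point [a], where [g] vanishes, so
    its coefficient is free; choosing it so that the combination annihilates the
    kernel at [a] replaces the form by its Schur complement, which is the form
    of the combination rescaled by the Blaschke factor.  Hence dividing an
    element of the Hardy space by the Blaschke factor of a zero does not
    increase its norm. *)
Lemma dominated_div X g c a : X `<=` disk -> 0 <= c -> X a -> g a = 0 ->
  dominated X g c -> dominated (X `\ a) (fun z => g z / blaschke a z) c.
Proof.
move=> XD c0 Xa ga gX s sX.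
have da := XD _ Xa.
have b0 p : p \in s -> blaschke a p.2 != 0.
  move=> /sX[/XD dp /eqP pa]; rewrite mulf_neq0 ?subr_eq0 // invr_eq0.
  exact: disk_den.
pose t := rescale (fun z => (blaschke a z)^-1) s.
have tX : supported X t by apply: supported_rescale => p /sX[].
pose al := - (1 - a * a^*) * pairing (szego a) t.
have := gX ((al, a) :: t) (supported_cons Xa tX).
rewrite pairing_cons /= ga mulr0 add0r pairing_rescale.
have -> : pairing (fun z => (blaschke a z)^-1 * g z) s =
    pairing (fun z => g z / blaschke a z) s.
  by apply: eq_bigr => p _; rewrite [_ * g _]mulrC.
rewrite (@form_szego_complement a) //; last first.
  by move=> p /(supported_cons (p:=(al,a)) Xa tX)/XD.
rewrite pairing_cons /= {3}/al /szego -/(szego a).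
have -> : al * (1 - a * a^*)^-1 + pairing (szego a) t = 0.
  rewrite /al mulrAC mulNr mulfV ?mulN1r ?addNr //.
  by rewrite gt_eqF // disk_1subnorm.
rewrite normr0 expr0n mulr0 addr0 blaschke_self mulr0 form_0cons.
suff -> : rescale (blaschke a) t = s by [].
rewrite /t /rescale -map_comp -[RHS]map_id; apply/eq_in_map => -[x y] ps /=.
by rewrite mulfVK // (b0 _ ps).
Qed.

(** The reproducing property: pairing with a combination of kernels is the inner
    product with it, so this is the Cauchy-Schwarz inequality. *)
Lemma dominated_kernels t : supported disk t ->
  dominated disk (fun z => form szego [:: (1, z)] t) (form szego t t).
Proof.
move=> dt s ds; rewrite mulrC.
suff -> : pairing (fun z => form szego [:: (1, z)] t) s = form szego s t.
  exact: (form_CauchySchwarz szego_conj szego_psd).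
rewrite /pairing /form; apply: eq_bigr => p _; rewrite big_seq1 mulr_sumr.
by apply: eq_bigr => q _ /=; ring.
Qed.

Lemma schur_kernelE f w z :
  schur_kernel f w z = szego w z - f z * (f w)^* * szego w z.
Proof. by rewrite /schur_kernel mulrBl mul1r. Qed.

Lemma pairing1_dominated : dominated disk (fun=> 1) 1.
Proof.
have -> : (fun=> 1) = (fun z : C => form szego [:: (1, z)] [:: (1, 0)]).
  by apply/funext => z; rewrite form11 /szego /= rmorph1 rmorph0 mulr0 subr0 invr1 !mulr1.
have {3}-> : (1 : C) = form szego [:: (1, 0)] [:: (1, 0)].
  by rewrite form11 /szego /= rmorph1 rmorph0 mulr0 subr0 invr1 !mulr1.
by apply: dominated_kernels => p; rewrite inE => /eqP->; rewrite diskE normr0.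
Qed.

(** Multiplication by a Schur function is a contraction, and the constant [1] has
    norm one in the Hardy space. *)
Lemma schur_dominated f : psd disk (schur_kernel f) -> dominated disk f 1.
Proof.
move=> fp s ds.
have := fp _ ds; have -> : form (schur_kernel f) s s =
    form szego s s - form szego (rescale f s) (rescale f s).
  rewrite form_rescale -mulN1r -formZ -formD.
  by apply: (eq_form ds ds) => w z _ _; rewrite schur_kernelE mulN1r.
rewrite subr_ge0 mul1r; apply: le_trans.
have := pairing1_dominated (supported_rescale (g := f) ds).
rewrite mul1r pairing_rescale.
by have -> : (fun z => f z * 1) = f by apply/funext => z; rewrite mulr1.
Qed.

Lemma schur_le1 X f z : X z -> disk z -> psd X (schur_kernel f) -> `|f z| <= 1.
Proof.
move=> Xz dz /(_ [:: (1, z)]).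
rewrite form11 /= rmorph1 !mul1r /schur_kernel -!normCK.
rewrite pmulr_lge0 ?invr_gt0 ?subr_gt0 ?exprn_ilt1 //.
rewrite subr_ge0 => h; rewrite -(@expr_le1 _ 2) //; apply: h.
by move=> p; rewrite inE => /eqP->.
Qed.

Lemma schur_mul X f g : psd X (schur_kernel f) -> psd X (schur_kernel g) ->
  psd X (schur_kernel (fun z => f z * g z)).
Proof.
move=> fp gp; have := psdD fp (psd_rescale f gp).
apply: eq_psd => w z _ _; rewrite !schur_kernelE rmorphM /=; ring.
Qed.

Lemma schur1 X : psd X (schur_kernel (fun=> 1)).
Proof.
move=> s sX; rewrite /form big1 // => p _; rewrite big1 // => q _.
by rewrite /schur_kernel rmorph1 mulr1 subrr mul0r mulr0.
Qed.

Lemma blaschke_kernel a w z : disk a -> disk w -> disk z ->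
  schur_kernel (blaschke a) w z = (1 - a * a^*) * (szego a z * (szego a w)^*).
Proof.
move=> da dw dz.
by rewrite schur_kernelE {1}(szego_complement da dw dz) addrC addKr.
Qed.

Lemma blaschke_schur a : disk a -> psd disk (schur_kernel (blaschke a)).
Proof.
move=> da; have := psdZ (ltW (disk_1subnorm da)) (@psd_rank1 _ disk (szego a)).
by apply: eq_psd => w z dw dz; rewrite blaschke_kernel.
Qed.

Lemma blaschke_norm a z : disk a -> disk z ->
  1 - `|blaschke a z| ^+ 2 =
  (1 - `|a| ^+ 2) * (1 - `|z| ^+ 2) / `|1 - z * a^*| ^+ 2.
Proof.
move=> da dz; rewrite !normCK /blaschke.
rewrite !(rmorphM, rmorphB, fmorphV, rmorph1) /= conjCK.
have h1 := disk_den da dz; have h2 := disk_den dz da.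
move: (a^*) (z^*) h1 h2 => a' z' h1 h2.
by field; rewrite h1 mulrC h2.
Qed.

End Szego.

Arguments szego {C} w z.
Arguments blaschke {C} a z.

(** * Finite Blaschke products *)

Section BlaschkeProducts.
Variable C : numClosedFieldType.
Local Notation disk := (unit_disk (C := C)).

Definition blaschke_prod (l : seq C) (z : C) : C := \prod_(a <- l) blaschke a z.

Lemma blaschke_eq0 (a z : C) : disk a -> disk z -> (blaschke a z == 0) = (z == a).
Proof.
move=> da dz.
by rewrite /blaschke mulf_eq0 invr_eq0 (negPf (disk_den da dz)) orbF subr_eq0.
Qed.

Lemma blaschke_prod_cons a l z :
  blaschke_prod (a :: l) z = blaschke a z * blaschke_prod l z.
Proof. by rewrite /blaschke_prod big_cons. Qed.

Lemma blaschke_prod_eq0 l z : (forall a, a \in l -> disk a) -> disk z ->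
  (blaschke_prod l z == 0) = (z \in l).
Proof.
elim: l => [|a l IH] dl dz; first by rewrite /blaschke_prod big_nil oner_eq0.
rewrite blaschke_prod_cons mulf_eq0 blaschke_eq0 ?inE ?IH //.
  by move=> b bl; apply: dl; rewrite inE bl orbT.
by apply: dl; rewrite mem_head.
Qed.

Lemma blaschke_prod_schur l : (forall a, a \in l -> disk a) ->
  psd disk (schur_kernel (blaschke_prod l)).
Proof.
elim: l => [|a l IH] dl.
  have -> : blaschke_prod [::] = fun=> 1.
    by apply/funext => z; rewrite /blaschke_prod big_nil.
  exact: schur1.
have -> : blaschke_prod (a :: l) = fun z => blaschke a z * blaschke_prod l z.
  by apply/funext => z; rewrite blaschke_prod_cons.
apply: schur_mul; first by apply: blaschke_schur; apply: dl; rewrite mem_head.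
by apply: IH => b bl; apply: dl; rewrite inE bl orbT.
Qed.

End BlaschkeProducts.

(** * Negative squares and interpolation *)

Section NegativeSquares.
Local Open Scope sesquilinear_scope.
Variable C : numClosedFieldType.
Implicit Types (X : set C) (K : C -> C -> C) (f g : C -> C) (s t : seq (C * C)).
Local Notation disk := (unit_disk (C := C)).

Definition points n (x : 'rV[C]_n) (w : 'I_n -> C) : seq (C * C) :=
  [seq (x 0 i, w i) | i <- enum 'I_n].

Lemma points_supported X n (x : 'rV[C]_n) (w : 'I_n -> C) :
  (forall i, X (w i)) -> supported X (points x w).
Proof. by move=> Xw _ /mapP[i _ ->]; exact: Xw. Qed.

Lemma form_kernel_matrix K n (x : 'rV_n) (w : 'I_n -> C) :
  (x *m kernel_matrix K w *m x^t*) 0 0 = form K (points x w) (points x w).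
Proof.
rewrite /form /points big_map big_enum mxE /=.
under eq_bigr do rewrite mxE mulr_suml.
rewrite exchange_big; apply: eq_bigr => i _; rewrite big_map big_enum /=.
by apply: eq_bigr => j _; rewrite !mxE mulrAC.
Qed.

Lemma pairing_points g n (x : 'rV_n) (w : 'I_n -> C) :
  pairing g (points x w) = (x *m \col_i g (w i)) 0 0.
Proof.
rewrite /pairing /points big_map big_enum mxE /=.
by apply: eq_bigr => i _; rewrite mxE.
Qed.

Lemma kernel_matrix_herm X K n (w : 'I_n -> C) : hermitian_kernel X K ->
  (forall i, X (w i)) -> kernel_matrix K w \is hermsymmx.
Proof.
move=> Kh Xw; apply/is_hermitianmxP; rewrite expr0 scale1r.
by apply/matrixP => i j; rewrite !mxE Kh.
Qed.

Lemma schur_kernel_conj f w z : schur_kernel f z w = (schur_kernel f w z)^*.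
Proof.
rewrite /schur_kernel !(fmorphV, rmorphM, rmorphB, rmorph1) /= !conjCK.
by rewrite [f w * _]mulrC [w * _]mulrC.
Qed.

Lemma schur_kernel_hermitian X f : hermitian_kernel X (schur_kernel f).
Proof. by move=> w z _ _; exact: schur_kernel_conj. Qed.

(** The form stays nonnegative on the hyperplane where the term of rank one
    vanishes. *)
Lemma rank1_perturbation X K K1 g : hermitian_kernel X K -> psd X K1 ->
  (forall w z, X w -> X z -> K w z = K1 w z - g z * (g w)^*) ->
  forall n (w : 'I_n -> C), (forall i, X (w i)) ->
  (num_neg_eigenvalues (kernel_matrix K w) <= 1)%N.
Proof.
move=> Kh K1p KE n w Xw.
apply: (num_neg_le1 (kernel_matrix_herm Kh Xw) (l := \col_i g (w i))) => x xl.
have Xs : supported X (points x w) by exact: points_supported.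
rewrite form_kernel_matrix (eq_form Xs Xs KE) formB_rank1 pairing_points xl.
by rewrite mxE normr0 expr0n subr0 K1p.
Qed.

Lemma has_neg_square1 X K : hermitian_kernel X K ->
  (forall n (w : 'I_n -> C), (forall i, X (w i)) ->
    (num_neg_eigenvalues (kernel_matrix K w) <= 1)%N) ->
  (exists2 s, supported X s & form K s s < 0) ->
  has_neg_squares X K 1.
Proof.
move=> Kh K1 [s Xs s0]; split=> //.
pose w (i : 'I_(size s)) := (tnth (in_tuple s) i).2.
pose x := \row_(i < size s) (tnth (in_tuple s) i).1.
have Xw i : X (w i) by apply: Xs; exact: mem_tnth.
have sE : points x w = s.
  rewrite /points -[RHS](@map_tnth_enum _ _ (in_tuple s)).
  by apply: eq_map => i; rewrite mxE -surjective_pairing.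
exists (size s), w; split=> //; apply/eqP; rewrite eqn_leq K1 //=.
apply: (num_neg_ge1 (kernel_matrix_herm Kh Xw) (x := x)).
by rewrite form_kernel_matrix sE.
Qed.

(** This rests on the expansion [szego w z = 1 + z w^* szego w z], by which the
    squared norm dominates the first two Taylor coefficients. *)
Lemma affine_dominated (a b : C) :
  dominated disk (fun z => a + b * z) (`|a| ^+ 2 + `|b| ^+ 2).
Proof.
move=> s ds.
have shift r : supported disk r -> form szego r r =
    `|pairing (fun=> 1) r| ^+ 2 + form szego (rescale id r) (rescale id r).
  move=> dr; rewrite form_rescale normCK -form_rank1 -formD.
  apply: (eq_form dr dr) => w z dw dz; rewrite /szego rmorph1 mulr1.
  by field; exact: disk_den.
have -> : pairing (fun z => a + b * z) s =
    a * pairing (fun=> 1) s + b * pairing id s.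
  rewrite /pairing !mulr_sumr -big_split; apply: eq_bigr => p _ /=; ring.
apply: (@le_trans _ _ ((`|a| ^+ 2 + `|b| ^+ 2) *
    (`|pairing (fun=> 1) s| ^+ 2 + `|pairing id s| ^+ 2))).
  rewrite -subr_ge0; set x := pairing _ s; set y := pairing _ s.
  suff -> : (`|a| ^+ 2 + `|b| ^+ 2) * (`|x| ^+ 2 + `|y| ^+ 2) -
    `|a * x + b * y| ^+ 2 = `|a * y^* - b * x^*| ^+ 2 by rewrite exprn_ge0.
  by rewrite !normCK !(rmorphM, rmorphB, rmorphD) /= !conjCK; ring.
rewrite ler_wpM2l ?addr_ge0 ?exprn_ge0 // shift // lerD2l.
have := pairing1_dominated (supported_rescale (g := id) ds).
rewrite mul1r pairing_rescale.
by have -> : (fun z : C => z * 1) = id by apply/funext => z; rewrite mulr1.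
Qed.

(** A kernel vector pairs to zero with every Schur function, in particular with
    the Blaschke product that vanishes at all points but one. *)
Lemma szego_matrix_unit n (u : 'I_n -> C) : injective u ->
  (forall i, disk (u i)) -> kernel_matrix szego u \in unitmx.
Proof.
move=> ui du; rewrite -row_free_unit -kermx_eq0; apply/eqP/row_matrixP => i.
rewrite row0; set x := row i _.
have x0 : x *m kernel_matrix szego u = 0.
  by apply/eqP; rewrite -sub_kermx row_sub.
apply/rowP => j; rewrite [RHS]mxE.
pose l := [seq u k | k <- enum 'I_n & k != j].
have dl a : a \in l -> disk a by move=> /mapP[k _ ->].
have dx : supported disk (points x u) by exact: points_supported.
have := schur_dominated (blaschke_prod_schur dl) dx.
rewrite -form_kernel_matrix x0 mul0mx mxE mulr0 pairing_points mxE.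
rewrite (bigD1 j) //= big1 ?addr0; last first.
  move=> k kj; rewrite !mxE (_ : blaschke_prod l (u k) = 0) ?mulr0 //.
  apply/eqP; rewrite blaschke_prod_eq0 //; apply/mapP.
  by exists k => //; rewrite mem_filter kj mem_enum.
rewrite real_exprn_even_le0 ?normr_real //= normr_eq0 mulf_eq0 => /orP[/eqP//|].
rewrite mxE blaschke_prod_eq0 // => /mapP[k]; rewrite mem_filter => /andP[kj _].
by move=> /ui jk; rewrite jk eqxx in kj.
Qed.

(** The plane of the polynomials [p = a + b z] meets the hyperplane on which the
    form of [f] is nonnegative; for the [p] found there, the interpolant of
    [f p] of minimal norm has at most the norm of [p]. *)
Lemma hardy_interpolation f n (u : 'I_n -> C) : injective u ->
  (forall i, disk (u i)) ->
  (num_neg_eigenvalues (kernel_matrix (schur_kernel f) u) <= 1)%N ->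
  exists a b g, [/\ `|a| ^+ 2 + `|b| ^+ 2 = 1, dominated disk g 1 &
    forall i, g (u i) = f (u i) * (a + b * u i)].
Proof.
move=> ui du.
move/(num_neg_le1_hyperplane
  (kernel_matrix_herm (schur_kernel_hermitian f) du)) => [l Hl].
pose G := kernel_matrix szego u.
have Gu : G \in unitmx by exact: szego_matrix_unit.
(* v0 and v1 hold the coefficients of the minimal interpolants for p = 1, p = z *)
pose v0 := invmx G *m \col_i f (u i).
pose v1 := invmx G *m \col_i (f (u i) * u i).
pose A := \sum_i v0 i 0 * (l i 0)^*; pose B := \sum_i v1 i 0 * (l i 0)^*.
have [a [b [ab nab]]] : exists a b, a * A + b * B = 0 /\
    `|a| ^+ 2 + `|b| ^+ 2 = 1.
  have [A0|A0] := eqVneq A 0.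
    by exists 1, 0; rewrite A0 mulr0 mul0r addr0 normr1 normr0 expr1n expr0n addr0.
  pose r := sqrtC (`|A| ^+ 2 + `|B| ^+ 2).
  have r0 : 0 < `|A| ^+ 2 + `|B| ^+ 2.
    by rewrite ltr_wpDr ?exprn_ge0 // exprn_gt0 // normr_gt0.
  exists (- B / r), (A / r); split.
    by rewrite mulrAC [A / r * B]mulrAC -mulrDl mulNr [A * B]mulrC addNr mul0r.
  have rr : `|r| ^+ 2 = `|A| ^+ 2 + `|B| ^+ 2.
    by rewrite ger0_norm ?sqrtC_ge0 ?ltW // sqrtCK.
  rewrite !normrM normrN normfV !exprMn exprVn rr -mulrDl addrC divff //.
  by rewrite gt_eqF.
pose y : 'rV_n := \row_i (a * v0 i 0 + b * v1 i 0)^*.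
pose t := points y u.
have dt : supported disk t by exact: points_supported.
pose g z := form szego [:: (1, z)] t.
have gE i : g (u i) = f (u i) * (a + b * u i).
  have -> : g (u i) = (G *m (a *: v0 + b *: v1)) i 0.
    rewrite /g /form big_seq1 /t /points big_map big_enum mxE.
    by apply: eq_bigr => j _; rewrite !mxE conjCK mul1r mulrC.
  rewrite mulmxDr -!scalemxAr !mulKVmx //.
  by rewrite !mxE; ring.
have yl : y *m l = 0.
  have : ((y *m l) 0 0)^* = a * A + b * B.
    rewrite /A /B !mulr_sumr -big_split mxE rmorph_sum /=.
    by apply: eq_bigr => k _; rewrite !mxE rmorphM /= conjCK; ring.
  rewrite ab => /eqP; rewrite conjC_eq0 => /eqP yl0.
  by apply/matrixP => i j; rewrite !ord1 yl0 mxE.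
have := Hl _ yl; rewrite form_kernel_matrix -/t.
have -> : form (schur_kernel f) t t =
    form szego t t - form szego (rescale f t) (rescale f t).
  rewrite form_rescale -mulN1r -formZ -formD.
  by apply: (eq_form dt dt) => w z _ _; rewrite schur_kernelE mulN1r.
rewrite subr_ge0 => le_ft.
exists a, b, g; split=> //.
(* the squared norm of the interpolant is the value of p on the combination
   rescaled by f, whose norm is at most that of t by the choice of p *)
have tt : form szego t t = pairing (fun z => a + b * z) (rescale f t).
  rewrite pairing_rescale pairing_points {1}/form {1}/t /points big_map big_enum.
  rewrite mxE; apply: eq_bigr => i _; rewrite [X in _ = _ * X]mxE -gE /g /form big_seq1.
  by rewrite mulr_sumr; apply: eq_bigr => q _ /=; ring.
have t0 : 0 <= form szego t t by exact: szego_psd.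
have t1 : form szego t t <= 1.
  have := affine_dominated a b (supported_rescale (g := f) dt).
  rewrite nab mul1r -tt ger0_norm // => /le_trans/(_ le_ft).
  have [->|tn0] := eqVneq (form szego t t) 0; first by rewrite ler01.
  by rewrite expr2 ger_pMr // lt_def tn0.
move=> s ds; apply: le_trans (dominated_kernels dt ds) _.
by rewrite ler_wpM2r // szego_psd.
Qed.

End NegativeSquares.

(** * Modulus and differentiability in the complex plane *)

(** All estimates use the modulus with values in the real field, where the order
    is total, rather than the norm with values in the complex field. *)
Section Modulus.
Variable R : realType.
Local Notation C := (complex_complex__canonical__Num_ClosedField R).
Local Notation N := (@Normc.normc R).
Local Notation re := (@complex.Re R).
Local Notation im := (@complex.Im R).
Implicit Types (z w : C) (x y e : R).

Lemma normrE z : `|z| = (N z)%:C%C. Proof. by case: z. Qed.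

Lemma normc_ge0 z : 0 <= N z.
Proof. by rewrite -lecR -normrE normr_ge0. Qed.

Lemma ler_normcD z w : N (z + w) <= N z + N w.
Proof. by rewrite -lecR rmorphD /= -!normrE ler_normD. Qed.

Lemma normc_opp z : N (- z) = N z.
Proof. by apply: complexI; rewrite -!normrE normrN. Qed.

Lemma normc_sub z w : N (z - w) = N (w - z).
Proof. by rewrite -normc_opp opprB. Qed.

Lemma ler_normcB z w : N (z - w) <= N z + N w.
Proof. by rewrite -(normc_opp w) ler_normcD. Qed.

Lemma ler_normc_tri z w u : N (z - w) <= N (z - u) + N (u - w).
Proof. by rewrite -[z - w](subrKA u) ler_normcD. Qed.

Lemma normc_eq0 z : (N z == 0) = (z == 0).
Proof.
apply/eqP/eqP => [/Normc.eq0_normc//|->]; exact: Normc.normc0.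
Qed.

Lemma normc_gt0 z : (0 < N z) = (z != 0).
Proof. by rewrite lt_def normc_ge0 andbT normc_eq0. Qed.

Lemma normc_real x : N x%:C%C = `|x|.
Proof. by rewrite /= expr0n addr0 sqrtr_sqr. Qed.

Lemma normc_i : N 'i%C = 1.
Proof. by rewrite /= expr0n add0r expr1n sqrtr1. Qed.

Lemma normc_exp z n : N (z ^+ n) = N z ^+ n.
Proof.
elim: n => [|n IH]; first by rewrite !expr0 Normc.normc1.
by rewrite !exprS Normc.normcM IH.
Qed.

Lemma normc_sqr z : N z ^+ 2 = re z ^+ 2 + im z ^+ 2.
Proof. by case: z => a b /=; rewrite sqr_sqrtr // addr_ge0 ?sqr_ge0. Qed.

Lemma normc_ge_absRe z : `|re z| <= N z.
Proof. by rewrite -lecR -normrE normc_ge_Re. Qed.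

Lemma normc_ge_absIm z : `|im z| <= N z.
Proof.
by rewrite -sqrtr_sqr; case: z => a b /=; rewrite ler_wsqrtr // lerDr sqr_ge0.
Qed.

Lemma normc_le_absReIm z : N z <= `|re z| + `|im z|.
Proof.
rewrite {1}[z]complexE; apply: le_trans (ler_normcD _ _) _.
by rewrite Normc.normcM normc_i !normc_real mul1r.
Qed.

Lemma ReB z w : re (z - w) = re z - re w. Proof. by case: z; case: w. Qed.
Lemma ImB z w : im (z - w) = im z - im w. Proof. by case: z; case: w. Qed.

Lemma ltr0C e : (0 < e%:C%C :> R[i]) = (0 < e).
Proof. by rewrite -(ltcR 0 e). Qed.

Lemma gt0_realC (e : R[i]) : 0 < e -> exists2 d : R, 0 < d & e = d%:C%C.
Proof.
move=> e0; have /complex_realP[d eE] := gtr0_real e0.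
by exists d => //; rewrite -ltr0C -eE.
Qed.

Lemma nbhs_normcP (A : set C) z :
  nbhs z A <-> exists2 e, 0 < e & forall w, N (w - z) < e -> A w.
Proof.
split=> [/nbhs_ballP[e /gt0_realC[d d0 ->] eA]|[e e0 eA]].
  by exists d => // w wz; apply: eA; rewrite /ball /= distrC normrE ltcR.
apply/nbhs_ballP; exists e%:C%C; first by rewrite /= ltr0C.
by move=> w; rewrite /ball /= distrC normrE ltcR => /eA.
Qed.

Lemma dnbhs_normcP (A : set C) z :
  z^' A <-> exists2 e, 0 < e & forall w, w != z -> N (w - z) < e -> A w.
Proof.
rewrite /dnbhs /within; split=> [/nbhs_normcP[e e0 eA]|[e e0 eA]].
  by exists e => // w wz /eA; apply.
by apply/nbhs_normcP; exists e => // w wz wnz; exact: eA.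
Qed.

Lemma cvg_normcP (T : Type) (F : set_system T) {FF : Filter F} (f : T -> C) l :
  f @ F --> l <-> forall e, 0 < e -> \forall t \near F, N (f t - l) < e.
Proof.
split=> [/cvgrPdist_lt fl e e0|fl].
  have := fl e%:C%C; rewrite ltr0C => /(_ e0).
  by apply: filterS => t; rewrite distrC normrE ltcR.
apply/cvgrPdist_lt => e /gt0_realC[d d0 ->]; have := fl _ d0.
by apply: filterS => t; rewrite distrC normrE ltcR.
Qed.

Lemma unit_diskE z : unit_disk z = (N z < 1).
Proof. by rewrite /unit_disk /= normrE -(ltcR _ 1). Qed.

End Modulus.

Section Differentials.

(** The Frechet form of differentiability in one variable. *)
Lemma derivable1_littleo (K : numFieldType) (f : K -> K) (z d : K) :
  (forall e, 0 < e -> \forall h \near (0 : K), `|f (z + h) - f z - d * h| <= e * `|h|) <->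
  derivable f z 1 /\ 'D_1 f z = d.
Proof.
split=> [fd|[df <-] e e0].
  have cv : h^-1 *: (f (h *: 1 + z) - f z) @[h --> 0^'] --> d.
    apply/cvgrPdist_le => e e0; have := fd _ e0.
    rewrite /dnbhs near_withinE; apply: filterS => h fh /= h0.
    have -> : d - h^-1 *: (f (h *: 1 + z) - f z) =
        - (h^-1 * (f (z + h) - f z - d * h)).
      by rewrite /GRing.scale /= mulr1 [h + z]addrC; field.
    rewrite normrN normrM normfV mulrC ler_pdivrMr ?normr_gt0 //.
  split; first by apply/cvg_ex; exists d; exact: cv.
  exact: (cvg_lim (@norm_hausdorff _ K^o) cv).
move: df; rewrite /derivable => /cvgrPdist_le /(_ _ e0).
rewrite /dnbhs near_withinE; apply: filterS => h /= hP.
have [->|h0] := eqVneq h 0.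
  by rewrite addr0 subrr mulr0 subr0 !normr0 mulr0.
have := hP h0; rewrite -/('D_1 f z) /GRing.scale /= mulr1 => {}hP.
have -> : f (z + h) - f z - 'D_1 f z * h =
    - (h * ('D_1 f z - h^-1 * (f (h + z) - f z))).
  by rewrite [h + z]addrC; field.
by rewrite normrN normrM mulrC ler_wpM2r.
Qed.

Variable R : realType.
Local Notation C := (complex_complex__canonical__Num_ClosedField R).
Local Notation N := (@Normc.normc R).

Definition cdiff (f : C -> C) (z d : C) : Prop :=
  forall e : R, 0 < e -> exists2 r : R, 0 < r &
    forall h, N h < r -> N (f (z + h) - f z - d * h) <= e * N h.

Lemma cdiffP f (z d : C) : cdiff f z d <-> derivable f z 1 /\ 'D_1 f z = d.
Proof.
rewrite -derivable1_littleo; split=> fd e.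
  move=> /gt0_realC[e' e'0 ->]; have [r r0 fr] := fd _ e'0.
  apply/nbhs_normcP; exists r => // h; rewrite subr0 => /fr.
  by rewrite !normrE -rmorphM lecR.
move=> e0; have := fd e%:C%C; rewrite ltr0C => /(_ e0)/nbhs_normcP[r r0 fr].
exists r => // h hr; have := fr h; rewrite subr0 => /(_ hr).
by rewrite !normrE -rmorphM lecR.
Qed.

Lemma derivable_cdiff f (z : C) : derivable f z 1 -> exists d, cdiff f z d.
Proof. by move=> fz; exists ('D_1 f z); apply/cdiffP. Qed.

Lemma cdiff_derivable f z d : cdiff f z d -> derivable f z 1.
Proof. by move/cdiffP => []. Qed.

Lemma cdiff_continuous f z d : cdiff f z d ->
  forall e : R, 0 < e -> exists2 r : R, 0 < r &
    forall w, N (w - z) < r -> N (f w - f z) < e.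
Proof.
move=> fd e e0; have [r r0 fr] := fd 1 ltr01.
have D0 : 0 < 1 + N d by rewrite ltr_pwDl // normc_ge0.
exists (Num.min r (e / (1 + N d))); first by rewrite lt_min r0 divr_gt0.
move=> w; rewrite lt_min => /andP[wr]; rewrite ltr_pdivlMr // => we.
have := fr _ wr; rewrite addrCA subrr addr0 mul1r => h.
have -> : f w - f z = (f w - f z - d * (w - z)) + d * (w - z) by rewrite subrK.
apply: le_lt_trans (ler_normcD _ _) _; rewrite Normc.normcM.
by apply: le_lt_trans we; rewrite [leRHS]mulrDr mulr1 [N d * _]mulrC lerD2r.
Qed.

End Differentials.

(** * Derivatives and antiderivatives along paths *)

Section PathDerivative.
Variable R : realType.
Local Notation C := (complex_complex__canonical__Num_ClosedField R).
Local Notation N := (@Normc.normc R).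
Local Notation re := (@complex.Re R).
Local Notation im := (@complex.Im R).
Implicit Types (phi psi : R -> C) (x : R) (d : C).

Definition path_deriv phi x d : Prop :=
  forall e : R, 0 < e -> exists2 r : R, 0 < r &
    forall h : R, `|h| < r ->
      N (phi (x + h) - phi x - d * h%:C%C) <= e * `|h|.

Lemma path_derivB phi psi x d d' : path_deriv phi x d -> path_deriv psi x d' ->
  path_deriv (fun t => phi t - psi t) x (d - d').
Proof.
move=> f1 f2 e e0; have e20 : 0 < e / 2 by rewrite divr_gt0.
have [r1 r10 h1] := f1 _ e20; have [r2 r20 h2] := f2 _ e20.
exists (Num.min r1 r2); first by rewrite lt_min r10.
move=> h; rewrite lt_min => /andP[/h1 {}h1 /h2 {}h2].
have -> : phi (x + h) - psi (x + h) - (phi x - psi x) - (d - d') * h%:C%C =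
  (phi (x + h) - phi x - d * h%:C%C) - (psi (x + h) - psi x - d' * h%:C%C) by ring.
apply: le_trans (ler_normcB _ _) _; lra.
Qed.

Lemma path_derivZ (c : C) phi x d : path_deriv phi x d ->
  path_deriv (fun t => c * phi t) x (c * d).
Proof.
move=> f1 e e0; have c0 : 0 < N c + 1 by rewrite ltr_wpDl ?normc_ge0.
have [r r0 h1] := f1 (e / (N c + 1)) (divr_gt0 e0 c0).
exists r => // h /h1 {}h1.
have -> : c * phi (x + h) - c * phi x - c * d * h%:C%C =
   c * (phi (x + h) - phi x - d * h%:C%C) by ring.
rewrite Normc.normcM; apply: le_trans (ler_wpM2l (normc_ge0 _) h1) _.
rewrite mulrA ler_wpM2r // mulrCA ler_piMr ?(ltW e0) // ler_pdivrMr // mul1r.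
by rewrite lerDl.
Qed.

Lemma path_deriv_re phi x d : path_deriv phi x d ->
  is_derive x 1 (fun t => re (phi t)) (re d).
Proof.
move=> fd; suff [] : derivable (fun t => re (phi t) : R) x 1 /\
   'D_1 (fun t => re (phi t) : R) x = re d by move=> ? ?; split.
apply/derivable1_littleo => e e0; have [r r0 fr] := fd _ e0.
apply/nbhs_ballP; exists r => // h; rewrite /ball /= sub0r normrN => /fr {}fr.
apply: le_trans fr.
have -> : re (phi (x + h)) - re (phi x) - re d * h =
    re (phi (x + h) - phi x - d * h%:C%C).
  by case: (phi _) => a b; case: (phi _) => a' b'; case: d {fd} => d1 d2 /=; ring.
exact: normc_ge_absRe.
Qed.

Lemma path_deriv_im phi x d : path_deriv phi x d ->
  is_derive x 1 (fun t => im (phi t)) (im d).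
Proof.
move=> /(path_derivZ (- 'i%C)) /path_deriv_re.
have reN (z : C) : re (- 'i%C * z) = im z.
  by case: z => a b /=; ring.
rewrite reN; congr is_derive; apply/funext => t; exact: reN.
Qed.

Lemma path_deriv_pair (f g : R -> R) x (f' g' : R) :
  is_derive x 1 f f' -> is_derive x 1 g g' ->
  path_deriv (fun t => Complex (f t) (g t)) x (Complex f' g').
Proof.
move=> [fx fE] [gx gE] e e0; have e20 : 0 < e / 2 by rewrite divr_gt0.
have /(_ _ e20)/nbhs_ballP[r1 r10 h1] :=
  (derivable1_littleo f x f').2 (conj fx fE).
have /(_ _ e20)/nbhs_ballP[r2 r20 h2] :=
  (derivable1_littleo g x g').2 (conj gx gE).
rewrite /= in r10 r20.
exists (Num.min r1 r2); first by rewrite lt_min r10.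
move=> h; rewrite lt_min => /andP[hr1 hr2].
have {}h1 := h1 h; rewrite /ball /= sub0r normrN in h1; have {}h1 := h1 hr1.
have {}h2 := h2 h; rewrite /ball /= sub0r normrN in h2; have {}h2 := h2 hr2.
set Z := (X in N X); have : N Z <= `|re Z| + `|im Z| := normc_le_absReIm Z.
rewrite /Z /= !mulr0 subr0 add0r.
lra.
Qed.

Lemma cdiff_path (F : C -> C) (z v d : C) x : cdiff F (z + x%:C%C * v) d ->
  path_deriv (fun t => F (z + t%:C%C * v)) x (d * v).
Proof.
move=> Fd e e0; have v0 : 0 < N v + 1 by rewrite ltr_wpDl ?normc_ge0.
have [r r0 h1] := Fd (e / (N v + 1)) (divr_gt0 e0 v0).
exists (r / (N v + 1)); first by rewrite divr_gt0.
move=> h hr; have := h1 (h%:C%C * v).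
rewrite Normc.normcM normc_real.
have hv : `|h| * N v <= `|h| * (N v + 1) by rewrite ler_wpM2l // lerDl.
rewrite ltr_pdivlMr // in hr => /(_ (le_lt_trans hv hr)).
have -> : z + x%:C%C * v + h%:C%C * v = z + (x + h)%:C%C * v.
  by rewrite rmorphD /=; ring.
have -> : d * (h%:C%C * v) = d * v * h%:C%C by ring.
move=> /le_trans; apply.
have -> : e * `|h| = e / (N v + 1) * (`|h| * (N v + 1)) by field; rewrite gt_eqF.
by rewrite ler_wpM2l // divr_ge0 ?ltW.
Qed.

Lemma path_mean_value phi (del : R -> C) (e a b : R) : a <= b ->
  (forall x, a <= x <= b -> path_deriv phi x (del x)) ->
  (forall x, a <= x <= b -> N (del x) <= e) ->
  N (phi b - phi a) <= 2 * e * (b - a).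
Proof.
move=> ab fd fe.
have comp (p : C -> R) (pB : forall z w, p (z - w) = p z - p w)
    (pN : forall z, `|p z| <= N z)
    (pd : forall x, a <= x <= b -> is_derive x 1 (fun t => p (phi t)) (p (del x))) :
    `|p (phi b - phi a)| <= e * (b - a).
  have [c|| /= c] := @MVT_segment R (fun t => p (phi t)) (fun t => p (del t)) a b ab.
  - by rewrite in_itv /= => /andP[ac cb]; apply: pd; rewrite !ltW.
  - apply: derivable_within_continuous => x; rewrite in_itv /= => /pd xd.
    exact: ex_derive.
  rewrite in_itv /= => cab; rewrite pB => ->; rewrite normrM.
  rewrite [`|b - a|]ger0_norm ?subr_ge0 // ler_wpM2r ?subr_ge0 //.
  exact: le_trans (pN _) (fe _ cab).
apply: le_trans (normc_le_absReIm _) _.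
have h1 := comp re (@ReB R) (@normc_ge_absRe R) (fun x xab => path_deriv_re (fd x xab)).
have h2 := comp im (@ImB R) (@normc_ge_absIm R) (fun x xab => path_deriv_im (fd x xab)).
rewrite -mulrA mulr2n mulrDl !mul1r; exact: lerD.
Qed.

Lemma real_antiderivative (f : R -> R) (a b : R) :
  (forall x, a <= x <= b -> {for x, continuous f}) ->
  exists F : R -> R, forall x, a < x < b -> is_derive x 1 F (f x).
Proof.
move=> fc; have fi : (@lebesgue_measure R).-integrable `[a, b] (EFin \o f).
  apply: continuous_compact_integrable; first exact: segment_compact.
  apply: continuous_in_subspaceT => x; rewrite inE /= in_itv /=; exact: fc.
exists (fun x => \int[@lebesgue_measure R]_(t in [set` `[a, x]]) (f t))%R.
move=> x /andP[ax xb].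
have [|h1 h2] := continuous_FTC1_closed xb fi ax.
  by apply: fc; rewrite !ltW.
split; first exact: h1.
by rewrite -h2 derive1E.
Qed.

Lemma path_antiderivative psi (a b : R) :
  (forall x, a <= x <= b -> forall e : R, 0 < e -> exists2 r : R, 0 < r &
    forall y, `|y - x| < r -> N (psi y - psi x) < e) ->
  exists phi, forall x, a < x < b -> path_deriv phi x (psi x).
Proof.
move=> pc.
have comp (p : C -> R) (pB : forall z w, p (z - w) = p z - p w)
    (pN : forall z, `|p z| <= N z) :
    exists F : R -> R, forall x, a < x < b -> is_derive x 1 F (p (psi x)).
  apply: real_antiderivative => x xab; apply/cvgrPdist_lt => e e0.
  have [r r0 hr] := pc x xab e e0.
  apply/nbhs_ballP; exists r => // y; rewrite /ball /= distrC => yr.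
  by rewrite distrC -pB; apply: le_lt_trans (pN _) (hr _ yr).
have [F hF] := comp re (@ReB R) (@normc_ge_absRe R).
have [G hG] := comp im (@ImB R) (@normc_ge_absIm R).
exists (fun t => Complex (F t) (G t)) => x xab.
have -> : psi x = Complex (re (psi x)) (im (psi x)) by case: (psi x).
exact: path_deriv_pair (hF _ xab) (hG _ xab).
Qed.

End PathDerivative.

(** * Goursat's theorem *)

Section Bisection.
Variable R : realType.

Lemma nested_intervals (a b : nat -> R) : (forall n, a n <= a n.+1) ->
  (forall n, b n.+1 <= b n) -> (forall n, a n <= b n) ->
  exists x, forall n, a n <= x <= b n.
Proof.
move=> am bm ab.
have am' i j : (i <= j)%N -> a i <= a j.
  elim: j => [|j IH]; first by rewrite leqn0 => /eqP->.
  rewrite leq_eqVlt => /predU1P[->//|/IH h]; exact: le_trans h (am j).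
have bm' i j : (i <= j)%N -> b j <= b i.
  elim: j => [|j IH]; first by rewrite leqn0 => /eqP->.
  rewrite leq_eqVlt => /predU1P[->//|/IH h]; exact: le_trans (bm j) h.
have abij i j : a i <= b j.
  apply: le_trans (le_trans (ab (maxn i j)) _); first exact/am'/leq_maxl.
  exact/bm'/leq_maxr.
have ub j : ubound (range a) (b j) by move=> _ [i _ <-].
exists (sup (range a)) => n; apply/andP; split.
  by apply: ub_le_sup; [exists (b 0%N); exact: ub|exists n].
by apply: ge_sup; [exists (a 0%N), 0%N|exact: ub].
Qed.

(** A failure would survive in one of the four quarters, and nested quarters
    shrink to a point. *)
Lemma rectangle_bisection (Pr : R -> R -> R -> R -> Prop) (a b c d : R) :
  (forall a b c d, a <= b -> c <= d ->
     let m := (a + b) / 2 in let n := (c + d) / 2 in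
     Pr a m c n -> Pr m b c n -> Pr a m n d -> Pr m b n d -> Pr a b c d) ->
  a <= b -> c <= d ->
  (forall x y, a <= x <= b -> c <= y <= d -> exists2 del, 0 < del &
     forall a' b' c' d', a <= a' -> b' <= b -> c <= c' -> d' <= d ->
       a' <= x <= b' -> c' <= y <= d' -> (b' - a') + (d' - c') < del ->
       Pr a' b' c' d') ->
  Pr a b c d.
Proof.
move=> quarters ab cd small; apply: contrapT => bad0.
pose bad (q : R * R * R * R) := ~ Pr q.1.1.1 q.1.1.2 q.1.2 q.2.
pose nxt (q : R * R * R * R) :=
  let: (a, b, c, d) := q in let m := (a + b) / 2 in let n := (c + d) / 2 in
  if ~~ `[< Pr a m c n >] then (a, m, c, n) else
  if ~~ `[< Pr m b c n >] then (m, b, c, n) else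
  if ~~ `[< Pr a m n d >] then (a, m, n, d) else (m, b, n, d).
pose u n := iter n nxt (a, b, c, d).
pose ua n := (u n).1.1.1; pose ub n := (u n).1.1.2.
pose uc n := (u n).1.2; pose ud n := (u n).2.
have step n : [/\ ua n <= ub n, uc n <= ud n, bad (u n) &
    [/\ ub n - ua n = (b - a) / 2 ^+ n, ud n - uc n = (d - c) / 2 ^+ n,
        a <= ua n /\ ub n <= b & c <= uc n /\ ud n <= d]] /\
    [/\ ua n <= ua n.+1, ub n.+1 <= ub n, uc n <= uc n.+1 & ud n.+1 <= ud n].
  have mid (x y : R) : x <= y -> x <= (x + y) / 2 <= y.
    by move=> xy; apply/andP; split; lra.
  have mono q : q.1.1.1 <= q.1.1.2 -> q.1.2 <= q.2 -> bad q ->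
    [/\ (nxt q).1.1.1 <= (nxt q).1.1.2, (nxt q).1.2 <= (nxt q).2, bad (nxt q) &
        (nxt q).1.1.2 - (nxt q).1.1.1 = (q.1.1.2 - q.1.1.1) / 2 /\
        (nxt q).2 - (nxt q).1.2 = (q.2 - q.1.2) / 2] /\
    [/\ q.1.1.1 <= (nxt q).1.1.1, (nxt q).1.1.2 <= q.1.1.2,
        q.1.2 <= (nxt q).1.2 & (nxt q).2 <= q.2].
    case: q => [[[a1 b1] c1] d1]; rewrite /bad /= => ab1 cd1 bd.
    have /andP[m1 m2] := mid _ _ ab1; have /andP[n1 n2] := mid _ _ cd1.
    have sm : b1 - (a1 + b1) / 2 = (b1 - a1) / 2 by field.
    have sm' : (a1 + b1) / 2 - a1 = (b1 - a1) / 2 by field.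
    have sn : d1 - (c1 + d1) / 2 = (d1 - c1) / 2 by field.
    have sn' : (c1 + d1) / 2 - c1 = (d1 - c1) / 2 by field.
    case: asboolP => [p1|p1] /=; last by do !split.
    case: asboolP => [p2|p2] /=; last by do !split.
    case: asboolP => [p3|p3] /=; last by do !split.
    by do !split => //; apply: contra_not bd => p4; exact: quarters.
  elim: n => [|n [[IH1 IH2 IH3 [IH4 IH5 [IH6 IH7] [IH8 IH9]]] [IH10 IH11 IH12 IH13]]].
    split; last by have [_ [? ? ? ?]] := mono (a, b, c, d) ab cd bad0; split.
    by rewrite /ua /ub /uc /ud /= expr0 !divr1; do !split.
  have [[h1 h2 h3 [h4 h5]] _] := mono (u n) IH1 IH2 IH3.
  split; last first.
    by have [_ [? ? ? ?]] := mono (u n.+1) h1 h2 h3; split.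
  split=> //; split.
  - by rewrite [LHS]h4 -/(ub n) -/(ua n) IH4 exprS invfM [2^-1 * _]mulrC mulrA.
  - by rewrite [LHS]h5 -/(ud n) -/(uc n) IH5 exprS invfM [2^-1 * _]mulrC mulrA.
  - by split; [exact: le_trans IH6 IH10|exact: le_trans IH11 IH7].
  - by split; [exact: le_trans IH8 IH12|exact: le_trans IH13 IH9].
have [x xu] : exists x, forall n, ua n <= x <= ub n.
  by apply: nested_intervals => n; have [[? ? ? _] [? ? ? ?]] := step n.
have [y yu] : exists y, forall n, uc n <= y <= ud n.
  by apply: nested_intervals => n; have [[? ? ? _] [? ? ? ?]] := step n.
have [del del0 Hdel] := small x y (xu 0%N) (yu 0%N).
pose D := (b - a) + (d - c).
have D0 : 0 <= D by rewrite addr_ge0 // subr_ge0.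
have [n Dn] : exists n, D / 2 ^+ n < del.
  exists (Num.bound (D / del)); rewrite ltr_pdivrMr ?exprn_gt0 //.
  rewrite mulrC -ltr_pdivrMr //.
  apply: lt_trans (archi_boundP _) _; first by rewrite divr_ge0 // ltW.
  by rewrite -natrX ltr_nat ltn_expl.
have [[h1 h2 h3 [h4 h5 [h6 h7] [h8 h9]]] _] := step n.
apply: h3; apply: (Hdel _ _ _ _ h6 h7 h8 h9 (xu n) (yu n)).
by rewrite [X in X + _]h4 [X in _ + X]h5 -mulrDl.
Qed.

End Bisection.

Section Goursat.
Variable R : realType.
Local Notation C := (complex_complex__canonical__Num_ClosedField R).
Local Notation N := (@Normc.normc R).
Local Notation re := (@complex.Re R).
Local Notation im := (@complex.Im R).

(** A primitive of the affine function [al + be * (z - z0)]. *)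
Definition quad (al be z0 z : C) : C := al * z + be * (z - z0) ^+ 2 / 2.

Lemma quad_cdiff (al be z0 z : C) : cdiff (quad al be z0) z (al + be * (z - z0)).
Proof.
move=> e e0; have b0 : 0 < N be + 1 by rewrite ltr_wpDl ?normc_ge0.
exists (e / (N be + 1)); first by rewrite divr_gt0.
move=> h; rewrite ltr_pdivlMr // => hr.
have -> : quad al be z0 (z + h) - quad al be z0 z - (al + be * (z - z0)) * h =
  h * (be / 2) * h by rewrite /quad; field.
rewrite Normc.normcM ler_wpM2r ?normc_ge0 // Normc.normcM.
apply: le_trans (ltW hr); rewrite ler_wpM2l ?normc_ge0 //.
rewrite Normc.normcM Normc.normcV.
have -> : N (2 : C) = 2.
  by rewrite -[2 : C](rmorph_nat (real_complex R)) normc_real ger0_norm.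
have := normc_ge0 be; lra.
Qed.

(** The mean value inequality for the difference between an antiderivative of [f]
    along a segment and the primitive of an affine approximation of [f]. *)
Lemma segment_estimate (f : C -> C) (phi : R -> C) (z1 v al be z0 : C) (e a b : R) :
  N v = 1 ->
  (forall t, Num.min a b <= t <= Num.max a b ->
     path_deriv phi t (f (z1 + t%:C%C * v) * v)) ->
  (forall t, Num.min a b <= t <= Num.max a b ->
     N (f (z1 + t%:C%C * v) - (al + be * (z1 + t%:C%C * v - z0))) <= e) ->
  N (phi b - phi a - (quad al be z0 (z1 + b%:C%C * v) -
                      quad al be z0 (z1 + a%:C%C * v))) <= 2 * e * `|b - a|.
Proof.
move=> v1; wlog ab : a b / a <= b => [hw|].
  have [ab|ba] := orP (le_total a b); first exact: hw.
  move=> h1 h2; have := hw b a ba; rewrite minC maxC => /(_ h1 h2).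
  rewrite distrC -normc_opp; congr (N _ <= _); ring.
rewrite min_l // max_r // => fd fe.
pose q t := quad al be z0 (z1 + t%:C%C * v).
have -> : phi b - phi a - (q b - q a) = (phi b - q b) - (phi a - q a) by ring.
rewrite [`|b - a|]ger0_norm ?subr_ge0 //.
pose del t := f (z1 + t%:C%C * v) * v - (al + be * (z1 + t%:C%C * v - z0)) * v.
apply: (@path_mean_value _ (fun t => phi t - q t) del) => // t tab.
  apply: path_derivB; first exact: fd.
  by apply: cdiff_path; exact: quad_cdiff.
by rewrite /del -mulrBl Normc.normcM v1 mulr1 fe.
Qed.

Variables (f : C -> C) (c : C) (r0 : R).

Definition square (r : R) (z : C) : Prop :=
  `|re z - re c| < r /\ `|im z - im c| < r.

Hypothesis fd : forall z, square r0 z -> exists d, cdiff f z d.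

Variable r : R.
Hypothesis rr0 : r < r0.

Lemma line_antiderivative (z1 v : C) (u : R) : N v = 1 ->
  (forall t, `|t - u| <= r -> square r0 (z1 + t%:C%C * v)) ->
  exists phi, forall t, `|t - u| < r -> path_deriv phi t (f (z1 + t%:C%C * v) * v).
Proof.
move=> v1 sq; have [|phi hphi] := @path_antiderivative R
    (fun t => f (z1 + t%:C%C * v) * v) (u - r) (u + r).
  move=> x xr e e0; have [|d fx] := fd (sq x _).
    by rewrite ler_distl.
  have [s s0 hs] := cdiff_continuous fx e0.
  exists s => // y yx; rewrite -mulrBl Normc.normcM v1 mulr1; apply: hs.
  have -> : z1 + y%:C%C * v - (z1 + x%:C%C * v) = (y - x)%:C%C * v.
    by rewrite rmorphB /=; ring.
  by rewrite Normc.normcM v1 mulr1 normc_real.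
by exists phi => t; rewrite ltr_distl; exact: hphi.
Qed.


Definition hline (y t : R) : C := Complex 0 y + t%:C%C * 1.
Definition vline (x t : R) : C := Complex x 0 + t%:C%C * 'i%C.

Lemma hlineE y t : hline y t = Complex t y.
Proof. by rewrite /hline mulr1; apply/eqP; rewrite eq_complex /= add0r addr0 !eqxx. Qed.

Lemma vlineE x t : vline x t = Complex x t.
Proof.
apply/eqP; rewrite /vline eq_complex /=.
by rewrite !mulr0 !mul0r mulr1 subr0 !addr0 add0r !eqxx.
Qed.

Lemma complex_subE (z w : C) : z - w = Complex (re z - re w) (im z - im w).
Proof. by case: z; case: w. Qed.

Lemma normc_box (u v u' v' : R) : `|u| <= `|u'| -> `|v| <= `|v'| ->
  N (Complex u v) <= N (Complex u' v').
Proof.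
move=> uu vv; rewrite /= ler_wsqrtr // lerD // -[_ ^+ 2]real_normK ?num_real //.
  by rewrite -[leRHS]real_normK ?num_real // lerXn2r // ?nnegrE.
by rewrite -[leRHS]real_normK ?num_real // lerXn2r // ?nnegrE.
Qed.

Lemma between_dist (a b t : R) : Num.min a b <= t <= Num.max a b ->
  `|t - a| <= `|b - a|.
Proof.
have [ab|ba] := orP (le_total a b).
  by rewrite min_l ?max_r // => /andP[h1 h2]; rewrite !ger0_norm ?subr_ge0 ?lerD2r.
rewrite min_r ?max_l // => /andP[h1 h2].
by rewrite !ler0_norm ?subr_le0 // lerN2 lerD2r.
Qed.

(** Goursat's theorem, in the form of a primitive.  The horizontal and vertical
    antiderivatives of [f] define an integral along the boundary of a rectangle;
    it is additive, and of smaller order than the area of small rectangles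
    because [f] is differentiable, so by bisection it vanishes.  Integrating
    from the centre along two sides of a rectangle then gives a primitive.
    The conclusion says that an affine approximation of [f] integrates to a
    quadratic approximation of the primitive. *)
Lemma primitive_estimate : 0 < r -> exists P : C -> C,
  forall z z' al be e, square r z -> square r z' ->
    (forall w, N (w - z) <= N (z' - z) -> N (f w - (al + be * (w - z))) <= e) ->
    N (P z' - P z - (al * (z' - z) + be * (z' - z) ^+ 2 / 2)) <=
      4 * e * N (z' - z).
Proof.
move=> r_gt0.
have /choice[A hA] : forall y, exists phi, `|y - im c| < r0 -> forall t, `|t - re c| < r ->
    path_deriv phi t (f (hline y t) * 1).
  move=> y; have [yr|ny] := ltP `|y - im c| r0; last by exists (fun=> 0).
  have [|t tr|phi hphi] := @line_antiderivative (Complex 0 y) 1 (re c).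
  - exact: Normc.normc1.
  - by rewrite -/(hline y t) hlineE; split=> //=; exact: le_lt_trans rr0.
  by exists phi.
have /choice[B hB] : forall x, exists phi, `|x - re c| < r0 -> forall t, `|t - im c| < r ->
    path_deriv phi t (f (vline x t) * 'i%C).
  move=> x; have [xr|nx] := ltP `|x - re c| r0; last by exists (fun=> 0).
  have [|t tr|phi hphi] := @line_antiderivative (Complex x 0) 'i%C (im c).
  - exact: normc_i.
  - by rewrite -/(vline x t) vlineE; split=> //=; exact: le_lt_trans rr0.
  by exists phi.
have btw (u a b t : R) : `|a - u| < r -> `|b - u| < r ->
    Num.min a b <= t <= Num.max a b -> `|t - u| < r.
  rewrite !ltr_norml => /andP[a1 a2] /andP[b1 b2] /andP[].
  rewrite ge_min le_max => /orP h1 /orP h2; apply/andP.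
  by split; case: h1; case: h2 => *; lra.
have horiz y a b al be z0 e : `|y - im c| < r -> `|a - re c| < r ->
    `|b - re c| < r ->
    (forall t, Num.min a b <= t <= Num.max a b ->
       N (f (Complex t y) - (al + be * (Complex t y - z0))) <= e) ->
    N (A y b - A y a - (quad al be z0 (Complex b y) - quad al be z0 (Complex a y)))
      <= 2 * e * `|b - a|.
  move=> yr ar br fe; rewrite -!hlineE.
  apply: (@segment_estimate f); first exact: Normc.normc1.
    by move=> t /(btw _ _ _ _ ar br) tr; apply: hA => //; exact: lt_trans rr0.
  by move=> t tab; rewrite -/(hline y t) hlineE; exact: fe.
have vert x a b al be z0 e : `|x - re c| < r -> `|a - im c| < r ->
    `|b - im c| < r ->
    (forall t, Num.min a b <= t <= Num.max a b ->
       N (f (Complex x t) - (al + be * (Complex x t - z0))) <= e) ->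
    N (B x b - B x a - (quad al be z0 (Complex x b) - quad al be z0 (Complex x a)))
      <= 2 * e * `|b - a|.
  move=> xr ar br fe; rewrite -!vlineE.
  apply: (@segment_estimate f); first exact: normc_i.
    by move=> t /(btw _ _ _ _ ar br) tr; apply: hB => //; exact: lt_trans rr0.
  by move=> t tab; rewrite -/(vline x t) vlineE; exact: fe.
(* the integral of f along the boundary of the rectangle [a, b] x [s, d] *)
pose J a b s d := (A s b - A s a) + (B b d - B b s) - (A d b - A d a) - (B a d - B a s).
have J0' a b s d : a <= b -> s <= d -> `|a - re c| < r -> `|b - re c| < r ->
    `|s - im c| < r -> `|d - im c| < r -> J a b s d = 0.
  move=> ab sd ar br sr dr.
  suff Je e : 0 < e -> N (J a b s d) <= 4 * e * ((b - a) + (d - s)) ^+ 2.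
    apply/eqP; rewrite -normc_eq0 eq_le normc_ge0 andbT.
    apply/ler_addgt0Pl => e e0; rewrite addr0.
    set D := ((b - a) + (d - s)) ^+ 2 in Je.
    have D0 : 0 <= D by rewrite sqr_ge0.
    have D1 : 0 < 4 * (D + 1) by lra.
    apply: le_trans (Je (e / (4 * (D + 1))) (divr_gt0 e0 D1)) _.
    have -> : 4 * (e / (4 * (D + 1))) * D = e * (D / (D + 1)).
      by field; rewrite gt_eqF //; lra.
    rewrite ler_piMr ?(ltW e0) // ler_pdivrMr; lra.
  move=> e0.
  apply: (@rectangle_bisection _ (fun a b s d =>
    N (J a b s d) <= 4 * e * ((b - a) + (d - s)) ^+ 2)) => //.
    move=> {ab sd ar br sr dr} {}a {}b {}s {}d ab sd m n h1 h2 h3 h4.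
    have -> : J a b s d = J a m s n + J m b s n + J a m n d + J m b n d.
      by rewrite /J; ring.
    apply: le_trans (ler_normcD _ _) _.
    apply: le_trans (lerD (ler_normcD _ _) (lexx _)) _.
    apply: le_trans (lerD (lerD (ler_normcD _ _) (lexx _)) (lexx _)) _.
    apply: le_trans (lerD (lerD (lerD h1 h2) h3) h4) _.
    by rewrite le_eqVlt; apply/orP; left; apply/eqP; rewrite /m /n; field.
  move=> x y /andP[ax xb] /andP[sy yd].
  have xr : `|x - re c| < r by move: ar br; rewrite !ltr_norml; lra.
  have yr : `|y - im c| < r by move: sr dr; rewrite !ltr_norml; lra.
  (* around x + iy, the affine approximation integrates to zero, and the error
     is e times the perimeter at most, on a boundary of the same length *)
  have [|D fD] := fd (z := Complex x y).
    by split=> /=; exact: lt_trans rr0.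
  have [del del0 hdel] := fD _ e0.
  exists del => // a' b' s' d' aa' bb' ss' dd' /andP[ax' xb'] /andP[sy' yd'] small.
  have ar' : `|a' - re c| < r by move: ar br; rewrite !ltr_norml; lra.
  have br' : `|b' - re c| < r by move: ar br; rewrite !ltr_norml; lra.
  have sr' : `|s' - im c| < r by move: sr dr; rewrite !ltr_norml; lra.
  have dr' : `|d' - im c| < r by move: sr dr; rewrite !ltr_norml; lra.
  set L := (b' - a') + (d' - s') in small *.
  have fe u v : a' <= u <= b' -> s' <= v <= d' ->
      N (f (Complex u v) - (f (Complex x y) + D * (Complex u v - Complex x y))) <= e * L.
    move=> uab vsd.
    have L1 : N (Complex u v - Complex x y) <= L.
      apply: le_trans (normc_le_absReIm _) _; apply: lerD => /=.
        by rewrite ler_norml; lra.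
      by rewrite ler_norml; lra.
    have := hdel _ (le_lt_trans L1 small); rewrite addrCA subrr addr0 opprD addrA.
    by move=> /le_trans; apply; rewrite ler_wpM2l // ltW.
  have ab' : a' <= b' by lra.
  have sd' : s' <= d' by lra.
  pose q := quad (f (Complex x y)) D (Complex x y).
  have i1 : N (A s' b' - A s' a' - (q (Complex b' s') - q (Complex a' s'))) <= 2 * (e * L) * `|b' - a'|.
    by apply: horiz => // t; rewrite min_l // max_r // => tab; apply: fe; rewrite // lexx.
  have i2 : N (A d' b' - A d' a' - (q (Complex b' d') - q (Complex a' d'))) <= 2 * (e * L) * `|b' - a'|.
    by apply: horiz => // t; rewrite min_l // max_r // => tab; apply: fe; rewrite // lexx andbT.
  have i3 : N (B b' d' - B b' s' - (q (Complex b' d') - q (Complex b' s'))) <= 2 * (e * L) * `|d' - s'|.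
    by apply: vert => // t; rewrite min_l // max_r // => tab; apply: fe; rewrite // lexx andbT.
  have i4 : N (B a' d' - B a' s' - (q (Complex a' d') - q (Complex a' s'))) <= 2 * (e * L) * `|d' - s'|.
    by apply: vert => // t; rewrite min_l // max_r // => tab; apply: fe; rewrite // lexx.
  rewrite ger0_norm ?subr_ge0 // in i1; rewrite ger0_norm ?subr_ge0 // in i2.
  rewrite ger0_norm ?subr_ge0 // in i3; rewrite ger0_norm ?subr_ge0 // in i4.
  have -> : J a' b' s' d' =
     (A s' b' - A s' a' - (q (Complex b' s') - q (Complex a' s')))
     + (B b' d' - B b' s' - (q (Complex b' d') - q (Complex b' s')))
     - (A d' b' - A d' a' - (q (Complex b' d') - q (Complex a' d')))
     - (B a' d' - B a' s' - (q (Complex a' d') - q (Complex a' s'))).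
    by rewrite /J; ring.
  apply: le_trans (ler_normcB _ _) _.
  apply: le_trans (lerD (ler_normcB _ _) (lexx _)) _.
  apply: le_trans (lerD (lerD (ler_normcD _ _) (lexx _)) (lexx _)) _.
  apply: le_trans (lerD (lerD (lerD i1 i3) i2) i4) _.
  by rewrite le_eqVlt; apply/orP; left; apply/eqP; rewrite /L; ring.
have J0 a b s d : `|a - re c| < r -> `|b - re c| < r ->
    `|s - im c| < r -> `|d - im c| < r -> J a b s d = 0.
  have Jab a1 b1 s1 d1 : J a1 b1 s1 d1 = - J b1 a1 s1 d1 by rewrite /J; ring.
  have Jsd a1 b1 s1 d1 : J a1 b1 s1 d1 = - J a1 b1 d1 s1 by rewrite /J; ring.
  move=> ar br sr dr; have [ab|ab] := orP (le_total a b); have [sd|sd] := orP (le_total s d).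
  - exact: J0'.
  - by rewrite Jsd J0' ?oppr0.
  - by rewrite Jab J0' ?oppr0.
  - by rewrite Jab Jsd J0' ?oppr0.
exists (fun z => (A (im c) (re z) - A (im c) (re c)) + (B (re z) (im z) - B (re z) (im c))).
move=> [x y] [x' y'] al be e zr zr' fe.
have xr : `|x - re c| < r by case: zr.
have yr : `|y - im c| < r by case: zr.
have xr' : `|x' - re c| < r by case: zr'.
have yr' : `|y' - im c| < r by case: zr'.
set z := Complex x y in fe *; set z' := Complex x' y' in fe *.
have cr : `|im c - im c| < r by rewrite subrr normr0.
have := J0 x x' (im c) y xr xr' cr yr; rewrite /J => J00.
pose q := quad al be z.
have i1 : N (A y x' - A y x - (q (Complex x' y) - q (Complex x y))) <= 2 * e * `|x' - x|.
  apply: horiz => // t /between_dist txx; apply: fe.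
  by rewrite !complex_subE; apply: normc_box => //=; rewrite subrr normr0.
have i2 : N (B x' y' - B x' y - (q (Complex x' y') - q (Complex x' y))) <= 2 * e * `|y' - y|.
  apply: vert => // t /between_dist tyy; apply: fe.
  by rewrite !complex_subE; apply: normc_box.
have e0 : 0 <= e.
  by have := fe z; rewrite subrr Normc.normc0 => /(_ (normc_ge0 _)); apply: le_trans (normc_ge0 _).
have qE : al * (z' - z) + be * (z' - z) ^+ 2 / 2 = q z' - q z by rewrite /q /quad; field.
rewrite qE.
have -> : A (im c) x' - A (im c) (re c) + (B x' y' - B x' (im c)) -
  (A (im c) x - A (im c) (re c) + (B x y - B x (im c))) - (q z' - q z) =
  (A y x' - A y x - (q (Complex x' y) - q (Complex x y))) +
  (B x' y' - B x' y - (q (Complex x' y') - q (Complex x' y))).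
  rewrite -/z -/z' -[LHS]subr0 -J00; ring.
apply: le_trans (ler_normcD _ _) _; apply: le_trans (lerD i1 i2) _.
have n1 : `|x' - x| <= N (z' - z) by exact: (normc_ge_absRe (z' - z)).
have n2 : `|y' - y| <= N (z' - z) by exact: (normc_ge_absIm (z' - z)).
have -> : 4 * e * N (z' - z) = 2 * e * N (z' - z) + 2 * e * N (z' - z) by ring.
by apply: lerD; rewrite ler_wpM2l // mulr_ge0.
Qed.

End Goursat.

(** * Limits along ultrafilters *)

Section UltraLimits.
Variable R : realType.
Local Notation C := (complex_complex__canonical__Num_ClosedField R).
Local Notation N := (@Normc.normc R).
Local Notation re := (@complex.Re R).
Local Notation im := (@complex.Im R).

Lemma ultra_bounded_real T (F : set_system T) (UF : UltraFilter F) (f : T -> R) M :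
  F [set t | `|f t| <= M] ->
  exists l, forall e, 0 < e -> \forall t \near F, `|f t - l| < e.
Proof.
move=> fM; have FF := @ultra_proper _ _ UF.
have [|l [_ lc]] := @segment_compact R (- M) M (f @ F) _.
  by rewrite /fmap /=; apply: filterS fM => t /=; rewrite in_itv /= -ler_norml.
exists l => e e0; have [//|bad] := in_ultra_setVsetC [set t | `|f t - l| < e] UF.
have lb : nbhs l (ball l e) by exact: nbhsx_ballx.
have [y [/= ny /=]] := lc [set y | ~ `|y - l| < e] _ bad lb.
by rewrite /ball /= distrC.
Qed.

(** This gives pointwise limits of families of functions on an uncountable set,
    where no convergent subsequence need exist. *)
Lemma ultra_bounded_cvg T (F : set_system T) (UF : UltraFilter F) (f : T -> C) M :
  F [set t | N (f t) <= M] -> exists l : C, f @ F --> l.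
Proof.
move=> fM; have FF := @ultra_proper _ _ UF.
have [|l1 h1] := @ultra_bounded_real _ F UF (fun t => re (f t)) M.
  by apply: filterS fM => t /=; apply: le_trans (normc_ge_absRe _).
have [|l2 h2] := @ultra_bounded_real _ F UF (fun t => im (f t)) M.
  by apply: filterS fM => t /=; apply: le_trans (normc_ge_absIm _).
exists (Complex l1 l2); apply/cvg_normcP => e e0.
have e20 : 0 < e / 2 by rewrite divr_gt0.
apply: filterS2 (h1 _ e20) (h2 _ e20) => t t1 t2.
apply: le_lt_trans (normc_le_absReIm _) _; rewrite ReB ImB [ltRHS]splitr.
exact: ltrD.
Qed.

Lemma cvg_normc_le T (F : set_system T) (FF : ProperFilter F) (f : T -> C) (l : C) M :
  f @ F --> l -> (\forall t \near F, N (f t) <= M) -> N l <= M.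
Proof.
move=> /cvg_normcP fl fM; apply/ler_addgt0Pr => e e0.
have [t [t1 t2]] :=
    @filter_ex _ F FF _ (@filterI _ F filter_filter _ _ fM (fl _ e0)).
by rewrite -[l](subrKC (f t)); apply: le_trans (ler_normcD _ _) _;
  rewrite lerD // normc_sub ltW.
Qed.

Lemma closed_disc_compact (v : C) (rho : R) : compact [set z : C | N (z - v) <= rho].
Proof.
rewrite compact_ultra => F UF FA; have FF := @ultra_proper _ _ UF.
have [|l Fl] := @ultra_bounded_cvg _ F UF id (N v + rho).
  apply: filterS FA => z /= zv; rewrite -[z](subrKC v).
  by apply: le_trans (ler_normcD _ _) _; rewrite lerD2l.
exists l; split; last exact: Fl.
have h : (fun z : C => z - v) @ F --> (l - v : C).
  apply/cvg_normcP => e /((cvg_normcP id l).1 Fl); apply: filterS => z /=.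
  by rewrite opprB addrA subrK.
exact: (cvg_normc_le FF h FA).
Qed.

End UltraLimits.

(** * The maximum modulus principle *)

Section MaximumModulus.
Variable R : realType.
Local Notation C := (complex_complex__canonical__Num_ClosedField R).
Local Notation N := (@Normc.normc R).
Local Notation re := (@complex.Re R).
Local Notation im := (@complex.Im R).

Lemma continuous_normcP (f : C -> C) (z : C) : {for z, continuous f} <->
  forall e : R, 0 < e -> exists2 r : R, 0 < r &
    forall w, N (w - z) < r -> N (f w - f z) < e.
Proof.
have -> : {for z, continuous f} <-> (f @ (nbhs z) --> (f z : C)) by [].
split=> [/cvg_normcP fz e /fz/nbhs_normcP //|fz].
by apply/cvg_normcP => e /fz/nbhs_normcP.
Qed.

(** The part of analyticity that the maximum modulus principle needs.  Unlike
    differentiability, it is known for primitives of holomorphic functions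
    without Cauchy's formula. *)
Definition expand2 (q : C -> C) (z : C) : Prop := exists a b c : C,
  forall e : R, 0 < e -> exists2 r : R, 0 < r & forall h, N h < r ->
    N (q (z + h) - (a + b * h + c * h ^+ 2)) <= e * N h ^+ 2.

Lemma quadratic_bound (a b c h : C) : N h <= 1 ->
  N (a + b * h + c * h ^+ 2) <= N a + N b + N c.
Proof.
move=> h1; have h0 := normc_ge0 h.
apply: le_trans (ler_normcD _ _) _; apply: lerD.
  apply: le_trans (ler_normcD _ _) _; apply: lerD => //.
  by rewrite Normc.normcM ler_piMr ?normc_ge0.
by rewrite Normc.normcM normc_exp ler_piMr ?normc_ge0 // exprn_ile1.
Qed.

Lemma expand2_mul (p q : C -> C) z : expand2 p z -> expand2 q z ->
  expand2 (fun w => p w * q w) z.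
Proof.
move=> [a [b [c pE]]] [a' [b' [c' qE]]].
exists (a * a'), (a * b' + b * a'), (a * c' + b * b' + c * a') => e e0.
pose M := N a + N b + N c; pose M' := N a' + N b' + N c'.
pose K := N (b * c' + c * b') + N (c * c').
have M0 : 0 <= M by rewrite !addr_ge0 ?normc_ge0.
have M'0 : 0 <= M' by rewrite !addr_ge0 ?normc_ge0.
have K0 : 0 <= K by rewrite !addr_ge0 ?normc_ge0.
have e30 : 0 < e / 3 by rewrite divr_gt0.
have D1 : 0 < M' + 1 by lra.
have D2 : 0 < M + 1 by lra.
have D3 : 0 < K + 1 by lra.
pose e1 := Num.min 1 (e / 3 / (M' + 1)).
pose e2 := Num.min 1 (e / 3 / (M + 1)).
have e10 : 0 < e1 by rewrite lt_min ltr01 divr_gt0.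
have e20 : 0 < e2 by rewrite lt_min ltr01 divr_gt0.
have [r1 r10 h1] := pE _ e10; have [r2 r20 h2] := qE _ e20.
exists (Num.min (Num.min 1 (e / 3 / (K + 1))) (Num.min r1 r2)).
  by rewrite !lt_min ltr01 r10 r20 divr_gt0.
move=> h; rewrite !lt_min => /andP[/andP[hl hK] /andP[/h1 {}h1 /h2 {}h2]].
have h0 := normc_ge0 h; have hl' := ltW hl.
set A := a + b * h + c * h ^+ 2 in h1; set A' := a' + b' * h + c' * h ^+ 2 in h2.
have AM : N A <= M by exact: quadratic_bound.
have AM' : N A' <= M' by exact: quadratic_bound.
set P := p _ in h1 *; set Q := q _ in h2 *.
have -> : P * Q - (a * a' + (a * b' + b * a') * h + (a * c' + b * b' + c * a') * h ^+ 2) =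
  (P - A) * Q + A * (Q - A') + (b * c' + c * b' + c * c' * h) * h ^+ 3.
  by rewrite /A /A'; ring.
have h21 : N h ^+ 2 <= 1 by rewrite exprn_ile1.
have h20 : 0 <= N h ^+ 2 by rewrite exprn_ge0.
have QM : N Q <= M' + 1.
  rewrite -[Q](subrKC A'); apply: le_trans (ler_normcD _ _) _; apply: lerD => //.
  apply: le_trans h2 _; rewrite -[leRHS]mulr1; apply: ler_pM => //; first exact: ltW.
  by rewrite ge_min lexx.
have t1 : N ((P - A) * Q) <= e / 3 * N h ^+ 2.
  rewrite Normc.normcM; apply: le_trans (ler_pM (normc_ge0 _) (normc_ge0 _) h1 QM) _.
  rewrite mulrAC ler_wpM2r // -ler_pdivlMr //.
  by rewrite ge_min lexx orbT.
have t2 : N (A * (Q - A')) <= e / 3 * N h ^+ 2.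
  rewrite Normc.normcM; apply: le_trans (ler_pM (normc_ge0 _) (normc_ge0 _) AM h2) _.
  rewrite mulrA ler_wpM2r //; apply: (@le_trans _ _ ((M + 1) * e2)).
    by rewrite ler_wpM2r ?(ltW e20) // lerDl.
  by rewrite mulrC -ler_pdivlMr // ge_min lexx orbT.
have t3 : N ((b * c' + c * b' + c * c' * h) * h ^+ 3) <= e / 3 * N h ^+ 2.
  rewrite Normc.normcM normc_exp exprS mulrA ler_wpM2r //.
  apply: (@le_trans _ _ ((K + 1) * N h)); last first.
    by rewrite mulrC -ler_pdivlMr // ltW.
  rewrite ler_wpM2r //; apply: (@le_trans _ _ K); last by rewrite lerDl.
  apply: le_trans (ler_normcD _ _) _; rewrite lerD2l Normc.normcM.
  by rewrite ler_piMr ?normc_ge0.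
apply: le_trans (ler_normcD _ _) _; apply: le_trans (lerD (ler_normcD _ _) (lexx _)) _.
lra.
Qed.

Lemma expand2_cst (a z : C) : expand2 (fun=> a) z.
Proof.
exists a, 0, 0 => e e0; exists 1 => // h _.
by rewrite !mul0r !addr0 subrr Normc.normc0 mulr_ge0 ?(ltW e0) // exprn_ge0 ?normc_ge0.
Qed.

Lemma expand2_near (p q : C -> C) z (r : R) : 0 < r ->
  (forall w, N (w - z) < r -> p w = q w) -> expand2 p z -> expand2 q z.
Proof.
move=> r0 pq [a [b [c pE]]]; exists a, b, c => e /pE[s s0 hs].
exists (Num.min r s); first by rewrite lt_min r0.
move=> h; rewrite lt_min => /andP[hr /hs]; rewrite pq //.
by rewrite addrAC subrr add0r.
Qed.

Lemma expand2_inv (v z : C) : z != v -> expand2 (fun w => (w - v)^-1) z.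
Proof.
move=> zv; set d := z - v; have d0 : d != 0 by rewrite subr_eq0.
have nd : 0 < N d by rewrite normc_gt0.
exists (d^-1), (- d ^- 2), (d ^- 3) => e e0.
pose K := N d ^+ 3 * (N d / 2).
have K0 : 0 < K by rewrite mulr_gt0 ?exprn_gt0 ?divr_gt0.
exists (Num.min (N d / 2) (e * K)); first by rewrite lt_min divr_gt0 // mulr_gt0.
move=> h; rewrite lt_min => /andP[hd hK].
have dh : N d / 2 <= N (d + h).
  have := ler_normcB (d + h) h; rewrite addrK => dd.
  by have := lt_le_trans hd (lexx _); lra.
have dh0 : d + h != 0 by rewrite -normc_gt0; apply: lt_le_trans dh; rewrite divr_gt0.
have -> : z + h - v = d + h by rewrite /d; ring.
have -> : (d + h)^-1 - (d^-1 + - d ^- 2 * h + d ^- 3 * h ^+ 2) = - (h * (d ^+ 3 * (d + h))^-1 * h ^+ 2).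
  by field; rewrite dh0 d0.
rewrite normc_opp Normc.normcM normc_exp ler_wpM2r ?exprn_ge0 ?normc_ge0 //.
rewrite Normc.normcM Normc.normcV Normc.normcM normc_exp.
rewrite ler_pdivrMr; last by rewrite mulr_gt0 ?exprn_gt0 ?normc_gt0.
apply: le_trans (ltW hK) _; rewrite ler_wpM2l ?(ltW e0) //.
by rewrite ler_wpM2l ?exprn_ge0 ?normc_ge0.
Qed.

Lemma expand2_pow (p : C -> C) z n : expand2 p z -> expand2 (fun w => p w ^+ n) z.
Proof.
move=> pz; elim: n => [|n IH]; first exact: expand2_cst.
have := expand2_mul pz IH; apply: (@expand2_near _ _ _ 1) => // w _.
by rewrite exprS.
Qed.

Lemma expand2_value (q : C -> C) z a b c :
  (forall e : R, 0 < e -> exists2 r : R, 0 < r & forall h, N h < r ->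
    N (q (z + h) - (a + b * h + c * h ^+ 2)) <= e * N h ^+ 2) -> q z = a.
Proof.
move=> qE; apply/eqP; rewrite -subr_eq0 -normc_eq0 eq_le normc_ge0 andbT.
have [r r0 /(_ 0)] := qE 1 ltr01.
by rewrite Normc.normc0 => /(_ r0); rewrite !expr0n !mulr0 !addr0.
Qed.

Lemma expand2_continuous (q : C -> C) z : expand2 q z -> {for z, continuous q}.
Proof.
move=> [a [b [c qE]]].
have aE := expand2_value qE.
apply/continuous_normcP => e e0; have [r r0 hr] := qE 1 ltr01.
pose K := N b + N c + 1.
have K0 : 0 < K by rewrite ltr_pwDr // addr_ge0 ?normc_ge0.
exists (Num.min (Num.min r 1) (e / K)).
  by rewrite !lt_min r0 ltr01 divr_gt0.
move=> w; rewrite !lt_min => /andP[/andP[/hr wr w1] wK].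
rewrite subrKC in wr; rewrite ltr_pdivlMr // in wK.
apply: le_lt_trans wK; have n0 := normc_ge0 (w - z).
set h := w - z in wr w1 n0 *.
have -> : q w - q z = (q w - (a + b * h + c * h ^+ 2)) + (b * h + c * h ^+ 2).
  by rewrite aE; ring.
have h2 : N h ^+ 2 <= N h by rewrite expr2 ler_piMr // ltW.
apply: le_trans (ler_normcD _ _) _; apply: le_trans (lerD wr (ler_normcD _ _)) _.
rewrite (Normc.normcM b) (Normc.normcM c) normc_exp mul1r.
have : N c * N h ^+ 2 <= N c * N h by rewrite ler_wpM2l ?normc_ge0.
rewrite /K; lra.
Qed.

Lemma normc_continuous (f : C -> C) (z : C) : {for z, continuous f} ->
  {for z, continuous (fun w => N (f w))}.
Proof.
move=> /continuous_normcP fz.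
suff : (fun w => N (f w)) @ (nbhs z) --> N (f z) by [].
apply/cvgrPdist_lt => e /fz[r r0 fr].
apply/nbhs_normcP; exists r => // w /fr fw; apply: le_lt_trans fw; rewrite ler_norml.
have := ler_normc_tri (f w) 0 (f z); have := ler_normc_tri (f z) 0 (f w).
rewrite !subr0 (normc_sub (f z)) => h1 h2; apply/andP; split; lra.
Qed.

Lemma four_points (a b c : C) (t : R) :
  N (a + b * t%:C%C + c * t%:C%C ^+ 2) ^+ 2 +
  N (a + b * - t%:C%C + c * (- t%:C%C) ^+ 2) ^+ 2 +
  N (a + b * ('i%C * t%:C%C) + c * ('i%C * t%:C%C) ^+ 2) ^+ 2 +
  N (a + b * (- ('i%C * t%:C%C)) + c * (- ('i%C * t%:C%C)) ^+ 2) ^+ 2 =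
  4 * (N a ^+ 2 + N b ^+ 2 * t ^+ 2 + N c ^+ 2 * t ^+ 4).
Proof.
case: a => a1 a2; case: b => b1 b2; case: c => c1 c2.
by rewrite !sqrrN !normc_sqr /=; ring.
Qed.

Lemma sqr_perturbation (x y del K : R) : 0 <= x -> 0 <= y -> 0 <= del -> y <= K ->
  y <= x + del -> y ^+ 2 - 2 * K * del <= x ^+ 2.
Proof.
move=> x0 y0 d0 yK yx; have yd : y * del <= K * del by rewrite ler_wpM2r.
have [yd'|yd'] := leP y del.
  have : y * y <= y * del by rewrite ler_wpM2l.
  by have := sqr_ge0 x; have := sqr_ge0 y; rewrite !expr2; lra.
have h : (y - del) ^+ 2 <= x ^+ 2 by rewrite lerXn2r // ?nnegrE; lra.
by apply: le_trans h; have := sqr_ge0 del; rewrite sqrrB; lra.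
Qed.

(** Averaging over the four points z + t, z + it, z - t, z - it kills the
    linear and quadratic terms of a second order expansion, so that |q|^2 plus a
    positive multiple of |z|^2 has no interior maximum. *)
Lemma maximum_modulus (q : C -> C) (v : C) (rho M : R) :
  (forall z, N (z - v) <= rho -> expand2 q z) ->
  (forall z, N (z - v) = rho -> N (q z) <= M) ->
  forall z, N (z - v) <= rho -> N (q z) <= M.
Proof.
move=> qE qM z1 z1v; rewrite leNgt; apply/negP => qz1.
have rho0 : 0 <= rho := le_trans (normc_ge0 _) z1v.
have [|M0] := ltP M 0.
  move=> M0; suff [w wv] : exists w, N (w - v) = rho.
    by have := qM w wv; have := normc_ge0 (q w); lra.
  by exists (v + rho%:C%C); rewrite addrAC subrr add0r normc_real ger0_norm.
(* eta is so small that the maximum of phi over the disk is still interior *)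
pose eta := (N (q z1) ^+ 2 - M ^+ 2) / (2 * (rho ^+ 2 + 1)).
have num0 : 0 < N (q z1) ^+ 2 - M ^+ 2 by rewrite subr_gt0 ltrXn2r // ?nnegrE ?normc_ge0.
have den0 : 0 < 2 * (rho ^+ 2 + 1) by have := sqr_ge0 rho; lra.
have eta0 : 0 < eta by rewrite divr_gt0.
have etaE : eta * (2 * (rho ^+ 2 + 1)) = N (q z1) ^+ 2 - M ^+ 2.
  by rewrite /eta divfK // gt_eqF.
pose phi w := N (q w) * N (q w) + eta * (N (w - v) * N (w - v)).
have phic w : N (w - v) <= rho -> {for w, continuous phi}.
  move=> wv; have c1 := normc_continuous (expand2_continuous (qE w wv)).
  have c2 : {for w, continuous (fun x : C => N (x - v))}.
    apply: normc_continuous; apply/continuous_normcP => e e0.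
    by exists e => // x; rewrite opprB addrA subrK.
  have c1' : (fun x => N (q x)) @ (nbhs w) --> N (q w) by [].
  have c2' : (fun x => N (x - v)) @ (nbhs w) --> N (w - v) by [].
  suff : phi @ (nbhs w) --> phi w by [].
  exact: (cvgD (cvgM c1' c1') (cvgM (cvg_cst eta) (cvgM c2' c2'))).
have [||zs zsA zmax] := @compact_EVT_max C R phi [set z : C | N (z - v) <= rho]
    _ (@closed_disc_compact R v rho).
- by exists v; rewrite /= subrr Normc.normc0.
- by apply: continuous_in_subspaceT => w; rewrite inE; exact: phic.
rewrite inE /= in zsA.
have {}zmax w : N (w - v) <= rho -> phi w <= phi zs.
  by move=> wv; apply: zmax; rewrite inE.
have etarho : eta * rho ^+ 2 < N (q z1) ^+ 2 - M ^+ 2.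
  by rewrite -etaE; have := mulr_ge0 (ltW eta0) (sqr_ge0 rho); lra.
have zsin : N (zs - v) < rho.
  rewrite lt_neqAle zsA andbT; apply/eqP => zsb.
  have := zmax z1 z1v; rewrite /phi zsb -!expr2.
  have : 0 <= eta * N (z1 - v) ^+ 2 by rewrite mulr_ge0 ?sqr_ge0 ?ltW.
  have : N (q zs) ^+ 2 <= M ^+ 2 by rewrite lerXn2r ?nnegrE ?normc_ge0 // qM.
  by lra.
have [a [b [c zE]]] := qE zs zsA; have aE := expand2_value zE.
pose K := N a + N b + N c.
have K0 : 0 <= K by rewrite !addr_ge0 ?normc_ge0.
have K1 : 0 < 4 * (K + 1) by lra.
pose e := eta / (4 * (K + 1)).
have e0 : 0 < e by rewrite divr_gt0.
have eE : e * (4 * (K + 1)) = eta by rewrite /e divfK // gt_eqF.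
have [r r0 hr] := zE e e0.
pose t := Num.min (Num.min 1 r) (rho - N (zs - v)) / 2.
have t0 : 0 < t by rewrite divr_gt0 // !lt_min ltr01 r0 subr_gt0.
have [tr t1 trho] : [/\ t < r, t <= 1 & N (zs - v) + t <= rho].
  have : t * 2 <= Num.min (Num.min 1 r) (rho - N (zs - v)) by rewrite divfK.
  rewrite !le_min => /andP[/andP[h1 h2] h3]; split; lra.
have point h : N h = t ->
    N (a + b * h + c * h ^+ 2) ^+ 2 - 2 * K * (e * t ^+ 2)
    + eta * N (zs + h - v) ^+ 2 <= phi zs.
  move=> ht; have := zmax (zs + h); have -> : zs + h - v = (zs - v) + h by ring.
  move=> /(_ (le_trans (ler_normcD _ _) _)); rewrite ht => /(_ trho).
  apply: le_trans; rewrite /phi -!expr2.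
  have -> : zs + h - v = (zs - v) + h by ring.
  rewrite lerD2r; have := hr h; rewrite ht => /(_ tr) hq.
  apply: sqr_perturbation; rewrite ?normc_ge0 //.
  - by rewrite mulr_ge0 ?sqr_ge0 ?ltW.
  - by apply: quadratic_bound; rewrite ht.
  set A := a + b * h + c * h ^+ 2 in hq *; set Q := q _ in hq *.
  rewrite -[A in leLHS](subrKC Q); apply: le_trans (ler_normcD _ _) _.
  by rewrite lerD2l normc_sub.
have nt : N (t%:C%C : C) = t by rewrite normc_real ger0_norm // ltW.
have nit : N ('i%C * t%:C%C : C) = t by rewrite Normc.normcM normc_i mul1r.
have p1 := point t%:C%C nt.
have p2 := point (- t%:C%C); rewrite normc_opp in p2; have {}p2 := p2 nt.
have p3 := point _ nit.
have p4 := point (- ('i%C * t%:C%C)); rewrite normc_opp in p4; have {}p4 := p4 nit.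
have id1 := four_points a b c t.
have id2 := four_points (zs - v) 1 0 t.
rewrite !mul0r !addr0 !mul1r Normc.normc0 Normc.normc1 expr1n mul1r in id2.
rewrite expr0n mul0r addr0 in id2.
have sh h : zs + h - v = zs - v + h by ring.
rewrite !sh in p1 p2 p3 p4.
have b0 : 0 <= N b ^+ 2 * t ^+ 2 by rewrite mulr_ge0 ?sqr_ge0.
have c0 : 0 <= N c ^+ 2 * t ^+ 4 by rewrite mulr_ge0 ?exprn_even_ge0 ?sqr_ge0.
have phiE : phi zs = N a ^+ 2 + eta * N (zs - v) ^+ 2 by rewrite /phi aE -!expr2.
rewrite phiE in p1 p2 p3 p4.
have t20 : 0 < t ^+ 2 by rewrite exprn_gt0.
have et : 0 < e * t ^+ 2 by rewrite mulr_gt0.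
have etaT : eta * t ^+ 2 = 4 * (K * (e * t ^+ 2)) + 4 * (e * t ^+ 2) by rewrite -eE; ring.
have Ke : 0 <= K * (e * t ^+ 2) by rewrite mulr_ge0 // ltW.
move: id1 id2 p1 p2 p3 p4.
set u1 := N _ ^+ 2; set u2 := N _ ^+ 2; set u3 := N _ ^+ 2; set u4 := N _ ^+ 2.
set w1 := N (zs - v + t%:C%C) ^+ 2; set w2 := N (zs - v - t%:C%C) ^+ 2.
set w3 := N (zs - v + 'i%C * t%:C%C) ^+ 2; set w4 := N (zs - v - 'i%C * t%:C%C) ^+ 2.
move=> id1 id2 p1 p2 p3 p4.
have : eta * (w1 + w2 + w3 + w4) = 4 * (eta * N (zs - v) ^+ 2) + 4 * (eta * t ^+ 2).
  by rewrite id2; ring.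
by rewrite !mulrDr; lra.
Qed.

End MaximumModulus.

(** * Unique continuation *)

Section UniqueContinuation.
Variable R : realType.
Local Notation C := (complex_complex__canonical__Num_ClosedField R).
Local Notation N := (@Normc.normc R).
Local Notation re := (@complex.Re R).
Local Notation im := (@complex.Im R).
Implicit Types (f g P : C -> C) (a c v z w : C) (r s : R).

Lemma ball_square c r z : N (z - c) < r -> square c r z.
Proof.
move=> zr; split; rewrite -?ReB -?ImB.
  exact: le_lt_trans (normc_ge_absRe _) zr.
exact: le_lt_trans (normc_ge_absIm _) zr.
Qed.

Lemma square_ball c r z : square c r z -> N (z - c) < 2 * r.
Proof.
move=> [z1 z2]; apply: le_lt_trans (normc_le_absReIm _) _.
by rewrite ReB ImB mulr2n mulrDl !mul1r ltrD.
Qed.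

Lemma square_open c r z : square c r z -> exists2 s, 0 < s &
  forall w, N (w - z) < s -> square c r w.
Proof.
move=> [z1 z2]; exists (Num.min (r - `|re z - re c|) (r - `|im z - im c|)).
  by rewrite lt_min !subr_gt0 z1.
move=> w; rewrite lt_min => /andP[w1 w2]; split.
  rewrite -(subrK (re z) (re w)) -addrA; apply: le_lt_trans (ler_normD _ _) _.
  by rewrite -ltrBrDr -ReB; exact: le_lt_trans (normc_ge_absRe _) w1.
rewrite -(subrK (im z) (im w)) -addrA; apply: le_lt_trans (ler_normD _ _) _.
by rewrite -ltrBrDr -ImB; exact: le_lt_trans (normc_ge_absIm _) w2.
Qed.

(** [P] is a primitive of [f], in the quantitative form provided by Goursat's
    theorem. *)
Definition integrates c r f P : Prop :=
  forall z z' al be e, square c r z -> square c r z' ->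
    (forall w, N (w - z) <= N (z' - z) -> N (f w - (al + be * (w - z))) <= e) ->
    N (P z' - P z - (al * (z' - z) + be * (z' - z) ^+ 2 / 2)) <=
      4 * e * N (z' - z).

Lemma integrates_expand2 c r f P z d : integrates c r f P -> square c r z ->
  cdiff f z d -> expand2 P z.
Proof.
move=> fP zr fd; exists (P z), (f z), (d / 2) => e e0.
have [s s0 hs] := square_open zr.
have e40 : 0 < e / 4 by rewrite divr_gt0.
have [t t0 ht] := fd _ e40.
exists (Num.min s t); first by rewrite lt_min s0.
move=> h; rewrite lt_min => /andP[h1 h2].
have hE : z + h - z = h by rewrite addrAC subrr add0r.
have := fP z (z + h) (f z) d (e / 4 * N h) zr _ _.
rewrite hE => /(_ (hs _ _)); rewrite hE => /(_ h1) est.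
have -> : P (z + h) - (P z + f z * h + d / 2 * h ^+ 2) =
   P (z + h) - P z - (f z * h + d * h ^+ 2 / 2) by ring.
have -> : e * N h ^+ 2 = 4 * (e / 4 * N h) * N h by field.
apply: est => w wh; have := ht (w - z) (le_lt_trans wh h2).
rewrite subrKC opprD addrA => /le_trans; apply.
by rewrite ler_wpM2l // ltW.
Qed.

Lemma integrates_const c r f P v s : integrates c r f P -> square c r v ->
  (forall z, N (z - v) < s -> f z = 0) ->
  forall z, square c r z -> N (z - v) < s -> P z = P v.
Proof.
move=> fP vr f0 z zr zs; have := fP v z 0 0 0 vr zr.
rewrite !mul0r addr0 subr0 mulr0 mul0r => h.
apply/eqP; rewrite -subr_eq0 -normc_eq0 eq_le normc_ge0 andbT; apply: h => w ws.
by rewrite f0 ?(le_lt_trans ws) // mul0r addr0 subr0 Normc.normc0.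
Qed.

Lemma integrates_zero c r f P z d s : integrates c r f P -> square c r z ->
  cdiff f z d -> 0 < s -> (forall w, N (w - z) < s -> P w = P z) -> f z = 0.
Proof.
move=> fP zr fd s0 Pz; apply/eqP; rewrite -normc_eq0 eq_le normc_ge0 andbT.
apply/ler_addgt0Pl => e e0; rewrite addr0.
have [t t0 ht] := square_open zr.
have e40 : 0 < e / 4 by rewrite divr_gt0.
have [u u0 hu] := cdiff_continuous fd e40.
pose x := Num.min s (Num.min t u) / 2.
have x0 : 0 < x by rewrite divr_gt0 // !lt_min s0 t0 u0.
have [xs xt xu] : [/\ x < s, x < t & x < u].
  have : x * 2 <= Num.min s (Num.min t u) by rewrite divfK.
  by rewrite !le_min => /andP[h1 /andP[h2 h3]]; split; lra.
pose z' := z + x%:C%C.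
have zz : z' - z = x%:C%C by rewrite /z' addrAC subrr add0r.
have nz : N (z' - z) = x by rewrite zz normc_real ger0_norm // ltW.
have := fP z z' (f z) 0 (e / 4) zr; rewrite nz => /(_ (ht _ _)); rewrite nz.
move=> /(_ xt) est; have {}est : N (P z' - P z - (f z * (z' - z) + 0 * (z' - z) ^+ 2 / 2)) <= 4 * (e / 4) * x.
  apply: est => w wx; rewrite mul0r addr0; apply/ltW/hu.
  exact: le_lt_trans wx xu.
move: est; rewrite Pz ?nz // subrr !mul0r addr0 sub0r normc_opp Normc.normcM nz.
by rewrite ler_pM2r // mulrC divfK.
Qed.

Lemma geometric_null (x M y : R) : 0 <= x -> x < 1 ->
  (forall n, y <= M * x ^+ n) -> y <= 0.
Proof.
move=> x0 x1 yM; have := @cvg_geometric R M x; rewrite ger0_norm // => /(_ x1) g.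
rewrite -(cvg_lim (@Rhausdorff R) g).
by apply: limr_ge; [exact: (cvgP _ g)|apply: nearW => n; exact: yM].
Qed.

(** By Goursat's theorem [f] has a primitive [P], which is constant near [v].  The
    maximum modulus principle for [(P - P v) / (z - v)^n], extended by [0] near
    [v], shows as [n] grows that [P - P v] vanishes on a disk around [v] that
    contains [a]. *)
Lemma local_unique_continuation f a r : 0 < r ->
  (forall z, N (z - a) < 8 * r -> exists d, cdiff f z d) ->
  forall v s, 0 < s -> N (v - a) < r -> (forall z, N (z - v) < s -> f z = 0) ->
  forall z, N (z - a) < r -> f z = 0.
Proof.
move=> r0 fd v s s0 va f0.
have [|||P fP] := @primitive_estimate R f a (4 * r) _ (3 * r); try lra.
  move=> z /square_ball zr; apply: fd; lra.
have {}fP : integrates a (3 * r) f P by [].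
have disc z : N (z - v) <= 2 * r -> square a (3 * r) z.
  move=> zv; apply: ball_square; have := ler_normc_tri z a v; lra.
have fdd z : square a (3 * r) z -> exists d, cdiff f z d.
  by move=> /square_ball h; apply: fd; lra.
have vr : square a (3 * r) v by apply: disc; rewrite subrr Normc.normc0; lra.
pose s' := Num.min s (2 * r).
have s'0 : 0 < s' by rewrite lt_min s0 mulr_gt0.
have P0 z : N (z - v) < s' -> P z = P v.
  rewrite lt_min => /andP[zs zr].
  by apply: (integrates_const fP vr f0) => //; apply: disc; exact: ltW.
pose g n z := (P z - P v) / (z - v) ^+ n.
have Pexp z : N (z - v) <= 2 * r -> expand2 P z.
  by move=> /disc zr; have [d zd] := fdd _ zr; exact: integrates_expand2 fP zr zd.
have qexp z : N (z - v) <= 2 * r -> expand2 (fun w => P w - P v) z.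
  move=> zr; have [x [y [t h]]] := Pexp z zr; exists (x - P v), y, t => e /h[u u0 hu].
  exists u => // k /hu; rewrite [P _ - _ - _](_ : _ = P (z + k) - (x + y * k + t * k ^+ 2)) //.
  by ring.
have gexp n z : N (z - v) <= 2 * r -> expand2 (g n) z.
  move=> zr; have [->|zv] := eqVneq z v.
    apply: expand2_near (expand2_cst 0 v) => [|w wv]; first exact: s'0.
    by rewrite /g P0 // subrr mul0r.
  have e2 := expand2_pow n (expand2_inv zv).
  apply: (expand2_near (r := 1) _ _ (expand2_mul (qexp z zr) e2)) => // w _.
  by rewrite /g exprVn.
have [M hM] : exists M, forall z, N (z - v) = 2 * r -> N (P z - P v) <= M.
  have [||w _ wmax] := @compact_EVT_max C R (fun z => N (P z - P v))
    [set z : C | N (z - v) <= 2 * r] _ (@closed_disc_compact R v (2 * r)).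
  - by exists v; rewrite /= subrr Normc.normc0; lra.
  - apply: continuous_in_subspaceT => w; rewrite inE => wv.
    exact: (normc_continuous (f := fun z => P z - P v)
      (expand2_continuous (qexp w wv))).
  exists (N (P w - P v)) => z zr; apply: wmax; rewrite inE /= zr; exact: lexx.
have r20 : 0 < 2 * r by rewrite mulr_gt0.
have bound n z : N (z - v) <= 2 * r -> N (P z - P v) <= M * (N (z - v) / (2 * r)) ^+ n.
  move=> zr; have [->|zv] := eqVneq z v.
    rewrite !subrr Normc.normc0 mul0r; case: n => [|n]; last by rewrite expr0n mulr0.
    rewrite expr0 mulr1; apply: le_trans (hM (v + (2 * r)%:C%C) _).
      exact: normc_ge0.
    by rewrite addrAC subrr add0r normc_real ger0_norm // ltW.
  have nzv : 0 < N (z - v) by rewrite normc_gt0 subr_eq0.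
  have := maximum_modulus (M := M / (2 * r) ^+ n) (gexp n) _ zr.
  have nfrac w : N (g n w) = N (P w - P v) / N (w - v) ^+ n.
    by rewrite /g Normc.normcM Normc.normcV normc_exp.
  rewrite nfrac ler_pdivrMr ?exprn_gt0 // mulrAC -mulrA -expr_div_n; apply.
  move=> w wr; by rewrite nfrac wr ler_wpM2r ?invr_ge0 ?exprn_ge0 ?(ltW r20) // hM.
have Pconst z : N (z - v) < 2 * r -> P z = P v.
  move=> zr; apply/eqP; rewrite -subr_eq0 -normc_eq0 eq_le normc_ge0 andbT.
  apply: (@geometric_null (N (z - v) / (2 * r)) M).
  - by rewrite divr_ge0 ?normc_ge0 // ltW.
  - by rewrite ltr_pdivrMr // mul1r.
  - by move=> n; apply: bound; exact: ltW.
move=> z za; have zv : N (z - v) < 2 * r.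
  by have := ler_normc_tri z v a; rewrite (normc_sub a); lra.
have zr := disc z (ltW zv); have [d zd] := fdd _ zr.
have e0 : 0 < 2 * r - N (z - v) by rewrite subr_gt0.
apply: (integrates_zero fP zr zd e0) => w wz; rewrite !Pconst //.
by have := ler_normc_tri w v z; lra.
Qed.

End UniqueContinuation.

(** * Holomorphy and limits in the Hardy space *)

Section HardyLimits.
Variable R : realType.
Local Notation C := (complex_complex__canonical__Num_ClosedField R).
Local Notation N := (@Normc.normc R).
Local Notation re := (@complex.Re R).
Local Notation disk := (unit_disk (C := C)).
Implicit Types (g : C -> C) (X : set C) (s t : seq (C * C)).

Lemma sqr_norm_le (x c : C) : 0 <= c ->
  (`|x| ^+ 2 <= c) = (N x <= Num.sqrt (re c)).
Proof.
move=> c0; have cR := RRe_real (ger0_real c0).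
have r0 : 0 <= re c by rewrite -lecR cR.
rewrite -{1}cR normrE -rmorphXn lecR -{1}(sqr_sqrtr r0) ler_sqr ?nnegrE //.
exact: normc_ge0.
Qed.

Lemma normc_conj (z : C) : N z^* = N z.
Proof. by apply: complexI; rewrite -!normrE norm_conjC. Qed.

Lemma szego_den_ge (w z : C) (rho : R) : N w <= rho -> N z <= rho -> rho < 1 ->
  1 - rho <= N (1 - z * w^*).
Proof.
move=> wr zr r1; have r0 : 0 <= rho := le_trans (normc_ge0 _) wr.
have := ler_normcD (1 - z * w^*) (z * w^*); rewrite subrK Normc.normc1.
rewrite Normc.normcM normc_conj.
have : N z * N w <= rho * 1.
  by apply: ler_pM; rewrite ?normc_ge0 //; apply: le_trans wr (ltW r1).
by lra.
Qed.

Lemma szego_lipschitz (x y w : C) (rho : R) : N x <= rho -> N y <= rho ->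
  N w <= rho -> rho < 1 ->
  N (szego x w - szego y w) <= N (x - y) / (1 - rho) ^+ 2.
Proof.
move=> xr yr wr r1; have r0 : 0 < 1 - rho by rewrite subr_gt0.
have h1 := szego_den_ge xr wr r1; have h2 := szego_den_ge yr wr r1.
have n1 : 0 < N (1 - w * x^*) := lt_le_trans r0 h1.
have n2 : 0 < N (1 - w * y^*) := lt_le_trans r0 h2.
have -> : szego x w - szego y w =
    w * (x - y)^* / ((1 - w * x^*) * (1 - w * y^*)).
  move: n1 n2; rewrite !normc_gt0 /szego rmorphB /= => n1 n2.
  move: (x^*) (y^*) n1 n2 => x' y' n1 n2.
  by field; rewrite n1 n2.
rewrite Normc.normcM Normc.normcV !Normc.normcM normc_conj.
apply: ler_pM; rewrite ?mulr_ge0 ?normc_ge0 //.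
- by rewrite invr_ge0 mulr_ge0 ?normc_ge0.
- by rewrite ler_piMl ?normc_ge0 // (le_trans wr) // ltW.
- rewrite lef_pV2 ?posrE ?mulr_gt0 ?exprn_gt0 // expr2.
  by apply: ler_pM => //; exact: ltW.
Qed.

Lemma dominated_lipschitz X g (c : C) (rho : R) : 0 <= c -> dominated X g c ->
  rho < 1 -> exists2 L : R, 0 <= L & forall x y, X x -> X y ->
    N x <= rho -> N y <= rho -> N (g x - g y) ^+ 2 <= L * N (x - y).
Proof.
move=> c0 gX r1; have r0 : 0 < 1 - rho by rewrite subr_gt0.
have cR := RRe_real (ger0_real c0).
have cr0 : 0 <= re c by rewrite -lecR cR.
exists (re c * (2 / (1 - rho) ^+ 2)) => [|x y Xx Xy xr yr].
  by rewrite mulr_ge0 // divr_ge0 // exprn_ge0 // ltW.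
have := dominated_diff Xx Xy gX.
set k := _ - _ - _ + _ => h.
have ck : N (c * k) = re c * N k.
  by rewrite Normc.normcM -{1}cR normc_real ger0_norm.
have : `|g x - g y| ^+ 2 <= `|c * k|.
  by rewrite (ger0_norm (le_trans (exprn_ge0 _ (normr_ge0 _)) h)).
rewrite !normrE -rmorphXn lecR ck => /le_trans; apply.
rewrite -mulrA ler_wpM2l //.
have -> : k = (szego x x - szego y x) - (szego x y - szego y y) by rewrite /k; ring.
apply: le_trans (ler_normcB _ _) _.
have h1 := szego_lipschitz xr yr xr r1; have h2 := szego_lipschitz xr yr yr r1.
rewrite mulrAC -mulrA mulr2n mulrDl !mul1r; exact: lerD.
Qed.

Lemma dominated_subcst g (c ga : C) : dominated disk g c ->
  dominated disk (fun z => g z - ga) (2 * c + 2 * `|ga| ^+ 2).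
Proof.
move=> gc s ds; have h1 := gc s ds; have h2 := pairing1_dominated ds.
have -> : pairing (fun z => g z - ga) s = pairing g s - ga * pairing (fun=> 1) s.
  rewrite /pairing mulr_sumr -sumrB; apply: eq_bigr => p _; ring.
have par (x y : C) : `|x - y| ^+ 2 <= 2 * `|x| ^+ 2 + 2 * `|y| ^+ 2.
  rewrite -subr_ge0; suff -> : 2 * `|x| ^+ 2 + 2 * `|y| ^+ 2 - `|x - y| ^+ 2 =
    `|x + y| ^+ 2 by rewrite exprn_ge0.
  by rewrite !normCK rmorphB rmorphD /=; ring.
apply: le_trans (par _ _) _; rewrite [leRHS]mulrDl -[X in _ <= X + _]mulrA -[X in _ <= _ + X]mulrA.
apply: lerD; rewrite ler_wpM2l //.
rewrite normrM exprMn ler_wpM2l ?exprn_ge0 //.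
by rewrite mul1r in h2.
Qed.

Lemma punctured_limit (f : C -> C) (z : C) (del L : R) : 0 < del -> 0 <= L ->
  (forall x y, x != z -> y != z -> N (x - z) < del -> N (y - z) < del ->
     N (f x - f y) ^+ 2 <= L * N (x - y)) ->
  exists l : C, forall e, 0 < e -> exists2 r, 0 < r &
    forall x, x != z -> N (x - z) < r -> N (f x - l) <= e.
Proof.
move=> del0 L0 fL.
have Fp : ProperFilter (dnbhs z).
  apply: Build_ProperFilter_ex => P /dnbhs_normcP[r r0 rP].
  have r20 : 0 < r / 2 by rewrite divr_gt0.
  have E : z + (r / 2)%:C%C - z = (r / 2)%:C%C by rewrite addrAC subrr add0r.
  exists (z + (r / 2)%:C%C); apply: rP.
    by rewrite -subr_eq0 -normc_eq0 E normc_real gtr0_norm // gt_eqF.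
  by rewrite E normc_real gtr0_norm //; lra.
have [G [GU Gz]] := ultraFilterLemma Fp.
have GF := @ultra_proper _ _ GU.
have near e : 0 < e -> G [set x | x != z /\ N (x - z) < e].
  by move=> e0; apply: Gz; apply/dnbhs_normcP; exists e.
have dist x y : N (x - z) < del -> N (y - z) < del -> N (x - y) <= 2 * del.
  by move=> xz yz; have := ler_normc_tri x y z; rewrite (normc_sub z); lra.
have [x0 [x0z x0d]] := @filter_ex _ G GF _ (near _ del0).
have [|l Gl] := @ultra_bounded_cvg R _ G GU f (N (f x0) + (L * (2 * del) + 1)).
  apply: filterS (near _ del0) => y [yz yd] /=.
  rewrite -[f y](subrKC (f x0)); apply: le_trans (ler_normcD _ _) _.
  rewrite lerD2l; set u := N _.
  have u0 : 0 <= u by exact: normc_ge0.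
  have : u ^+ 2 <= L * (2 * del).
    by apply: le_trans (fL _ _ yz x0z yd x0d) _; rewrite ler_wpM2l ?dist.
  by nra.
exists l => e e0.
pose r := Num.min del (e ^+ 2 / (2 * (L + 1))).
have L1 : 0 < 2 * (L + 1) by lra.
have r0 : 0 < r by rewrite lt_min del0 divr_gt0 ?exprn_gt0.
exists r => // x xz xr.
have rdel : r <= del by rewrite ge_min lexx.
have rL : r * (2 * (L + 1)) <= e ^+ 2 by rewrite -ler_pdivlMr // ge_min lexx orbT.
have cv : (fun y => f x - f y) @ G --> (f x - l : C).
  apply/cvg_normcP => d /((cvg_normcP f l).1 Gl); apply: filterS => y.
  by rewrite [_ - _ - _](_ : _ = - (f y - l)) ?normc_opp //; ring.
apply: (cvg_normc_le GF cv); apply: filterS (near _ r0) => y [yz yr].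
have h := fL x y xz yz (lt_le_trans xr rdel) (lt_le_trans yr rdel).
rewrite -(@ler_pXn2r _ 2) ?nnegrE ?normc_ge0 ?(ltW e0) //.
apply: le_trans h _; apply: le_trans rL.
have : N (x - y) <= 2 * r.
  by have := ler_normc_tri x y z; rewrite (normc_sub z); lra.
by move=> h; have := normc_ge0 (x - y); nra.
Qed.

(** The difference quotient at [z] is, up to a smooth factor, [g - g z] divided by
    the Blaschke factor of [z].  This lies in the Hardy space of the punctured
    disk, so it is uniformly continuous near [z] and has a limit there. *)
Lemma dominated_cdiff g (c : C) z : 0 <= c -> dominated disk g c -> disk z ->
  exists d, cdiff g z d.
Proof.
move=> c0 gc dz.
have c'0 : 0 <= 2 * c + 2 * `|g z| ^+ 2 by rewrite addr_ge0 ?mulr_ge0 ?exprn_ge0.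
have g0z : (fun w => g w - g z) z = 0 by rewrite subrr.
have g1 := dominated_div (@subset_refl _ disk) c'0 dz g0z (dominated_subcst (g z) gc).
set f := (fun w => _ / _) in g1.
have zlt : N z < 1 by move: dz; rewrite unit_diskE.
pose rho := (N z + 1) / 2; have rho1 : rho < 1 by rewrite /rho; lra.
have zrho : N z < rho by rewrite /rho; lra.
pose del := rho - N z; have del0 : 0 < del by rewrite subr_gt0.
have near w : N (w - z) < del -> N w <= rho.
  by move=> wz; have := ler_normcD (w - z) z; rewrite subrK /del in wz *; lra.
have near' w : w != z -> N (w - z) < del -> (disk `\ z) w.
  move=> /eqP wz /near wr; split=> //; rewrite unit_diskE; lra.
have [L L0 fL] := dominated_lipschitz c'0 g1 rho1.
have [|l fl] := @punctured_limit f z del L del0 L0.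
  by move=> x y xz yz xd yd; apply: fL; [exact: near'|exact: near'|exact: near|exact: near].
pose be w := (1 - w * z^*)^-1.
have m0 : 0 < 1 - rho by rewrite subr_gt0.
have beN w : N w <= rho -> N (be w) <= (1 - rho)^-1.
  move=> wr; rewrite /be Normc.normcV lef_pV2 ?posrE //.
    exact: szego_den_ge (ltW zrho) wr rho1.
  exact: lt_le_trans (szego_den_ge (ltW zrho) wr rho1).
have den w : N w <= rho -> 1 - w * z^* != 0.
  by move=> wr; rewrite -normc_gt0; apply: lt_le_trans (szego_den_ge (ltW zrho) wr rho1).
exists (l * be z) => e e0.
have K0 : 0 < (1 - rho)^-1 by rewrite invr_gt0.
have e1 : 0 < e * (1 - rho) / 2 by rewrite !mulr_gt0 ?invr_gt0.
have [r r0 hr] := fl _ e1.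
pose K := N l / (1 - rho) ^+ 2 + 1.
have K1 : 0 < K by rewrite ltr_wpDl // divr_ge0 ?normc_ge0 // exprn_ge0 // ltW.
exists (Num.min (Num.min r del) (e / 2 / K)).
  by rewrite !lt_min r0 del0 !divr_gt0.
move=> h; rewrite !lt_min => /andP[/andP[hr' hd] hK].
have [->|h0] := eqVneq h 0.
  by rewrite addr0 subrr mulr0 subrr Normc.normc0 mulr0.
have hz : z + h - z = h by rewrite addrAC subrr add0r.
have zh : z + h != z by rewrite -subr_eq0 hz.
have zhr : N (z + h) <= rho by apply: near; rewrite hz.
have gE : g (z + h) - g z = f (z + h) * be (z + h) * h.
  rewrite /f /be /blaschke hz.
  have hd' := den _ zhr; move: (z^*) hd' => z' hd'.
  by field; rewrite hd' h0.
have -> : g (z + h) - g z - l * be z * h =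
    ((f (z + h) - l) * be (z + h) + l * (be (z + h) - be z)) * h.
  by rewrite gE; ring.
rewrite Normc.normcM ler_wpM2r ?normc_ge0 //.
apply: le_trans (ler_normcD _ _) _; rewrite [leRHS]splitr; apply: lerD.
  rewrite Normc.normcM; apply: (@le_trans _ _ (e * (1 - rho) / 2 * (1 - rho)^-1)).
    apply: ler_pM; rewrite ?normc_ge0 //; last exact: beN.
    by apply: hr => //; rewrite hz.
  by rewrite mulrAC mulfK // gt_eqF.
have -> : be (z + h) - be z = h * z^* * (be (z + h) * be z).
  rewrite /be; have hd1 := den _ zhr; have hd2 := den _ (ltW zrho).
  by move: (z^*) hd1 hd2 => z' hd1 hd2; field; rewrite hd1 hd2.
have bb : N (be (z + h) * be z) <= ((1 - rho) ^+ 2)^-1.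
  rewrite Normc.normcM expr2 invfM; apply: ler_pM; rewrite ?normc_ge0 ?beN //.
  exact: ltW.
rewrite Normc.normcM Normc.normcM (Normc.normcM h) normc_conj.
apply: (@le_trans _ _ (N l * (N h * ((1 - rho) ^+ 2)^-1))).
  rewrite ler_wpM2l ?normc_ge0 //; apply: ler_pM; rewrite ?mulr_ge0 ?normc_ge0 //.
  by rewrite ler_piMr ?normc_ge0 // ltW.
apply: (@le_trans _ _ (K * N h)).
  rewrite [N h * _]mulrC mulrA ler_wpM2r ?normc_ge0 // lerDl ler01 //.
by rewrite mulrC -ler_pdivlMr // ltW.
Qed.

Lemma form_pairing g s t : form szego (rescale g s) t =
  pairing g (rescale (fun z => form szego [:: (1, z)] t) s).
Proof.
rewrite pairing_rescale /form big_map; apply: eq_bigr => p _.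
rewrite big_seq1 mulr_suml mulr_sumr; apply: eq_bigr => q _ /=; ring.
Qed.

(** By duality, membership in the Schur class amounts to conditions that are
    linear in the function, hence pass to pointwise limits. *)
Lemma schur_pairing g : psd disk (schur_kernel g) <->
  forall s t, supported disk s -> supported disk t ->
   `|form szego (rescale g s) t| ^+ 2 <= form szego s s * form szego t t.
Proof.
have E s : supported disk s -> form (schur_kernel g) s s =
    form szego s s - form szego (rescale g s) (rescale g s).
  move=> ds; rewrite form_rescale -mulN1r -formZ -formD.
  by apply: (eq_form ds ds) => w z _ _; rewrite schur_kernelE mulN1r.
split=> [gp s t ds dt|gst s ds].
  have ds' := supported_rescale (g := g) ds.
  apply: le_trans (form_CauchySchwarz (@szego_conj _) (@szego_psd _) ds' dt) _.
  rewrite ler_wpM2r ?szego_psd // -subr_ge0 -E //; exact: gp.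
have ds' := supported_rescale (g := g) ds.
have B0 := szego_psd ds'; have A0 := szego_psd ds.
have := gst s _ ds ds'; rewrite E // subr_ge0 ger0_norm //.
have [->|Bn0] := eqVneq (form szego (rescale g s) (rescale g s)) 0 => //.
by rewrite expr2 ler_pM2r // lt_def Bn0.
Qed.

Lemma cvg_pairing T (F : set_system T) (FF : Filter F) (G : T -> C -> C) g s :
  (forall p, p \in s -> (fun l => G l p.2) @ F --> (g p.2 : C)) ->
  (fun l => pairing (G l) s) @ F --> (pairing g s : C).
Proof.
elim: s => [|p s IH] Gs.
  have -> : (fun l => pairing (G l) [::]) = (fun=> pairing g [::]).
    by apply/funext => l; rewrite /pairing !big_nil.
  exact: cvg_cst.
have -> : (fun l => pairing (G l) (p :: s)) =
    (fun l => p.1 * G l p.2 + pairing (G l) s).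
  by apply/funext => l; rewrite pairing_cons.
rewrite pairing_cons.
have h1 : (fun l => G l p.2) @ F --> (g p.2 : C) by apply: Gs; rewrite mem_head.
have h2 : (fun l => pairing (G l) s) @ F --> (pairing g s : C).
  by apply: IH => q qs; apply: Gs; rewrite inE qs orbT.
exact: (cvgD (cvgM (cvg_cst p.1) h1) h2).
Qed.

Lemma dominated_limit T (F : set_system T) (FF : ProperFilter F) (G : T -> C -> C) g (c : C) :
  0 <= c -> (forall z, disk z -> (fun l => G l z) @ F --> (g z : C)) ->
  (\forall l \near F, dominated disk (G l) c) -> dominated disk g c.
Proof.
move=> c0 Gg Gc s ds; have cf0 : 0 <= c * form szego s s.
  by rewrite mulr_ge0 ?szego_psd.
rewrite sqr_norm_le //.
apply: (cvg_normc_le FF (cvg_pairing (G := G) _ _)) => [p /ds /Gg //|].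
by apply: filterS Gc => l /(_ s ds); rewrite sqr_norm_le.
Qed.

Lemma schur_limit T (F : set_system T) (FF : ProperFilter F) (G : T -> C -> C) g :
  (forall z, disk z -> (fun l => G l z) @ F --> (g z : C)) ->
  (\forall l \near F, psd disk (schur_kernel (G l))) -> psd disk (schur_kernel g).
Proof.
move=> Gg Gc; apply/schur_pairing => s t ds dt.
have cf0 : 0 <= form szego s s * form szego t t by rewrite mulr_ge0 ?szego_psd.
rewrite sqr_norm_le // form_pairing.
apply: (cvg_normc_le FF (cvg_pairing (G := G) _ _)).
  by move=> p /(supported_rescale ds) /Gg.
apply: filterS Gc => l /schur_pairing /(_ s t ds dt).
by rewrite sqr_norm_le // form_pairing.
Qed.

(** In a limit along this ultrafilter, each single point of [X] may be assumed to
    belong to the list; no enumeration of [X] is needed. *)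
Lemma finite_lists_ultra X : exists F : set_system (seq C),
  [/\ UltraFilter F, F [set l : seq C | uniq l /\ forall x, x \in l -> X x] &
      forall x, X x -> F [set l : seq C | x \in l]].
Proof.
pose D := [set l : seq C | forall x, x \in l -> X x].
pose B (l0 : seq C) := [set l : seq C | [/\ {subset l0 <= l}, uniq l & D l]].
have Ff : Filter (filter_from D B).
  apply: filter_from_filter; first by exists [::].
  move=> l1 l2 D1 D2; exists (l1 ++ l2).
    by move=> x; rewrite mem_cat => /orP[/D1|/D2].
  by move=> l [l12 ul Dl]; split; split=> // x xl; apply: l12; rewrite mem_cat xl ?orbT.
have Fp : ProperFilter (filter_from D B).
  apply: filter_from_proper => l Dl; exists (undup l); split.
  - by move=> x; rewrite mem_undup.
  - exact: undup_uniq.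
  - by move=> x; rewrite mem_undup; exact: Dl.
have [G [GU FG]] := ultraFilterLemma Fp.
exists G; split=> // [|x Xx]; apply: FG.
  by exists [::] => // l [].
exists [:: x] => [y|l [xl _ _]]; first by rewrite inE => /eqP->.
by apply: xl; rewrite mem_head.
Qed.

Lemma ultra_pointwise_limit T (F : set_system T) (UF : UltraFilter F)
    (G : T -> C -> C) (M : C -> R) (X : set C) :
  (forall z, X z -> F [set l | N (G l z) <= M z]) ->
  exists g, forall z, X z -> (fun l => G l z) @ F --> (g z : C).
Proof.
move=> GM; suff /choice[g gG] : forall z, exists v : C, X z -> (fun l => G l z) @ F --> v.
  by exists g.
move=> z; have [Xz|nXz] := pselect (X z); last by exists 0.
by have [v Gv] := ultra_bounded_cvg UF (GM z Xz); exists v.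
Qed.

End HardyLimits.

(** * Functions whose kernel has one negative square *)

Section KreinLanger.
Variable R : realType.
Local Notation C := (complex_complex__canonical__Num_ClosedField R).
Local Notation N := (@Normc.normc R).
Local Notation re := (@complex.Re R).
Local Notation disk := (unit_disk (C := C)).
Implicit Types (F g : C -> C) (U : set C) (z w : C).

(** A limit of the interpolants on finite subsets of [U].  This takes the place of
    the Krein-Langer factorization: the zero of the affine factor is where the
    function may have its pole. *)
Lemma hardy_multiple F U : U `<=` disk ->
  (forall n (u : 'I_n -> C), (forall i, U (u i)) ->
    (num_neg_eigenvalues (kernel_matrix (schur_kernel F) u) <= 1)%N) ->
  exists a b g, [/\ (a != 0) || (b != 0), dominated disk g 1 &
    forall x, U x -> g x = F x * (a + b * x)].
Proof.
move=> UD Fneg.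
have /choice[abg abgP] : forall l : seq C, exists q : C * C * (C -> C),
    uniq l -> (forall x, x \in l -> U x) ->
    [/\ `|q.1.1| ^+ 2 + `|q.1.2| ^+ 2 = 1, dominated disk q.2 1 &
    forall x, x \in l -> q.2 x = F x * (q.1.1 + q.1.2 * x)].
  move=> l; have [ul|] := boolP (uniq l); last by exists (0, 0, fun=> 0).
  have [lU|nlU] := pselect (forall x, x \in l -> U x); last by exists (0, 0, fun=> 0).
  have Uu i : U (tnth (in_tuple l) i) by apply: lU; exact: mem_tnth.
  have ui : injective (tnth (in_tuple l)) by apply/tuple_uniqP.
  have [a [b [g [ab gd gl]]]] := hardy_interpolation ui (fun i => UD _ (Uu i)) (Fneg _ _ Uu).
  exists (a, b, g) => _ _; split=> // x xl.
  by have /tnthP[i ->] : x \in in_tuple l by []; exact: gl.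
have [G [GU Gl Gx]] := finite_lists_ultra U.
have GF := @ultra_proper _ _ GU; have GFF : Filter G by exact: filter_filter.
pose ga l := (abg l).1.1; pose gb l := (abg l).1.2; pose gg l := (abg l).2.
have nab l : uniq l -> (forall x, x \in l -> U x) -> N (ga l) ^+ 2 + N (gb l) ^+ 2 = 1.
  move=> ul lU; have [h _ _] := abgP l ul lU; apply: complexI.
  by rewrite rmorphD !rmorphXn /= -!normrE.
have le1 (x y : R) : 0 <= x -> x ^+ 2 + y ^+ 2 = 1 -> x <= 1.
  move=> x0 xy; have : x ^+ 2 <= 1 by have := sqr_ge0 y; lra.
  by rewrite expr_le1.
have [|a aG] := @ultra_bounded_cvg R _ G GU ga 1.
  apply: filterS Gl => l /= [ul lU].
  exact: le1 (normc_ge0 _) (nab l ul lU).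
have [|b bG] := @ultra_bounded_cvg R _ G GU gb 1.
  apply: filterS Gl => l /= [ul lU]; apply: (le1 _ (N (ga l))) (normc_ge0 _) _.
  by rewrite addrC; exact: nab.
have [|g gG] := @ultra_pointwise_limit R _ G GU gg (fun z => Num.sqrt (re (szego z z))) disk.
  move=> z dz; apply: filterS Gl => l /= [ul lU].
  have [_ h _] := abgP l ul lU; have := dominated_norm dz h.
  by rewrite mul1r sqr_norm_le // ltW // szego_diag_gt0.
exists a, b, g; split.
- apply/negPn/negP; rewrite negb_or !negbK => /andP[/eqP a0 /eqP b0].
  have h2 : 0 < (2^-1 : R) by rewrite invr_gt0.
  have A := (@cvg_normcP R _ G GFF ga a).1 aG _ h2; have B := (@cvg_normcP R _ G GFF gb b).1 bG _ h2.
  have [l [[ul lU] [/= la lb]]] := @filter_ex _ G GF _ (filterI Gl (filterI A B)).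
  rewrite a0 subr0 in la; rewrite b0 subr0 in lb.
  have := nab l ul lU; have := normc_ge0 (ga l); have := normc_ge0 (gb l); nra.
- apply: (dominated_limit GF ler01 gG); apply: filterS Gl => l [ul lU].
  by have [] := abgP l ul lU.
- move=> x Ux; apply/eqP; rewrite -subr_eq0 -normc_eq0 eq_le normc_ge0 andbT.
  have cv : (fun l => gg l x - F x * (ga l + gb l * x)) @ G -->
      (g x - F x * (a + b * x) : C).
    exact: (cvgB (gG x (UD x Ux)) (cvgM (cvg_cst (F x)) (cvgD aG (cvgM bG (cvg_cst x))))).
  apply: (cvg_normc_le GF cv); apply: filterS (filterI Gl (Gx x Ux)) => l [[ul lU] xl].
  have [_ _ h] := abgP l ul lU.
  by rewrite /gg h // subrr Normc.normc0.
Qed.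

Lemma segment_connected (A : set C) (c : C) : A c ->
  (forall z, A z -> forall t : R, 0 <= t <= 1 -> A (c + t%:C%C * (z - c))) ->
  connected A.
Proof.
move=> Ac Ast; pose seg z := (fun t : R => c + t%:C%C * (z - c)) @` `[0, 1].
have -> : A = \bigcup_(z in A) seg z.
  apply/seteqP; split=> z.
    move=> Az; exists z => //; exists 1; first by rewrite /= in_itv /= ler01 lexx.
    by rewrite mul1r subrKC.
  by move=> [w Aw [t]]; rewrite /= in_itv /= => t01 <-; exact: Ast.
apply: bigcup_connected.
  exists c => z Az; exists 0; first by rewrite /= in_itv /= lexx ler01.
  by rewrite mul0r addr0.
move=> z Az; apply: connected_continuous_connected.
  by apply/connected_intervalP; exact: interval_is_interval.
apply: continuous_subspaceT => t.
suff : (fun t : R => c + t%:C%C * (z - c)) @ (nbhs t) --> (c + t%:C%C * (z - c) : C) by [].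
apply/cvg_normcP => e e0; have K0 : 0 < N (z - c) + 1 by rewrite ltr_wpDl ?normc_ge0.
apply/nbhs_ballP; exists (e / (N (z - c) + 1)); first by rewrite /= divr_gt0.
move=> u; rewrite /ball /= ltr_pdivlMr // distrC => h.
have -> : c + u%:C%C * (z - c) - (c + t%:C%C * (z - c)) = (u - t)%:C%C * (z - c).
  by rewrite rmorphB /=; ring.
rewrite Normc.normcM normc_real; apply: le_lt_trans h.
by rewrite ler_wpM2l // lerDl.
Qed.

Lemma ball_connected (c : C) (r : R) : 0 < r -> connected [set z : C | N (z - c) < r].
Proof.
move=> r0; apply: (@segment_connected _ c); first by rewrite /= subrr Normc.normc0.
move=> z /= zr t /andP[t0 t1]; rewrite addrAC subrr add0r Normc.normcM normc_real.
rewrite ger0_norm //; apply: le_lt_trans zr; by rewrite ler_piMl ?normc_ge0.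
Qed.

Lemma disk_connected : connected disk.
Proof.
have -> : disk = [set z : C | N (z - 0) < 1].
  by apply/funext => z; rewrite unit_diskE /= subr0.
exact: ball_connected.
Qed.

Lemma disk_ball z : disk z -> exists2 e : R, 0 < e & forall w, N (w - z) < e -> disk w.
Proof.
rewrite unit_diskE => z1; exists (1 - N z); first by rewrite subr_gt0.
by move=> w wz; rewrite unit_diskE; have := ler_normcD (w - z) z; rewrite subrK; lra.
Qed.

Lemma derivable_affine (a b z : C) : derivable (fun w : C => a + b * w) z 1.
Proof.
have ca : derivable (fun=> a : C) z 1 by exact: derivable_cst.
have cb : derivable (fun=> b : C) z 1 by exact: derivable_cst.
have cz : derivable (fun w : C => w) z 1 by exact: derivable_id.
exact: (derivableD ca (derivableM cb cz)).
Qed.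

Lemma derivable_subXn (v z : C) n : derivable (fun w : C => (w - v) ^+ n) z 1.
Proof.
elim: n => [|n IH].
  have -> : (fun w : C => (w - v) ^+ 0) = cst 1 by apply/funext => w; rewrite expr0.
  exact: derivable_cst.
have -> : (fun w : C => (w - v) ^+ n.+1) = (fun w => (w - v) * (w - v) ^+ n).
  by apply/funext => w; rewrite exprS.
have cv : derivable (fun=> v : C) z 1 by exact: derivable_cst.
have cz : derivable (fun w : C => w) z 1 by exact: derivable_id.
exact: (derivableM (derivableB cz cv) IH).
Qed.

(** Near a point [z] where [F = G / (w - z)^n], unique continuation is applied to
    the holomorphic function [G (a + b w) - g (w - z)^n]; so the set of points
    with a punctured neighbourhood of agreement is open and closed in the
    disk. *)
Lemma meromorphic_identity F g (a b : C) (U : set C) : meromorphic_on disk F ->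
  dominated disk g 1 -> open U -> U !=set0 -> U `<=` disk ->
  (forall x, U x -> g x = F x * (a + b * x)) ->
  forall z, disk z -> exists2 e : R, 0 < e &
    forall w, w != z -> N (w - z) < e -> F w * (a + b * w) = g w.
Proof.
move=> Fm gd Uo [u0 Uu0] UD gU.
pose Q z := exists2 e : R, 0 < e &
    forall w, w != z -> N (w - z) < e -> F w * (a + b * w) = g w.
have local z : disk z -> exists e : R, [/\ 0 < e, (forall w, N (w - z) < e -> disk w) &
    forall v, N (v - z) < e -> Q v -> forall w, N (w - z) < e -> Q w].
  move=> dz; have [n [G [Gh FG]]] := Fm z dz.
  have [r1 r10 h1] := (nbhs_normcP _ z).1 Gh.
  have [r2 r20 h2] := (dnbhs_normcP _ z).1 FG.
  have [r3 r30 h3] := disk_ball dz.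
  pose r := Num.min r1 (Num.min r2 r3) / 8.
  have r0 : 0 < r by rewrite divr_gt0 // !lt_min r10 r20.
  have [rr1 rr2 rr3] : [/\ 8 * r <= r1, 8 * r <= r2 & 8 * r <= r3].
    have : r * 8 <= Num.min r1 (Num.min r2 r3) by rewrite divfK.
    by rewrite !le_min => /andP[? /andP[? ?]]; split; rewrite mulrC.
  exists r; split=> // [w wz|v vz [e e0 ve] w wz]; first by apply: h3; lra.
  pose H x := G x * (a + b * x) - g x * (x - z) ^+ n.
  have Hd x : N (x - z) < 8 * r -> exists d, cdiff H x d.
    move=> xz; have dx : disk x by apply: h3; exact: lt_le_trans xz rr3.
    have Gx : derivable G x 1 by apply: h1; exact: lt_le_trans xz rr1.
    have [d /cdiff_derivable gx] := dominated_cdiff ler01 gd dx.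
    apply: derivable_cdiff.
    have px : derivable (fun w : C => a + b * w) x 1 by exact: derivable_affine.
    have qx : derivable (fun w : C => (w - z) ^+ n) x 1 by exact: derivable_subXn.
    exact: (derivableB (derivableM Gx px) (derivableM gx qx)).
  (* a point of the domain close to v, but different from v and from z *)
  pose d := Num.min e (r - N (v - z)).
  have d0 : 0 < d by rewrite lt_min e0 subr_gt0.
  have [v' [v'v v'z v'd]] : exists v', [/\ v' != v, v' != z & N (v' - v) < d].
    have E x : v + x%:C%C - v = x%:C%C by rewrite addrAC subrr add0r.
    have ne x : 0 < x -> v + x%:C%C != v.
      by move=> x0; rewrite -subr_eq0 E -normc_eq0 normc_real gtr0_norm // gt_eqF.
    have d2 : 0 < d / 2 by rewrite divr_gt0.
    have d3 : 0 < d / 3 by rewrite divr_gt0.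
    have [zE|zN] := eqVneq (v + (d / 2)%:C%C) z; last first.
      exists (v + (d / 2)%:C%C); rewrite ne // zN E normc_real gtr0_norm //.
      by split=> //; lra.
    exists (v + (d / 3)%:C%C); rewrite ne // E normc_real gtr0_norm //.
    split=> //; last by lra.
    apply/eqP => zE'; have : (d / 2)%:C%C = (d / 3)%:C%C :> C.
      by apply: (addrI v); rewrite zE.
    by move=> /complexI; lra.
  move: v'd; rewrite lt_min => /andP[v'e v'r].
  have v'zr : N (v' - z) < r.
    by have := ler_normc_tri v' z v; lra.
  pose s := Num.min (Num.min (e - N (v' - v)) (N (v' - v))) (Num.min (r - N (v' - z)) (N (v' - z))).
  have s0 : 0 < s.
    by rewrite !lt_min !subr_gt0 v'e v'zr !normc_gt0 !subr_eq0 v'v.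
  have FGn x : x != z -> N (x - z) < 8 * r -> F x = G x / (x - z) ^+ n.
    by move=> xz xr; apply: h2 => //; exact: lt_le_trans xr rr2.
  have H0 x : N (x - v') < s -> H x = 0.
    rewrite !lt_min => /andP[/andP[x1 x2] /andP[x3 x4]].
    have xv : x != v by apply: contraTneq x2 => ->; rewrite normc_sub ltxx.
    have xz : x != z by apply: contraTneq x4 => ->; rewrite normc_sub ltxx.
    have xve : N (x - v) < e by have := ler_normc_tri x v v'; lra.
    have xzr : N (x - z) < 8 * r by have := ler_normc_tri x z v'; lra.
    have x0 : (x - z) ^+ n != 0 by rewrite expf_neq0 // subr_eq0.
    rewrite /H -(ve x xv xve) (FGn x xz xzr); field.
    by rewrite x0.
  have Hz := local_unique_continuation r0 Hd s0 v'zr H0.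
  have FQ x : x != z -> N (x - z) < r -> F x * (a + b * x) = g x.
    move=> xz xr; have x0 : (x - z) ^+ n != 0 by rewrite expf_neq0 // subr_eq0.
    have xr8 : N (x - z) < 8 * r by lra.
    rewrite (FGn x xz xr8); apply: (mulIf x0).
    rewrite -(subr0_eq (Hz x xr)) mulrAC divfK //.
  have [->|wnz] := eqVneq w z; first by exists r.
  have nwz : 0 < N (w - z) by rewrite normc_gt0 subr_eq0.
  exists (Num.min (r - N (w - z)) (N (w - z))); first by rewrite lt_min subr_gt0 wz.
  move=> x xw; rewrite lt_min => /andP[x1 x2]; apply: FQ.
    by apply: contraTneq x2 => ->; rewrite normc_sub ltxx.
  by have := ler_normc_tri x z w; lra.
suff -> : disk = [set z | disk z /\ Q z] by move=> z [].
apply/esym/disk_connected.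
- exists u0; split; first exact: UD.
  have [e e0 eU] := (nbhs_normcP U u0).1 (open_nbhs_nbhs (conj Uo Uu0)).
  by exists e => // w _ /eU /gU.
- exists (interior [set z | disk z /\ Q z]); first exact: open_interior.
  apply/seteqP; split=> z; last by move=> [_ /interior_subset].
  move=> [dz Qz]; split=> //; have [e [e0 h1 h2]] := local z dz.
  apply/nbhs_normcP; exists e => // w we; split; first exact: h1.
  by apply: (h2 z) => //; rewrite subrr Normc.normc0.
- exists (closure [set z | disk z /\ Q z]); first exact: closed_closure.
  apply/seteqP; split=> z; first by move=> [dz Qz]; split=> //; exact: subset_closure.
  move=> [dz clz]; split=> //; have [e [e0 h1 h2]] := local z dz.
  have /clz[v [[dv Qv] /= vz]] : nbhs z [set w | N (w - z) < e].
    by apply/nbhs_normcP; exists e.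
  by apply: (h2 v) => //; rewrite subrr Normc.normc0.
Qed.

Lemma meromorphic_identity_at F g (a b : C) z : dominated disk g 1 -> disk z ->
  (exists2 e : R, 0 < e &
    forall w, w != z -> N (w - z) < e -> F w * (a + b * w) = g w) ->
  holomorphic_at F z -> F z * (a + b * z) = g z.
Proof.
move=> gd dz [e e0 FG] /(nbhs_normcP _ z)[r r0 hr].
have [|dF Fz] := derivable_cdiff (hr z _); first by rewrite subrr Normc.normc0.
have [dg gz] := dominated_cdiff ler01 gd dz.
have Pz : derivable (fun w => F w * (a + b * w) - g w) z 1.
  have px : derivable (fun w : C => a + b * w) z 1 by exact: derivable_affine.
  exact: (derivableB (derivableM (cdiff_derivable Fz) px) (cdiff_derivable gz)).
have [d /cdiff_continuous Hc] := derivable_cdiff Pz.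
apply/eqP; rewrite -subr_eq0 -normc_eq0 eq_le normc_ge0 andbT.
apply/ler_addgt0Pl => x x0; rewrite addr0; have [s s0 hs] := Hc x x0.
pose t := Num.min e s / 2; have t0 : 0 < t by rewrite divr_gt0 // lt_min e0.
have [te ts] : t < e /\ t < s.
  have : t * 2 <= Num.min e s by rewrite divfK.
  by rewrite le_min => /andP[? ?]; split; lra.
have E : z + t%:C%C - z = t%:C%C by rewrite addrAC subrr add0r.
have nE : N (z + t%:C%C - z) = t by rewrite E normc_real gtr0_norm.
have := hs (z + t%:C%C); rewrite nE => /(_ ts).
rewrite FG ?nE // ?subrr ?sub0r ?normc_opp; first exact: ltW.
by rewrite -subr_eq0 E -normc_eq0 normc_real gtr0_norm // gt_eqF.
Qed.

End KreinLanger.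

(** * The Blaschke condition *)

Section BlaschkeCondition.
Variable R : realType.
Local Notation C := (complex_complex__canonical__Num_ClosedField R).
Local Notation N := (@Normc.normc R).
Local Notation disk := (unit_disk (C := C)).

Lemma big_uniq_split (T : eqType) (l l0 : seq T) (A : Type) (x1 : A)
    (op : Monoid.com_law x1) (f : T -> A) : uniq l -> uniq l0 -> {subset l <= l0} ->
  \big[op/x1]_(x <- l0) f x =
  op (\big[op/x1]_(x <- l) f x) (\big[op/x1]_(x <- l0 | x \notin l) f x).
Proof.
move=> ul ul0 ll0; rewrite (bigID (fun x => x \in l)) /=; congr (op _ _).
rewrite -big_filter; apply: perm_big; apply: uniq_perm => // [|x].
  exact: filter_uniq.
by rewrite mem_filter andb_idr //; exact: ll0.
Qed.

Lemma sum_uniq_sub (T : eqType) (l l0 : seq T) (f : T -> R) : uniq l -> uniq l0 ->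
  {subset l <= l0} -> (forall x, x \in l0 -> 0 <= f x) ->
  \sum_(x <- l) f x <= \sum_(x <- l0) f x.
Proof.
move=> ul ul0 ll0 f0; rewrite (big_uniq_split _ _ ul ul0 ll0) /= lerDl.
by rewrite big_seq_cond sumr_ge0 // => x /andP[/f0].
Qed.

Lemma prod_unit_interval (T : eqType) (l : seq T) (P : pred T) (f : T -> R) :
  (forall x, x \in l -> 0 <= f x <= 1) -> 0 <= \prod_(x <- l | P x) f x <= 1.
Proof.
move=> fl; rewrite big_seq_cond; elim/big_rec: _ => [|x y /andP[/fl/andP[f0 f1] _] /andP[y0 y1]].
  by rewrite ler01 lexx.
by rewrite mulr_ge0 //= mulr_ile1.
Qed.

Lemma prod_uniq_sub (T : eqType) (l l0 : seq T) (f : T -> R) : uniq l -> uniq l0 ->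
  {subset l <= l0} -> (forall x, x \in l0 -> 0 <= f x <= 1) ->
  \prod_(x <- l0) f x <= \prod_(x <- l) f x.
Proof.
move=> ul ul0 ll0 fl; rewrite (big_uniq_split _ _ ul ul0 ll0) /=.
have /andP[h1 h2] := prod_unit_interval (fun x => x \notin l) fl.
have fl' x : x \in l -> 0 <= f x <= 1 by move=> /ll0 /fl.
have /andP[h3 h4] := prod_unit_interval xpredT fl'.
by rewrite ler_piMr.
Qed.

(** Turns a lower bound on a product into an upper bound on the sum of the
    defects. *)
Lemma prod_sum_le1 (T : eqType) (l : seq T) (f : T -> R) :
  (forall x, x \in l -> 0 <= f x <= 1) ->
  \prod_(x <- l) f x * (1 + \sum_(x <- l) (1 - f x)) <= 1.
Proof.
elim: l => [|x l IH] fl; first by rewrite !big_nil addr0 mulr1.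
rewrite !big_cons; have /andP[f0 f1] := fl x (mem_head _ _).
have fl' y : y \in l -> 0 <= f y <= 1 by move=> yl; apply: fl; rewrite inE yl orbT.
have {}IH := IH fl'; have /andP[p0 p1] := prod_unit_interval xpredT fl'.
have s0 : 0 <= \sum_(j <- l) (1 - f j).
  by rewrite big_seq sumr_ge0 // => y /fl' /andP[_]; rewrite subr_ge0.
set p := \prod_(j <- l) f j in IH p0 p1 *; set s := \sum_(j <- l) _ in IH s0 *.
have h : f x * (1 + (1 - f x + s)) <= 1 + s by nra.
apply: le_trans IH; rewrite mulrAC mulrC ler_wpM2l //.
Qed.

Lemma prod_ge_sum (T : eqType) (l : seq T) (f : T -> R) :
  (forall x, x \in l -> 0 <= f x <= 1) ->
  1 - \sum_(x <- l) (1 - f x) <= \prod_(x <- l) f x.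
Proof.
elim: l => [|x l IH] fl; first by rewrite !big_nil subr0.
rewrite !big_cons; have /andP[f0 f1] := fl x (mem_head _ _).
have fl' y : y \in l -> 0 <= f y <= 1 by move=> yl; apply: fl; rewrite inE yl orbT.
have {}IH := IH fl'; have /andP[p0 p1] := prod_unit_interval xpredT fl'.
set p := \prod_(j <- l) f j in IH p0 p1 *; set s := \sum_(j <- l) _ in IH *.
nra.
Qed.

(** Outside a finite set that carries almost all of the sum of the defects, the
    products are at least one half. *)
Lemma prod_bounded_below (X : set C) (f : C -> R) (M : R) :
  (forall x, X x -> 0 < f x <= 1) ->
  (forall l, uniq l -> (forall x, x \in l -> X x) -> \sum_(x <- l) (1 - f x) <= M) ->
  exists2 del, 0 < del & forall l, uniq l -> (forall x, x \in l -> X x) ->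
    del <= \prod_(x <- l) f x.
Proof.
move=> f01 fM.
pose E := [set s | exists l, [/\ uniq l, (forall x, x \in l -> X x) &
  s = \sum_(x <- l) (1 - f x)]].
have Es : has_sup E.
  split; first by exists 0, [::]; rewrite big_nil.
  by exists M => _ [l [ul lX ->]]; exact: fM.
have h2 : 0 < (2^-1 : R) by rewrite invr_gt0.
have [_ [l0 [ul0 l0X ->]] l0sup] := sup_adherent h2 Es.
have fX (l : seq C) : (forall x, x \in l -> X x) -> forall x, x \in l -> 0 <= f x <= 1.
  by move=> lX x /lX /f01 /andP[/ltW -> ->].
exists (\prod_(x <- l0) f x / 2).
  rewrite divr_gt0 // big_seq prodr_gt0 // => x /l0X /f01 /andP[] //.
move=> l ul lX; pose l1 := [seq x <- l | x \in l0]; pose l2 := [seq x <- l | x \notin l0].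
have -> : \prod_(x <- l) f x = \prod_(x <- l1) f x * \prod_(x <- l2) f x.
  by rewrite !big_filter [LHS](bigID (fun x => x \in l0)).
have l1l0 : {subset l1 <= l0} by move=> x; rewrite mem_filter => /andP[].
have l2X x : x \in l2 -> X x by rewrite mem_filter => /andP[_ /lX].
have p1 := prod_uniq_sub (filter_uniq _ ul) ul0 l1l0 (fX l0 l0X).
have p2 := prod_ge_sum (fX l2 l2X).
have s2 : \sum_(x <- l2) (1 - f x) <= 2^-1.
  have : \sum_(x <- l0 ++ l2) (1 - f x) <= sup E.
    apply: sup_upper_bound => //; exists (l0 ++ l2); split=> // [|x].
      rewrite cat_uniq ul0 filter_uniq // andbT /=; apply/hasPn => x.
      by rewrite mem_filter => /andP[].
    by rewrite mem_cat => /orP[/l0X|/l2X].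
  rewrite big_cat /=; lra.
have p0 : 0 <= \prod_(x <- l0) f x by have /andP[] := prod_unit_interval xpredT (fX l0 l0X).
apply: ler_pM => //; lra.
Qed.

Lemma infinite_set_lists (T : eqType) (A : set T) n : infinite_set A ->
  exists l : seq T, [/\ uniq l, forall x, x \in l -> A x & size l = n].
Proof.
move=> infA; elim: n => [|n [l [ul lA sl]]]; first by exists [::].
have [x [Ax xl]] : exists x, A x /\ x \notin l.
  apply: contrapT => nx; apply: infA.
  have lf : finite_set [set x | x \in l] by apply/finite_seqP; exists l.
  apply: sub_finite_set lf => x Ax /=.
  by apply: contrapT => /negP xl; apply: nx; exists x.
exists (x :: l); split=> /= [|y|]; rewrite ?xl ?sl //.
by rewrite inE => /predU1P[->|/lA].
Qed.

(** If the sums over finite subsets are bounded by [M], at most [M (k + 1)] points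
    have defect larger than [1 / (k + 1)], so the set is countable. *)
Lemma blaschke_sequenceP (Omega : set C) : Omega `<=` disk ->
  blaschke_sequence Omega <->
  exists M : R, forall l, uniq l -> (forall x, x \in l -> Omega x) ->
    \sum_(x <- l) (1 - N x ^+ 2) <= M.
Proof.
move=> OD; have d01 x : Omega x -> 0 < 1 - N x ^+ 2 <= 1.
  move=> /OD; rewrite unit_diskE => x1; have x0 := normc_ge0 x.
  by rewrite subr_gt0 exprn_ilt1 // gerBl exprn_ge0.
have d0 x : Omega x -> 0 <= 1 - N x ^+ 2 by move=> /d01/andP[/ltW].
split=> [[/finite_seqP[s sO]|zP]|[M hM]].
- exists (\sum_(x <- undup s) (1 - N x ^+ 2)) => l ul lO.
  apply: sum_uniq_sub => //; first exact: undup_uniq.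
    by move=> x /lO; rewrite sO /= mem_undup.
  by move=> x; rewrite mem_undup => xs; apply: d0; rewrite sO.
- have {zP} [z [zi zO cv]] : exists z : nat -> C, [/\ injective z, range z = Omega &
    cvgn (series (fun n => 1 - N (z n) ^+ 2))] by case: zP => z; exists z.
  have nd : nondecreasing_seq (series (fun n => 1 - N (z n) ^+ 2)).
    by apply: nondecreasing_series => n _ _; apply: d0; rewrite -zO; exists n.
  exists (limn (series (fun n => 1 - N (z n) ^+ 2))) => l ul lO.
  have [n ln] : exists n, {subset l <= [seq z i | i <- iota 0 n]}.
    elim: l {ul} lO => [|x l IH] lO; first by exists 0%N.
    have [n hn] := IH (fun y yl => lO y (mem_behead (s := x :: l) yl)).
    have := lO x (mem_head _ _); rewrite -zO => -[k _ kx].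
    exists (maxn n k.+1) => y; rewrite inE => /predU1P[->|/hn].
      by rewrite -kx map_f // mem_iota /= add0n leq_maxr.
    move=> /mapP[k' ]; rewrite mem_iota add0n /= => im ->.
    by rewrite map_f // mem_iota add0n /= (leq_trans im) // leq_maxl.
  apply: le_trans (nondecreasing_cvgn_le nd cv n).
  apply: (le_trans (sum_uniq_sub ul _ ln _)).
  - by rewrite map_inj_uniq // iota_uniq.
  - by move=> x /mapP[i _ ->]; apply: d0; rewrite -zO; exists i.
  - by rewrite big_map /series /= /index_iota subn0.
have [fin|inf] := pselect (finite_set Omega); [by left|right].
have Oc : countable Omega.
  pose A k := [set x | Omega x /\ k.+1%:R^-1 < 1 - N x ^+ 2].
  have -> : Omega = \bigcup_k A k.
    apply/seteqP; split=> [x Ox|x [k _ []//]].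
    have /andP[x0 _] := d01 x Ox.
    exists (Num.bound (1 - N x ^+ 2)^-1) => //; split=> //.
    rewrite -[ltRHS]invrK ltf_pV2 ?posrE ?invr_gt0 ?ltr0n //.
    apply: lt_le_trans (archi_boundP _) _; first by rewrite invr_ge0 ltW.
    by rewrite ler_nat.
  apply: bigcup_countable => // k _; apply: finite_set_countable.
  apply: contrapT => infA.
  have [l [ul lA sl]] := infinite_set_lists (Num.bound (M * k.+1%:R)) infA.
  have M0 : 0 <= M by have := hM [::] isT; rewrite big_nil; apply.
  have lO x : x \in l -> Omega x by move=> /lA [].
  have : \sum_(x <- l) (k.+1%:R : R)^-1 <= M.
    apply: le_trans (hM _ ul lO); rewrite big_seq [leRHS]big_seq.
    by apply: ler_sum => x /lA [_ /ltW].
  rewrite big_const_seq count_predT iter_addr_0 sl -[_ *+ Num.bound _]mulr_natl => h.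
  have Mk : 0 <= M * k.+1%:R by rewrite mulr_ge0 ?ler0n.
  have := archi_boundP Mk; rewrite ltNge => /negP; apply.
  by rewrite -ler_pdivrMr ?ltr0n.
have /card_set_bijP[z [zO zi zs]] : ([set: nat] #= Omega)%card.
  by rewrite card_eq_sym eq_card_nat.
have zOm n : Omega (z n) by apply: zO.
exists z; split.
- by move=> i j; apply: zi; rewrite inE.
- by apply/seteqP; split=> [_ [n _ <-]|x /zs[n _ <-]] //; exists n.
apply: nondecreasing_is_cvgn.
  by apply: nondecreasing_series => n _ _; exact: d0.
exists M => _ [n _ <-].
rewrite /series /= /index_iota subn0 -(big_map z xpredT (fun x => 1 - N x ^+ 2)).
apply: hM => [|x /mapP[i _ ->] //].
by rewrite map_inj_uniq ?iota_uniq // => i j; apply: zi; rewrite inE.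
Qed.

Lemma blaschke_defect (a z : C) : disk a -> disk z ->
  (1 - N (blaschke a z) ^+ 2) * N (1 - z * a^*) ^+ 2 =
  (1 - N a ^+ 2) * (1 - N z ^+ 2).
Proof.
move=> da dz; apply: complexI; have := blaschke_norm da dz.
rewrite !normrE => h.
rewrite !(rmorphM, rmorphB, rmorphXn, rmorph1) /= h divfK //.
rewrite expf_neq0 // -normrE normr_eq0.
exact: disk_den.
Qed.

Lemma blaschke_le1 (a z : C) : disk a -> disk z -> N (blaschke a z) ^+ 2 <= 1.
Proof.
move=> da dz; have := schur_le1 dz dz (blaschke_schur da).
rewrite normrE => h; have {}h : N (blaschke a z) <= 1 by rewrite -lecR.
by rewrite exprn_ile1 ?normc_ge0.
Qed.

End BlaschkeCondition.

(** * Zeros of a generalized Schur function *)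

Section Necessity.
Variable R : realType.
Local Notation C := (complex_complex__canonical__Num_ClosedField R).
Local Notation N := (@Normc.normc R).
Local Notation re := (@complex.Re R).
Local Notation disk := (unit_disk (C := C)).
Implicit Types (F g : C -> C) (Omega : set C).

Lemma dominated_div_prod g (c : C) (l : seq C) : 0 <= c -> dominated disk g c ->
  uniq l -> (forall a, a \in l -> disk a) -> (forall a, a \in l -> g a = 0) ->
  dominated [set z | disk z /\ z \notin l] (fun z => g z / blaschke_prod l z) c.
Proof.
move=> c0 gd; elim: l => [|a l IH] /=.
  move=> _ _ _; have -> : (fun z => g z / blaschke_prod [::] z) = g.
    by apply/funext => z; rewrite /blaschke_prod big_nil divr1.
  by apply: dominated_sub gd => z [].
move=> /andP[al ul] ld lg.
have {}IH := IH ul (fun b bl => ld b (mem_behead (s := a :: l) bl))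
  (fun b bl => lg b (mem_behead (s := a :: l) bl)).
have da : disk a by apply: ld; rewrite mem_head.
have ga : g a = 0 by apply: lg; rewrite mem_head.
have XD : [set z | disk z /\ z \notin l] `<=` disk by move=> z [].
have ga' : (fun z => g z / blaschke_prod l z) a = 0 by rewrite ga mul0r.
have := dominated_div XD c0 (conj da al) ga' IH.
have -> : (fun z => g z / blaschke_prod l z / blaschke a z) =
    (fun z => g z / blaschke_prod (a :: l) z).
  by apply/funext => z; rewrite blaschke_prod_cons -mulrA -(invfM (blaschke_prod l z)) [blaschke_prod l z * _]mulrC.
apply: dominated_sub => z [dz]; rewrite inE negb_or => /andP[/eqP za zl].
by split; [split|].
Qed.

Lemma normc_prod (l : seq C) (f : C -> C) :
  N (\prod_(a <- l) f a) ^+ 2 = \prod_(a <- l) N (f a) ^+ 2.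
Proof.
elim: l => [|a l IH]; first by rewrite !big_nil Normc.normc1 expr1n.
by rewrite !big_cons Normc.normcM exprMn IH.
Qed.

(** Dividing by the Blaschke product of finitely many zeros does not increase the
    norm, so the value of this product at a point where the function does not
    vanish is bounded below. *)
Lemma zeros_summable g (Z : set C) (w : C) : dominated disk g 1 -> disk w ->
  g w != 0 -> Z `<=` disk -> (forall z, Z z -> g z = 0) ->
  exists M : R, forall l, uniq l -> (forall x, x \in l -> Z x) ->
    \sum_(x <- l) (1 - N x ^+ 2) <= M.
Proof.
move=> gd dw gw ZD Zg; have w1 : N w < 1 by rewrite -unit_diskE.
have w0 := normc_ge0 w.
have W0 : 0 < 1 - N w ^+ 2 by rewrite subr_gt0 exprn_ilt1.
pose del := N (g w) ^+ 2 * (1 - N w ^+ 2).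
have del0 : 0 < del by rewrite mulr_gt0 // exprn_gt0 // normc_gt0.
exists (4 / (del * (1 - N w ^+ 2))) => l ul lZ.
have ld a : a \in l -> disk a by move=> /lZ/ZD.
have wl : w \notin l by apply: contra gw => /lZ/Zg/eqP.
have Bw : blaschke_prod l w != 0 by rewrite blaschke_prod_eq0.
have NB : 0 < N (blaschke_prod l w) ^+ 2 by rewrite exprn_gt0 // normc_gt0.
have := dominated_norm (conj dw wl) (dominated_div_prod ler01 gd ul ld (fun a al => Zg a (lZ a al))).
rewrite mul1r szego_diag !normrE Normc.normcM Normc.normcV.
rewrite -!rmorphXn -(rmorph1 (real_complex R)) -rmorphB -fmorphV lecR.
rewrite exprMn exprVn ler_pdivrMr // ler_pdivlMl // mulrC => delB.
have f01 a : a \in l -> 0 <= N (blaschke a w) ^+ 2 <= 1.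
  by move=> al; rewrite exprn_ge0 ?normc_ge0 // (blaschke_le1 (ld a al) dw).
have := prod_sum_le1 f01; rewrite -normc_prod -/(blaschke_prod l w).
set s := \sum_(x <- l) _ => ps.
have s0 : 0 <= s.
  by rewrite /s big_seq sumr_ge0 // => a /f01/andP[_]; rewrite subr_ge0.
have dels : del * s <= 1.
  apply: le_trans ps; apply: ler_pM => //; [exact: ltW|by rewrite lerDr].
have sl : \sum_(x <- l) (1 - N x ^+ 2) * (1 - N w ^+ 2) <= 4 * s.
  rewrite mulr_sumr big_seq [leRHS]big_seq; apply: ler_sum => a al.
  rewrite -(blaschke_defect (ld a al) dw) mulrC; have /andP[_ f1] := f01 a al.
  apply: ler_wpM2r; first by rewrite subr_ge0.
  have h : N (1 - w * a^*) <= 2.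
    apply: le_trans (ler_normcB _ _) _; rewrite Normc.normc1 Normc.normcM normc_conj.
    have a1 : N a <= 1 by rewrite ltW // -unit_diskE; exact: ld.
    have := mulr_ile1 w0 (normc_ge0 a) (ltW w1) a1; lra.
  have -> : 4 = 2 ^+ 2 :> R by ring.
  by rewrite lerXn2r ?nnegrE ?normc_ge0.
rewrite -mulr_suml in sl.
rewrite ler_pdivlMr; last exact: mulr_gt0.
rewrite mulrCA; apply: (@le_trans _ _ (del * (4 * s))); first by rewrite ler_wpM2l // ltW.
by rewrite mulrCA -[leRHS]mulr1 ler_wpM2l.
Qed.

Lemma summable_add_point (Omega : set C) (w0 : C) (M : R) :
  (forall l, uniq l -> (forall x, x \in l -> (Omega `\ w0) x) ->
    \sum_(x <- l) (1 - N x ^+ 2) <= M) ->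
  exists M : R, forall l, uniq l -> (forall x, x \in l -> Omega x) ->
    \sum_(x <- l) (1 - N x ^+ 2) <= M.
Proof.
move=> hM; have M0 : 0 <= M by have := hM [::] isT; rewrite big_nil; apply.
exists (1 + M) => l ul lO; rewrite (bigID (pred1 w0)) /=; apply: lerD; last first.
  rewrite -big_filter; apply: hM; first exact: filter_uniq.
  by move=> x; rewrite mem_filter => /andP[/eqP xw /lO].
have [wl|wl] := boolP (w0 \in l); last first.
  rewrite big_seq_cond big1 ?ler01 // => x /andP[xl /eqP xw].
  by move: wl; rewrite -xw xl.
rewrite -big_filter filter_pred1_uniq // big_seq1 gerBl exprn_ge0 // normc_ge0 //.
Qed.

(** The affine factor may vanish at [w0] itself, but not at two nearby points. *)
Lemma nonzero_value F g (a b w0 : C) : (a != 0) || (b != 0) ->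
  dominated disk g 1 -> disk w0 -> holomorphic_at F w0 -> F w0 = 1 ->
  (exists2 e : R, 0 < e &
    forall w, w != w0 -> N (w - w0) < e -> F w * (a + b * w) = g w) ->
  exists2 w, disk w & g w != 0.
Proof.
move=> ab gd dw0 /(nbhs_normcP _ w0)[r r0 hr] Fw0 [e e0 FG].
have [|dF Fz] := derivable_cdiff (hr w0 _); first by rewrite subrr Normc.normc0.
have [s s0 hs] := cdiff_continuous Fz ltr01.
have [t t0 ht] := disk_ball dw0.
pose d := Num.min e (Num.min s t).
have d0 : 0 < d by rewrite !lt_min e0 s0.
have good x : 0 < x -> x < d -> a + b * (w0 + x%:C%C) != 0 -> exists2 w, disk w & g w != 0.
  move=> x0 xd nz; have E : w0 + x%:C%C - w0 = x%:C%C by rewrite addrAC subrr add0r.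
  have nE : N (w0 + x%:C%C - w0) = x by rewrite E normc_real gtr0_norm.
  move: xd; rewrite !lt_min => /andP[xe /andP[xs xt]].
  exists (w0 + x%:C%C); first by apply: ht; rewrite nE.
  rewrite -FG ?nE //; last by rewrite -subr_eq0 E -normc_eq0 normc_real gtr0_norm // gt_eqF.
  rewrite mulf_neq0 //; apply: contraTneq (hs (w0 + x%:C%C) _) => [->|].
    by rewrite Fw0 sub0r normc_opp Normc.normc1 ltxx.
  by rewrite nE.
have d2 : 0 < d / 2 by rewrite divr_gt0.
have d3 : 0 < d / 3 by rewrite divr_gt0.
have [z2|] := eqVneq (a + b * (w0 + (d / 2)%:C%C)) 0; last by apply: good => //; lra.
have [z3|] := eqVneq (a + b * (w0 + (d / 3)%:C%C)) 0; last by apply: good => //; lra.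
have b0 : b = 0.
  have : b * ((d / 2)%:C%C - (d / 3)%:C%C) = 0.
    by rewrite -[RHS](subrr 0) -{1}z2 -z3; ring.
  move/eqP; rewrite mulf_eq0 => /orP[/eqP//|]; rewrite subr_eq0 => /eqP/complexI dd.
  by exfalso; clear -d0 dd; lra.
by move: ab; rewrite b0 eqxx orbF; move: z2; rewrite b0 mul0r addr0 => ->; rewrite eqxx.
Qed.

Lemma restriction_blaschke Omega (w0 : C) (S : C -> C) : Omega `<=` disk ->
  Omega w0 -> S w0 = 1 -> (forall z, Omega z -> z <> w0 -> S z = 0) ->
  restriction_of_generalized_schur 1 Omega S -> blaschke_sequence Omega.
Proof.
move=> OD Ow0 S1 S0 [F [[Fm [U [[Uo _ Une] UD _ [_ Un _]]]] FS]].
have [a [b [g [ab gd gU]]]] := hardy_multiple UD Un.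
have FG := meromorphic_identity Fm gd Uo Une UD gU.
have [Fh0 Fw0] := FS _ Ow0; rewrite S1 in Fw0.
have [w dw gw] := nonzero_value ab gd (OD _ Ow0) Fh0 Fw0 (FG _ (OD _ Ow0)).
have Zg z : (Omega `\ w0) z -> g z = 0.
  move=> [Oz zw]; have [Fh Fz] := FS _ Oz.
  rewrite -(meromorphic_identity_at gd (OD _ Oz) (FG _ (OD _ Oz)) Fh).
  by rewrite Fz S0 // mul0r.
have ZD : Omega `\ w0 `<=` disk by move=> z [/OD].
have [M hM] := zeros_summable gd dw gw ZD Zg.
by apply/(blaschke_sequenceP OD); exact: summable_add_point hM.
Qed.

End Necessity.

(** * Construction of a generalized Schur function *)

Section Sufficiency.
Variable R : realType.
Local Notation C := (complex_complex__canonical__Num_ClosedField R).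
Local Notation N := (@Normc.normc R).
Local Notation disk := (unit_disk (C := C)).
Implicit Types (F B : C -> C) (Omega : set C).

(** A substitute for an infinite Blaschke product: a limit of the products over
    finite subsets.  It vanishes where required and stays in the Schur class;
    its value at [w0] is nonzero by the Blaschke condition. *)
Lemma blaschke_function (Z : set C) (w0 : C) (M : R) : Z `<=` disk -> disk w0 ->
  ~ Z w0 ->
  (forall l, uniq l -> (forall x, x \in l -> Z x) ->
     \sum_(x <- l) (1 - N x ^+ 2) <= M) ->
  exists B, [/\ psd disk (schur_kernel B), forall z, Z z -> B z = 0 & B w0 != 0].
Proof.
move=> ZD dw0 Zw0 hM.
have w01 : N w0 < 1 by rewrite -unit_diskE.
pose m := (1 - N w0) ^+ 2.
have m0 : 0 < m by rewrite exprn_gt0 // subr_gt0.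
have f01 x : Z x -> 0 < N (blaschke x w0) ^+ 2 <= 1.
  move=> Zx; rewrite (blaschke_le1 (ZD x Zx) dw0) andbT exprn_gt0 // normc_gt0.
  rewrite blaschke_eq0 //; last exact: ZD.
  by apply: contra_notN Zw0 => /eqP->.
have fM l : uniq l -> (forall x, x \in l -> Z x) ->
    \sum_(x <- l) (1 - N (blaschke x w0) ^+ 2) <= M / m.
  move=> ul lZ; rewrite ler_pdivlMr //; apply: le_trans (hM l ul lZ).
  rewrite mulr_suml big_seq [leRHS]big_seq; apply: ler_sum => x xl.
  have dx := ZD x (lZ x xl); have /andP[_ f1] := f01 x (lZ x xl).
  have x1 : N x < 1 by rewrite -unit_diskE.
  have N0 := normc_ge0 w0; have X0 := normc_ge0 x.
  apply: (@le_trans _ _ ((1 - N x ^+ 2) * (1 - N w0 ^+ 2))); last first.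
    by rewrite ler_piMr ?subr_ge0 ?exprn_ile1 ?(ltW x1) // gerBl exprn_ge0.
  rewrite -(blaschke_defect dx dw0) ler_wpM2l ?subr_ge0 //.
  have h : 1 - N w0 <= N (1 - w0 * x^*).
    have := ler_normcD (1 - w0 * x^*) (w0 * x^*).
    rewrite subrK Normc.normc1 Normc.normcM normc_conj => h.
    have : N w0 * N x <= N w0 by rewrite ler_piMr // ltW.
    lra.
  rewrite /m lerXn2r // ?nnegrE ?normc_ge0 //; lra.
have [del del0 hdel] := prod_bounded_below f01 fM.
have [G [GU Gl Gx]] := finite_lists_ultra Z.
have GF := @ultra_proper _ _ GU; have GFF : Filter G by exact: filter_filter.
have Bpsd l : (forall x, x \in l -> Z x) -> psd disk (schur_kernel (blaschke_prod l)).
  by move=> lZ; apply: blaschke_prod_schur => a /lZ /ZD.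
have [|B BG] := @ultra_pointwise_limit R _ G GU (@blaschke_prod C) (fun=> 1) disk.
  move=> z dz; apply: filterS Gl => l [ul lZ].
  have := schur_le1 dz dz (Bpsd l lZ).
  by rewrite normrE /= => h; rewrite -lecR.
exists B; split.
- apply: (schur_limit GF BG); apply: filterS Gl => l [_ lZ]; exact: Bpsd.
- move=> z Zz; apply/eqP; rewrite -normc_eq0 eq_le normc_ge0 andbT.
  apply: (cvg_normc_le GF (BG z (ZD z Zz))).
  apply: filterS (filterI Gl (Gx z Zz)) => l [[ul lZ] zl].
  suff -> : blaschke_prod l z = 0 by rewrite Normc.normc0.
  apply/eqP; rewrite blaschke_prod_eq0 //; last exact: ZD.
  by move=> a /lZ /ZD.
- apply/negP => /eqP B0.
  have e0 : 0 < Num.min 1 del by rewrite lt_min ltr01.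
  have B0cv := (@cvg_normcP R _ G GFF (fun l => blaschke_prod l w0) (B w0)).1 (BG w0 dw0) _ e0.
  have [l [[ul lZ] /= lb]] := @filter_ex _ G GF _ (filterI Gl B0cv).
  rewrite B0 subr0 lt_min in lb; move/andP: lb => [lb1 lb2].
  have := hdel l ul lZ; rewrite -normc_prod -/(blaschke_prod l w0).
  have n0 := normc_ge0 (blaschke_prod l w0).
  by apply/negP; rewrite -ltNge; nra.
Qed.

Lemma derivable_div (p q : C -> C) (z : C) : derivable p z 1 -> derivable q z 1 ->
  q z != 0 -> derivable (fun w => p w / q w) z 1.
Proof.
move=> pz qz q0; have qVz : derivable (fun w => (q w)^-1) z 1 by exact: derivableV.
exact: (derivableM pz qVz).
Qed.

Lemma schur_cst (c : C) : `|c| <= 1 -> psd disk (schur_kernel (fun=> c)).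
Proof.
move=> c1; have c2 : 0 <= 1 - `|c| ^+ 2 by rewrite subr_ge0 exprn_ile1.
have := psdZ c2 (@szego_psd C); apply: eq_psd => w z _ _.
by rewrite /schur_kernel /szego normCK.
Qed.

(** Up to a rescaling, the kernel of the quotient is that of [g] minus that of the
    Blaschke factor, and the latter has rank one. *)
Lemma schur_over_blaschke (g : C -> C) (al : C) (X : set C) F : disk al ->
  X `<=` disk -> ~ X al -> psd disk (schur_kernel g) ->
  (forall z, X z -> F z = g z / blaschke al z) ->
  forall n (w : 'I_n -> C), (forall i, X (w i)) ->
    (num_neg_eigenvalues (kernel_matrix (schur_kernel F) w) <= 1)%N.
Proof.
move=> dal XD Xal gp FE.
pose be z := (blaschke al z)^-1.
pose r := sqrtC (1 - al * al^*).
have rr : r * r^* = 1 - al * al^*.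
  rewrite -normCK ger0_norm ?sqrtC_ge0 ?ltW ?disk_1subnorm //.
  by rewrite sqrtCK.
apply: (rank1_perturbation (schur_kernel_hermitian F)
  (K1 := fun w z => be z * (be w)^* * schur_kernel g w z)
  (g := fun z => r * szego al z * be z)).
  exact: psd_rescale (psd_sub XD gp).
move=> w z Xw Xz; have dw := XD w Xw; have dz := XD z Xz.
have nz x : X x -> blaschke al x != 0.
  move=> Xx; rewrite blaschke_eq0 //; last exact: XD.
  by apply: contra_notN Xal => /eqP <-.
have -> : r * szego al z * be z * (r * szego al w * be w)^* =
    be z * (be w)^* * schur_kernel (blaschke al) w z.
  by rewrite blaschke_kernel // -rr !rmorphM /=; ring.
rewrite -mulrBr /schur_kernel -mulrBl mulrA; congr (_ / _).
rewrite !FE // rmorphM fmorphV /= /be fmorphV /=.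
have n1 := nz z Xz; have n2 : (blaschke al w)^* != 0 by rewrite conjC_eq0; exact: nz.
by move: (blaschke al z) (blaschke al w)^* n1 n2 => b b' n1 n2; field; rewrite n1 n2.
Qed.

(** The function is a multiple of [B / b], where [B] vanishes on [Omega] except at
    [w0] and [b] is the Blaschke factor of a pole near [w0].  A suitable pole
    makes the multiple normalized at [w0] again a Schur function over [b], and
    near the pole the modulus exceeds one, which gives the negative square. *)
Lemma blaschke_restriction Omega (w0 : C) (S : C -> C) : Omega `<=` disk ->
  Omega w0 -> S w0 = 1 -> (forall z, Omega z -> z <> w0 -> S z = 0) ->
  blaschke_sequence Omega -> restriction_of_generalized_schur 1 Omega S.
Proof.
move=> OD Ow0 S1 S0 /(blaschke_sequenceP OD)[M hM].
have dw0 := OD _ Ow0.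
have ZD : Omega `\ w0 `<=` disk by move=> z [/OD].
have [|l ul lZ|B [Bp BZ Bw0]] := @blaschke_function (Omega `\ w0) w0 M ZD dw0.
- by move=> [_]; apply.
- by apply: hM => // x /lZ[].
have Bd z : disk z -> exists d, cdiff B z d.
  by move=> dz; apply: dominated_cdiff ler01 (schur_dominated Bp) dz.
have w01 : N w0 < 1 by rewrite -unit_diskE.
have NB0 : 0 < N (B w0) by rewrite normc_gt0.
(* the pole: so close to w0 that B does not vanish there and that the Blaschke
   factor of the pole is at most |B| at w0 *)
have [al [dal alw0 Bal bal]] : exists al, [/\ disk al, al != w0, B al != 0 &
    N (blaschke al w0) <= N (B w0)].
  have [d Bw] := Bd _ dw0; have [s s0 hs] := cdiff_continuous Bw NB0.
  have [t t0 ht] := disk_ball dw0.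
  have u0 : 0 < N (B w0) * (1 - N w0) by rewrite mulr_gt0 // subr_gt0.
  pose x := Num.min s (Num.min t (N (B w0) * (1 - N w0))) / 2.
  have x0 : 0 < x by rewrite divr_gt0 // !lt_min s0 t0 u0.
  have [xs xt xu] : [/\ x < s, x < t & x < N (B w0) * (1 - N w0)].
    have : x * 2 <= Num.min s (Num.min t (N (B w0) * (1 - N w0))) by rewrite divfK.
    by rewrite !le_min => /andP[h1 /andP[h2 h3]]; split; lra.
  pose al := w0 + x%:C%C; have E : al - w0 = x%:C%C by rewrite /al addrAC subrr add0r.
  have nE : N (al - w0) = x by rewrite E normc_real gtr0_norm.
  have dal : disk al by apply: ht; rewrite nE.
  have al1 : N al < 1 by rewrite -unit_diskE.
  exists al; split=> //.
  - by rewrite -subr_eq0 -normc_eq0 nE gt_eqF.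
  - apply: contraTneq (hs al _) => [->|]; last by rewrite nE.
    by rewrite sub0r normc_opp ltxx.
  rewrite /blaschke Normc.normcM Normc.normcV normc_sub nE ler_pdivrMr; last first.
    by rewrite normc_gt0; exact: disk_den.
  apply: le_trans (ltW xu) _; rewrite ler_wpM2l ?normc_ge0 //.
  have := ler_normcD (1 - w0 * al^*) (w0 * al^*).
  rewrite subrK Normc.normc1 Normc.normcM normc_conj => h.
  have : N w0 * N al <= N w0 by rewrite ler_piMr ?normc_ge0 // ltW.
  lra.
have bw0 : blaschke al w0 != 0 by rewrite blaschke_eq0 // eq_sym.
pose c := blaschke al w0 / B w0.
have c0 : c != 0 by rewrite mulf_neq0 // invr_eq0.
have c1 : `|c| <= 1.
  rewrite normrE -(rmorph1 (real_complex R)) lecR /c Normc.normcM Normc.normcV.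
  by rewrite ler_pdivrMr // mul1r.
pose g z := c * B z.
have gp : psd disk (schur_kernel g) := schur_mul (schur_cst c1) Bp.
pose G z := g z * (1 + (- al^*) * z).
pose F z := G z / (z - al) ^+ 1.
have FE z : F z = g z / blaschke al z.
  rewrite /F /G /blaschke invfM invrK expr1 mulrAC mulrA mulNr [al^* * z]mulrC.
  by rewrite mulrAC.
have Gd z : disk z -> derivable G z 1.
  move=> dz; have [d /cdiff_derivable Bz] := Bd z dz.
  have cz : derivable (fun=> c : C) z 1 by exact: derivable_cst.
  have az : derivable (fun w : C => 1 + (- al^*) * w) z 1 by exact: derivable_affine.
  exact: (derivableM (derivableM cz Bz) az).
have Fd z : disk z -> z != al -> derivable F z 1.
  move=> dz zal; have xz : derivable (fun w : C => (w - al) ^+ 1) z 1.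
    exact: derivable_subXn.
  have x0 : (z - al) ^+ 1 != 0 by rewrite expr1 subr_eq0.
  exact: (derivable_div (p := G) (q := fun w => (w - al) ^+ 1) (Gd z dz) xz x0).
have Gh z : disk z -> holomorphic_at G z.
  move=> dz; have [t t0 ht] := disk_ball dz.
  by apply/(nbhs_normcP _ z); exists t => // w /ht /Gd.
have Fh z : disk z -> z != al -> holomorphic_at F z.
  move=> dz zal; have [t t0 ht] := disk_ball dz.
  apply/(nbhs_normcP _ z); exists (Num.min t (N (z - al))).
    by rewrite lt_min t0 normc_gt0 subr_eq0.
  move=> w; rewrite lt_min => /andP[wt wal]; apply: Fd; first exact: ht.
  by apply: contraTneq wal => ->; rewrite normc_sub ltxx.
exists F; split; last first.
  move=> z Oz; have dz := OD _ Oz; have [->|zw0] := eqVneq z w0.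
    split; first by apply: Fh; rewrite // eq_sym.
    by rewrite FE S1 /g /c divfK // divff.
  have Zz : (Omega `\ w0) z by split=> //; exact/eqP.
  split; last by rewrite FE /g BZ // mulr0 mul0r S0 //; exact/eqP.
  by apply: Fh => //; apply: contraNneq Bal => <-; rewrite BZ.
split.
  move=> a da; have [->|aal] := eqVneq a al.
    by exists 1%N, G; split; [exact: Gh|exact: nearW].
  exists 0%N, F; split; first exact: Fh.
  by apply: nearW => z; rewrite expr0 divr1.
have Gal : G al != 0.
  have h : 1 + (- al^*) * al != 0 by rewrite mulNr [al^* * al]mulrC; exact: disk_den.
  by rewrite /G /g; apply: mulf_neq0 h; exact: mulf_neq0.
have NG : 0 < N (G al) / 2 by rewrite divr_gt0 // normc_gt0.
have [dG Gcd] := derivable_cdiff (Gd al dal).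
have [s s0 hs] := cdiff_continuous Gcd NG.
have [t t0 ht] := disk_ball dal.
(* a point u so close to the pole that |F u| > 1; the largest disk around u
   that avoids the pole serves as the region *)
pose x := Num.min (Num.min s t) (N (G al) / 2) / 4.
have x0 : 0 < x by rewrite divr_gt0 // !lt_min s0 t0 NG.
have [xs xt xG] : [/\ x < s, 2 * x < t & x < N (G al) / 2].
  have : x * 4 <= Num.min (Num.min s t) (N (G al) / 2) by rewrite divfK.
  by rewrite !le_min => /andP[/andP[h1 h2] h3]; split; lra.
pose u := al + x%:C%C.
have uE : u - al = x%:C%C by rewrite /u addrAC subrr add0r.
have nu : N (u - al) = x by rewrite uE normc_real gtr0_norm.
have UD : [set z : C | N (z - u) < x] `<=` disk.
  move=> z /= zu; apply: ht; have := ler_normc_tri z al u; lra.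
have Ual : ~ [set z : C | N (z - u) < x] al by rewrite /= normc_sub nu ltxx.
have Uu : [set z : C | N (z - u) < x] u by rewrite /= subrr Normc.normc0.
exists [set z : C | N (z - u) < x]; split=> //.
- split; [|exact: ball_connected|by exists u].
  rewrite openE => z /= zu; apply/(nbhs_normcP _ z).
  exists (x - N (z - u)); first by rewrite subr_gt0.
  by move=> w wz /=; have := ler_normc_tri w u z; lra.
- move=> z zU; apply: Fh; first exact: UD.
  by apply/eqP => zal; apply: Ual; rewrite -zal.
apply: has_neg_square1 (schur_kernel_hermitian F) _ _.
  by apply: (schur_over_blaschke dal UD Ual gp) => z _; exact: FE.
exists [:: (1, u)]; first by move=> p; rewrite inE => /eqP->.
rewrite form11 /= rmorph1 !mul1r /schur_kernel -!normCK.
have du := UD u Uu.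
rewrite pmulr_llt0; last first.
  by rewrite invr_gt0 normCK; exact: disk_1subnorm.
have Fu : 1 < N (F u).
  rewrite /F expr1 Normc.normcM Normc.normcV nu ltr_pdivlMr // mul1r.
  have := hs u; rewrite nu => /(_ xs) hGu.
  have := ler_normc_tri (G al) 0 (G u); rewrite !subr0 (normc_sub (G al)); lra.
rewrite subr_lt0 normrE -rmorphXn -(rmorph1 (real_complex R)) ltcR.
by rewrite exprn_egt1.
Qed.

End Sufficiency.

(** * The function supported at one point *)

(** On [Omega] the kernel is the Szego kernel minus its value at [w0], placed at
    the single entry [(w0, w0)]; there it vanishes, which a second point turns
    into a negative direction. *)
Lemma point_kernel_neg_square (C : numClosedFieldType) (Omega : set C) (w0 : C)
    (S : C -> C) : Omega `<=` unit_disk (C := C) -> Omega w0 ->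
  (exists2 w1, Omega w1 & w1 <> w0) -> S w0 = 1 ->
  (forall z, Omega z -> z <> w0 -> S z = 0) ->
  has_neg_squares Omega (schur_kernel S) 1.
Proof.
move=> OD Ow0 [w1 Ow1 w10] S1 S0.
have k0 := szego_diag_gt0 (OD _ Ow0).
pose r := sqrtC (szego w0 w0).
have rr : r * r^* = szego w0 w0.
  by rewrite -normCK ger0_norm ?sqrtC_ge0 ?ltW // sqrtCK.
apply: has_neg_square1; first exact: schur_kernel_hermitian.
  apply: (rank1_perturbation (schur_kernel_hermitian S)
    (K1 := szego) (g := fun z => S z * r)).
    exact: psd_sub OD (@szego_psd C).
  move=> w z Ow Oz; rewrite schur_kernelE; congr (_ - _).
  have [->|/eqP zw] := eqVneq z w0; last by rewrite (S0 z Oz zw) !mul0r.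
  have [->|/eqP ww] := eqVneq w w0; last by rewrite (S0 w Ow ww) mul0r !rmorph0 !mulr0 mul0r.
  by rewrite S1 !mul1r rmorph1 mul1r rr.
(* the form at (alpha, 1) is alpha * b^* + alpha^* * b + k, with b and k the
   values of the kernel at (w0, w1) and at (w1, w1); take alpha = - k / b^* *)
pose b := szego w0 w1; pose k := szego w1 w1.
have k1 : 0 < k := szego_diag_gt0 (OD _ Ow1).
have b0 : b != 0 by rewrite invr_eq0; apply: disk_den; exact: OD.
have bc0 : b^* != 0 by rewrite conjC_eq0.
exists [:: (- k / b^*, w0); (1, w1)].
  by move=> p; rewrite !inE => /orP[]/eqP->.
have K00 : schur_kernel S w0 w0 = 0.
  by rewrite schur_kernelE S1 rmorph1 !mul1r subrr.
have K01 : schur_kernel S w0 w1 = b.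
  by rewrite schur_kernelE (S0 _ Ow1 w10) !mul0r subr0.
have K10 : schur_kernel S w1 w0 = b^* by rewrite schur_kernel_conj K01.
have K11 : schur_kernel S w1 w1 = k.
  by rewrite schur_kernelE (S0 _ Ow1 w10) !mul0r subr0.
clearbody b k; rewrite /form !big_cons !big_nil /= K00 K01 K10 K11.
rewrite !mulr0 !add0r !addr0 rmorph1 !mulr1 rmorphM fmorphV rmorphN /= conjCK.
rewrite (CrealP (gtr0_real k1)) divfK // !mul1r divfK //.
by rewrite addNr addr0 oppr_lt0.
Qed.

Theorem proposition1p1 (R : realType) (Omega : set R[i]) (w0 : R[i])
    (S : R[i] -> R[i])
    (Omega_disk : Omega `<=` unit_disk (C := R[i]))
    (Omega_w0 : Omega w0)
    (Omega_other : exists2 w1, Omega w1 & w1 <> w0)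
    (S_w0 : S w0 = 1)
    (S_other : forall z, Omega z -> z <> w0 -> S z = 0) :
  has_neg_squares (C := R[i]) Omega (schur_kernel (C := R[i]) S) 1 /\
  (restriction_of_generalized_schur (C := R[i]) 1 Omega S <->
   blaschke_sequence Omega).
Proof.
split; first exact: point_kernel_neg_square Omega_disk Omega_w0 Omega_other S_w0 S_other.
split; first exact: restriction_blaschke Omega_disk Omega_w0 S_w0 S_other.
exact: blaschke_restriction Omega_disk Omega_w0 S_w0 S_other.
Qed.
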